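(* Assume that: (1) the matrices $H(\theta)$ and $H(\theta)-K_0(\theta)L(\theta)$ are stable for $\theta\in G_\theta$; (2) $\int_{|x|\ge 1}|x|^q\,\nu(dx)<\infty$ for all $q\ge 1$, and $\mathbb{E}[\Delta Z_n]=0$; (3) for each $\theta\in D_\theta$ the equation $W_{E,\eta}(\theta,\eta)=0$ (in the unknown $\eta$) has a unique solution in $D_\eta^*$. Then, for fixed $\theta\in D_\theta$, $$\hat\eta_N(\theta)-\eta^*(\theta)=-\bigl(R_E^*(\theta)\bigr)^{-1}V_{E,N,\eta}(\theta,\eta^*(\theta))+O_M(N^{-1}).$$
   Context: **Model.** $(Z_t)_{t\in\mathbb{R}}$, $Z_0=0$, is a real Lévy process whose Lévy measure $\nu(dx)=\nu(dx,\eta^* )$ satisfies $\int\min(|x|,1)\,\nu(dx)<\infty$, and $\mathbb{E}e^{iuZ_t}=\exp[t(ibu+\int(e^{iux}-1)\nu(dx))]$ with drift $b$. For a fixed $h>0$, $\Delta Z_n$, $n\in\mathbb{Z}$, is the increment of $Z$ over $[(n-1)h,nh)$. The vector $\eta^*\in\mathbb{R}^r$ is the true noise parameter, and $\varphi(u,\eta)$ is the (known) characteristic function of $\Delta Z_n$ when the noise parameter is $\eta$. The observed scalar process is $$\Delta y_n=A(\theta^*,q^{-1})\Delta Z_n,\qquad -\infty<n<\infty,$$ where $\theta^*$ is the true system parameter, $q^{-1}$ is the backward shift and $A(\theta,q^{-1})$ is a rational transfer function with state space representation in innovation form $\Delta X_{n+1}=H(\theta)\Delta X_n+K_0(\theta)\Delta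 Z_n$, $\Delta Y_n=L(\theta)\Delta X_n+\Delta Z_n$. A matrix is stable if all its eigenvalues lie in the open unit disc. $A(\theta,q^{-1})$ is three times continuously differentiable in $\theta$ for $\theta\in D_\theta$. **Parameter domains.** $G_\theta\subset\mathbb{R}^p$ and $G_\eta\subset\mathbb{R}^r$ are known sets. $D_\theta,D_\theta^*$ are compact domains with $\theta^*\in D_\theta^*\subset\mathrm{int}\,D_\theta$ and $D_\theta\subset G_\theta$; analogously $D_\eta,D_\eta^*$ are compact domains with $\eta^*\in D_\eta^*\subset\mathrm{int}\,D_\eta$ and $D_\eta\subset G_\eta$. **Estimated innovations.** $\varepsilon_n(\theta)=A^{-1}(\theta,q^{-1})\Delta y_n$, the filter being started at time $0$ with zero initial conditions. The superscript $(s)$ denotes stationary versions, obtained by starting the filter at $-\infty$ instead. **Scores, cost and estimator.** Fix real numbers $u_1,\dots,u_M$ with $NM\ge\dim\eta$, and put $$h_{k,n}(\theta,\eta)=e^{iu_k\varepsilon_n(\theta)}-\varphi(u_k,\eta),\quad h_n=(h_{1,n},\dots,h_{M,n})^T,\quad \overline h_N(\theta,\eta)=\frac1N\sum_{n=1}^N h_n(\theta,\eta).$$ Let $K$ be a symmetric positive definite $M\times M$ weighting matrix. The cost function is $V_{E,N}(\theta,\eta)=|K^{-1/2}\overline h_N(\theta,\eta)|^2$, and the asymptotic cost function is $W_E(\theta,\eta)=\mathbb{E}|K^{-1/2}h_n^{(s)}(\theta,\eta)|^2$, where $h_n^{(s)}$ is $h_n$ with $\varepsilon_n$ replaced by $\varepsilon_n^{(s)}$.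 Subscripts $\eta$ and $\eta\eta$ denote gradient and Hessian in $\eta$. The estimator $\hat\eta_N(\theta)$ is obtained as the solution $\eta$ of $V_{E,N,\eta}(\theta,\eta)=0$. For each fixed $\theta$, $\eta^*(\theta)$ is the solution of $W_{E,\eta}(\theta,\eta^*(\theta))=0$ provided by assumption (3), and $R_E^*(\theta)=W_{E,\eta\eta}(\theta,\eta^*(\theta))$. **Notation $O_M$.** For a stochastic process $X_n$ and $f:\mathbb{Z}\to\mathbb{R}^+$, $X_n=O_M(f(n))$ means $\sup_n \mathbb{E}^{1/q}|X_n|^q/f(n)<\infty$ for all $q\ge1$.
   Formalization: Added: φ(u_k,·) is C³ in η near D_η (without smoothness the O_M(1/N) remainder can fail) and R_E^*(θ) is invertible. The estimator is a D_η-valued solution whenever one exists; among several it is in D_η^* or nearest to it (an arbitrary zero may stay away from η^* ). *)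

(* Defs.v *)
From HB Require Import structures.
From mathcomp Require Import all_boot all_order all_algebra.
From mathcomp Require Import all_classical all_reals all_analysis.
From mathcomp Require Import complex.
Set Implicit Arguments.
Unset Strict Implicit.
Unset Printing Implicit Defensive.
Import Order.TTheory GRing.Theory Num.Theory.
Import numFieldNormedType.Exports.
Import Normc.

Local Open Scope classical_set_scope.
Local Open Scope ring_scope.

Section EuclideanCalculus.
Context {R : realType}.

Definition enorm {n} (x : 'cV[R]_n) : R := Num.sqrt (\sum_i x i 0 ^+ 2).

Definition dist_to {n} (A : set 'cV[R]_n) (x : 'cV[R]_n) : R :=
  inf [set enorm (x - y) | y in A].

(* The Euclidean norm of a complex vector, squared. *)
Definition csqnorm {n} (v : 'cV[R[i]]_n) : R := \sum_k normc (v k 0) ^+ 2.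

Definition partial {n} (f : 'cV[R]_n -> R) (i : 'I_n) (x : 'cV[R]_n) : R :=
  'D_(delta_mx i 0) f x.

Definition gradient {n} (f : 'cV[R]_n -> R) (x : 'cV[R]_n) : 'cV[R]_n :=
  \col_i partial f i x.

Definition hessian {n} (f : 'cV[R]_n -> R) (x : 'cV[R]_n) : 'M[R]_n :=
  \matrix_(i, j) partial (partial f i) j x.

Fixpoint ck {n} (k : nat) (U : set 'cV[R]_n) (f : 'cV[R]_n -> R) : Prop :=
  (forall x, U x -> {for x, continuous f}) /\
  match k with
  | 0 => True
  | k'.+1 => forall i : 'I_n,
      (forall x, U x -> derivable f x (delta_mx i 0)) /\ ck k' U (partial f i)
  end.

(* On a set D which need not be open, C^k means C^k on a neighbourhood of D. *)
Definition ck_on {n} (k : nat) (D : set 'cV[R]_n) (f : 'cV[R]_n -> R) : Prop :=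
  exists U : set 'cV[R]_n, [/\ open U, D `<=` U & ck k U f].

Definition cck_on {n} (k : nat) (D : set 'cV[R]_n) (f : 'cV[R]_n -> R[i]) :
    Prop :=
  ck_on k D (fun x => complex.Re (f x)) /\ ck_on k D (fun x => complex.Im (f x)).

(* A domain is a nonempty connected open set; a compact domain is the closure
   of a domain, when that closure is compact. *)
Definition compact_domain {n} (D : set 'cV[R]_n) : Prop :=
  compact D /\
  exists U : set 'cV[R]_n, [/\ open U, connected U, U !=set0 & D = closure U].

Definition sym_posdef {n} (K : 'M[R]_n) : Prop :=
  K^T = K /\ forall v : 'cV[R]_n, v != 0 -> 0 < (v^T *m K *m v) 0 0.

(* K^{-1/2} *)
Definition inv_sqrtmx {n} (K : 'M[R]_n) : 'M[R]_n :=
  xget 0 [set S | sym_posdef S /\ S *m S = invmx K].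

Definition cmx {m n} (A : 'M[R]_(m, n)) : 'M[R[i]]_(m, n) :=
  map_mx (fun x => x%:C%C) A.

Definition stable_mx {n} (F : 'M[R]_n) : Prop :=
  forall z : R[i], eigenvalue (cmx F) z -> normc z < 1.

Definition cis (x : R) : R[i] := Complex (cos x) (sin x).

Definition cexp (z : R[i]) : R[i] := (expR (complex.Re z))%:C%C * cis (complex.Im z).

Definition cintegral {d} {T : measurableType d}
    (mu : {measure set T -> \bar R}) (f : T -> R[i]) : R[i] :=
  Complex (Rintegral mu setT (fun x => complex.Re (f x)))
          (Rintegral mu setT (fun x => complex.Im (f x))).

End EuclideanCalculus.

Section LevyProcess.
Context {R : realType}.

Definition levy_measure (nu : {measure set R -> \bar R}) : Prop :=
  nu [set 0] = 0%E /\
  (\int[nu]_x (Num.min `|x| 1)%:E < +oo)%E.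

Definition levy_exponent (b : R) (nu : {measure set R -> \bar R}) (u : R) :
    R[i] :=
  Complex 0 (b * u) + cintegral nu (fun x => cis (u * x) - 1).

Context {d : measure_display} {Omega : measurableType d}.
Variable P : probability Omega R.

Definition mutually_independent {n} (X : 'I_n -> Omega -> R) : Prop :=
  forall B : 'I_n -> set R, (forall i, measurable (B i)) ->
    P [set w | forall i, B i (X i w)] =
    (\prod_i fine (P [set w | B i (X i w)]))%:E.

(* The drift/Lévy measure representation of E exp(iuZ_t) is that of t >= 0; for
   t < 0 the law of Z_t is determined by stationarity of the increments. *)
Definition levy_process (b : R) (nu : {measure set R -> \bar R})
    (Z : R -> {RV P >-> R}) : Prop :=
  [/\ {ae P, forall w, Z 0 w = 0},
      {ae P, forall w, forall t : R,
         Z s w @[s --> t^'+] --> (Z t w : R) /\ cvg (Z s w @[s --> t^'-])},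
      forall (n : nat) (t : nat -> R), {homo t : i j / (i <= j)%N >-> i <= j} ->
        mutually_independent (fun (i : 'I_n) w => Z (t i.+1) w - Z (t i) w),
      forall (s t : R) (B : set R), 0 <= s -> measurable B ->
        P [set w | B (Z (t + s) w - Z t w)] = P [set w | B (Z s w)] &
      forall t u : R, 0 <= t ->
        cintegral P (fun w => cis (u * Z t w)) =
        cexp (t%:C%C * levy_exponent b nu u)].

Definition increment (Z : R -> {RV P >-> R}) (h : R) (n : int) (w : Omega) : R :=
  Z (n%:~R * h) w - Z ((n - 1)%:~R * h) w.

End LevyProcess.

(* The linear filter X_{n+1} = F X_n + G x_n, y_n = C X_n + x_n. *)
Section Filter.
Context {R : realType} {m : nat}.
Variables (F : 'M[R]_m) (G : 'cV[R]_m) (C : 'rV[R]_m) (x : int -> R).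

(* The state at time n0 + k, from the zero state at time n0. *)
Fixpoint filter_state (n0 : int) (k : nat) : 'cV[R]_m :=
  match k with
  | 0 => 0
  | k'.+1 => F *m filter_state n0 k' + x (n0 + k'%:Z) *: G
  end.

(* The output at time n0 + k. *)
Definition filter_from (n0 : int) (k : nat) : R :=
  (C *m filter_state n0 k) 0 0 + x (n0 + k%:Z).

(* The output at time n of the filter started at -oo. *)
Definition filter_stationary (n : int) : R :=
  lim (filter_from (n - k%:Z) k @[k --> \oo]).

(* The transfer function, w standing for the backward shift. *)
Definition transfer (w : R[i]) : R[i] :=
  1 + w * (cmx C *m invmx (1%:M - w *: cmx F) *m cmx G) 0 0.

End Filter.

Section ECF.
Context {R : realType} {p r m M : nat}.
Variables (H : 'cV[R]_p -> 'M[R]_m) (K0 : 'cV[R]_p -> 'cV[R]_m)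
  (L : 'cV[R]_p -> 'rV[R]_m).

Definition observed (theta : 'cV[R]_p) (dZ : int -> R) : int -> R :=
  filter_stationary (H theta) (K0 theta) (L theta) dZ.

(* The inverse of the system X_{n+1} = H X_n + K0 z_n, y_n = L X_n + z_n is
   X_{n+1} = (H - K0 L) X_n + K0 y_n, z_n = - L X_n + y_n. *)
Definition innovation (theta : 'cV[R]_p) (dy : int -> R) (n : nat) : R :=
  filter_from (H theta - K0 theta *m L theta) (K0 theta) (- L theta) dy 0 n.

Definition innovation_stationary (theta : 'cV[R]_p) (dy : int -> R) (n : int) :
    R :=
  filter_stationary (H theta - K0 theta *m L theta) (K0 theta) (- L theta) dy n.

Definition noise_cf (h : R) (b : 'cV[R]_r -> R)
    (nu : 'cV[R]_r -> {measure set R -> \bar R}) (u : R) (eta : 'cV[R]_r) :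
    R[i] :=
  cexp (h%:C%C * levy_exponent (b eta) (nu eta) u).

Variables (u : 'I_M -> R) (phi : R -> 'cV[R]_r -> R[i]) (K : 'M[R]_M).

Definition score (e : R) (eta : 'cV[R]_r) : 'cV[R[i]]_M :=
  \col_k (cis (u k * e) - phi (u k) eta).

(* |K^{-1/2} v|^2 *)
Definition weighted_sqnorm (v : 'cV[R[i]]_M) : R :=
  csqnorm (cmx (inv_sqrtmx K) *m v).

Definition score_mean (dy : int -> R) (N : nat) (theta : 'cV[R]_p)
    (eta : 'cV[R]_r) : 'cV[R[i]]_M :=
  N%:R^-1 *: \sum_(1 <= n < N.+1) score (innovation theta dy n) eta.

(* V_{E,N} *)
Definition cost (dy : int -> R) (N : nat) (theta : 'cV[R]_p) (eta : 'cV[R]_r) :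
    R :=
  weighted_sqnorm (score_mean dy N theta eta).

Context {d : measure_display} {Omega : measurableType d}.
Variables (P : probability Omega R) (dy : Omega -> int -> R).

(* W_E; by stationarity the expectation does not depend on the time index,
   here 0. *)
Definition asymptotic_cost (theta : 'cV[R]_p) (eta : 'cV[R]_r) : R :=
  fine 'E_P[(fun w =>
    weighted_sqnorm (score (innovation_stationary theta (dy w) 0) eta))].

Definition eta_star (D : set 'cV[R]_r) (theta : 'cV[R]_p) : 'cV[R]_r :=
  xget 0 [set eta | D eta /\ gradient (asymptotic_cost theta) eta = 0].

(* The estimator as a measurable selection with values in D, from the solutions
   in D of the estimating equation; which value in D it takes is left free when
   there is no solution. If there are several solutions it is one in D',
   or, failing that, one as close as possible to D' (D' is the set in which the
   limiting equation is uniquely solvable). *)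
Definition ecf_estimator (D D' : set 'cV[R]_r) (N : nat) (theta : 'cV[R]_p)
    (etahat : Omega -> 'cV[R]_r) : Prop :=
  let solution := fun w eta => D eta /\ gradient (cost (dy w) N theta) eta = 0 in
  [/\ forall i, measurable_fun setT (fun w => etahat w i 0),
      forall w, D (etahat w) &
      {ae P, forall w, (exists eta, solution w eta) ->
         solution w (etahat w) /\
         forall eta, solution w eta ->
           dist_to D' (etahat w) <= dist_to D' eta}].

End ECF.

(* X_N = O_M(f N), the index N ranging over I. *)
Definition is_OM {R : realType} {d : measure_display} {Omega : measurableType d}
    (P : probability Omega R) {n : nat} (I : set nat)
    (X : nat -> Omega -> 'cV[R]_n) (f : nat -> R) : Prop :=
  forall q : R, 1 <= q ->
    (ereal_sup [set 'N[P]_(q%:E)[(fun w => (enorm (X N w))%:E)] * ((f N)^-1)%:E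
               | N in I] < +oo)%E.

(* Main.v *)
(* By stability the innovations are almost surely exponentially weighted series of the past noise increments, hence so
   close to functions of finitely many of them that the centered score averages delta (real and imaginary parts) have
   E |delta|^(2k) = O(N^-k) for every k.

   Expanding the square, V_{E,N} is W_E plus an eta-independent term plus a sum of the components of delta times fixed
   C^3 functions of eta. Everything else is deterministic: if delta is small, Newton's map has a fixed point near eta*,
   so the estimating equation is solvable; by compactness and the uniqueness assumption, the solution that is closest
   to D_eta^* must itself lie near eta*; a Taylor expansion then bounds the remainder by C |delta|^2. If delta is not
   small, the same bound holds trivially, since the estimator lies in the compact set D_eta. The moments of |delta|^2
   finish the proof. *)

(* The innovations depend on the whole past, so the centered scores are neither independent nor
   martingale differences. The moment bound rests on two facts instead: disjoint windows of
   increments are independent, and truncating the filter to finitely many lags changes a score by a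
   geometrically small amount in mean. Real and imaginary parts of a score are cosines with a phase,
   and addition formulas break a truncated one into products over single increments. The even
   moments of the partial sums can then be propagated: a common bound for them grows per step by at
   most a factor 1 + c/N and a term c N^k, hence to order N^(k+1) after N steps.

   The system at the true parameter and the inverse filter at another one do not cancel, so their
   impulse responses are convolved, with a cutoff because the inverse starts at time 0.

   Stationary filters are defined by limits that are only controlled almost surely, and the
   remainder involves gradients of random functions. Integrals of such expressions are therefore
   compared with those of measurable functions that dominate or equal them almost everywhere. *)
Require Import Defs.
From HB Require Import structures.
From mathcomp Require Import all_boot all_order all_algebra.
From mathcomp Require Import all_classical all_reals all_analysis.
From mathcomp Require Import measurable_realfun complex ring lra zify.
Set Implicit Arguments.
Unset Strict Implicit.
Unset Printing Implicit Defensive.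
Import Order.TTheory GRing.Theory Num.Theory.
Import numFieldNormedType.Exports.
Import Normc.
Local Open Scope classical_set_scope.
Local Open Scope ring_scope.

(** * Stable linear recursions *)

Section Stab.
Context {R : realType}.

(** A rate [s] strictly above [l] and at least [rho] leaves a gap [s - l], and the constant is
    chosen so that [D * (s - l) >= C] pays for the forcing. Some loss of rate is unavoidable when
    [l = rho], where k rho^k may occur. *)
Lemma linear_recursion_decay (a : nat -> R) (l C rho : R) :
  (forall k, 0 <= a k) -> 0 <= l < 1 -> 0 <= C -> 0 <= rho < 1 ->
  (forall k, a k.+1 <= l * a k + C * rho ^+ k) ->
  exists D s, [/\ 0 <= D, 0 <= s < 1 & forall k, a k <= D * s ^+ k].
Proof.
move=> a0 /andP[l0 l1] C0 /andP[r0 r1] h.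
pose s := (1 + Num.max l rho) / 2.
have ls : l < s by rewrite /s; have := le_max l l rho; rewrite lexx /=; case: (leP l rho) => ? _; lra.
have rs : rho <= s by rewrite /s; case: (leP l rho) => ?; lra.
have s1 : s < 1 by rewrite /s; case: (leP l rho) => ?; lra.
have s0 : 0 <= s by lra.
exists (a 0%N + C / (s - l)), s; split; rewrite ?s0 ?s1//.
  by rewrite addr_ge0 ?divr_ge0//; lra.
elim=> [|k IH]; first by rewrite expr0 mulr1 lerDl divr_ge0//; lra.
apply: (le_trans (h k)); set D := (X in _ <= X * _).
have rk : rho ^+ k <= s ^+ k by rewrite lerXn2r// nnegrE.
have sk : 0 <= s ^+ k by rewrite exprn_ge0.
apply: (@le_trans _ _ (l * (D * s ^+ k) + C * s ^+ k)).
  by rewrite lerD// ler_wpM2l.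
rewrite exprS [X in _ <= X](_ : _ = l * (D * s ^+ k) + (s - l) * D * s ^+ k); last by ring.
rewrite lerD2l ler_wpM2r// /D mulrDr [X in _ <= _ + X](_ : _ = C); last by field; lra.
by rewrite lerDr mulr_ge0//; lra.
Qed.

(** A property of one orbit rather than of the matrix: stripping a root of the characteristic
    polynomial changes the vector. *)
Definition decays {m} (F : 'M[R[i]]_m) (v : 'cV[R[i]]_m) :=
  exists C rho : R, [/\ 0 <= C, 0 <= rho < 1 &
    forall k i, normc (iter k (mulmx F) v i 0) <= C * rho ^+ k].

Lemma iter_mulmxD {m} (F : 'M[R[i]]_m) k (u v : 'cV[R[i]]_m) (a : R[i]) :
  iter k (mulmx F) (u + a *: v) = iter k (mulmx F) u + a *: iter k (mulmx F) v.
Proof. by elim: k => //= k ->; rewrite mulmxDr scalemxAr. Qed.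

(* Used to strip the factors of the characteristic polynomial off one at a time, starting from Cayley-Hamilton. *)
Lemma decays_factor {m} (F : 'M[R[i]]_m) (v : 'cV[R[i]]_m) (l : R[i]) :
  normc l < 1 -> decays F (F *m v - l *: v) -> decays F v.
Proof.
move=> l1 [C [rho [C0 rho1 h]]].
have nc0 (z : R[i]) : 0 <= normc z by case: z => *; apply: sqrtr_ge0.
have := @linear_recursion_decay
  (fun k => \sum_i normc (iter k (mulmx F) v i 0)) (normc l) (C *+ m) rho.
case.
- by move=> k; apply: sumr_ge0.
- by rewrite nc0.
- by rewrite mulrn_wge0.
- exact: rho1.
- move=> k; rewrite mulr_sumr mulrnAl -[in X in _ + X](card_ord m) -sumr_const.
  rewrite -big_split; apply: ler_sum => i _ /=.
  have -> : F *m iter k (mulmx F) v =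
      l *: iter k (mulmx F) v + iter k (mulmx F) (F *m v - l *: v).
    rewrite -scaleNr iter_mulmxD -iterSr iterS scaleNr; move: (F *m _) => u.
    by rewrite addrC subrK.
  rewrite !mxE; apply: (le_trans (le_normcD _ _)); rewrite lerD//.
  by rewrite normcM.
- move=> D [s [D0 s1 hs]]; exists D, s; split=> // k i.
  by apply: le_trans (hs k); rewrite (bigD1 i)//= lerDl sumr_ge0.
Qed.

Lemma stable_decays {m} (F : 'M[R]_m) (v : 'cV[R]_m) :
  stable_mx F -> decays (cmx F) (cmx v).
Proof.
move: F v; case: m => [|m] F v sF.
  by exists 0, 0; split; rewrite ?lexx ?ltr01// => k [].
have := closed_field_poly_normal (char_poly (cmx F)).
case=> rs hrs; have monic := char_poly_monic (cmx F).
move: hrs; rewrite (monicP monic) scale1r => hrs.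
have roots z : z \in rs -> normc z < 1.
  by move=> zrs; apply: sF; rewrite eigenvalue_root_char hrs root_prod_XsubC.
have : decays (cmx F) (horner_mx (cmx F) (\prod_(z <- rs) ('X - z%:P)) *m cmx v).
  rewrite -hrs Cayley_Hamilton mul0mx; exists 0, 0; split; rewrite ?lexx ?ltr01// => k i.
  suff -> : iter k (mulmx (cmx F)) 0 = 0 by rewrite mxE normc0 mul0r.
  by move=> q; elim: k => //= k ->; rewrite mulmx0.
move: (cmx v) => {}v; elim: rs v roots {hrs} => [|z rs IH] v roots.
  by rewrite big_nil rmorph1 mul1mx.
rewrite big_cons mulrC rmorphM rmorphB /= horner_mx_X horner_mx_C.
rewrite -[_ * _]/(_ *m _) -mulmxA => /IH h.
apply: (@decays_factor _ _ _ z); first by apply: roots; rewrite inE eqxx.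
rewrite -mul_scalar_mx -mulmxBl; apply: h.
by move=> y yrs; apply: roots; rewrite inE yrs orbT.
Qed.

Lemma stable_impulse_decay {m} (F : 'M[R]_m) (G : 'cV[R]_m) (C : 'rV[R]_m) :
  stable_mx F -> exists D s : R, [/\ 0 <= D, 0 <= s < 1 &
    forall k, `|(C *m iter k (mulmx F) G) 0 0| <= D * s ^+ k].
Proof.
move=> /(@stable_decays _ F G)[D [s [D0 s1 h]]].
exists ((\sum_j `|C 0 j|) * D), s; split=> //.
  by rewrite mulr_ge0// sumr_ge0.
move=> k; rewrite mxE -mulrA mulr_suml.
apply: (le_trans (ler_norm_sum _ _ _)); apply: ler_sum => j _.
rewrite normrM ler_wpM2l//; apply: le_trans (h k j).
have -> : iter k (mulmx (cmx F)) (cmx G) = cmx (iter k (mulmx F) G).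
  elim: k => //= k ->; rewrite /cmx.
  by rewrite -(map_mxM (@real_complex R)).
by rewrite mxE /= expr0n/= addr0 sqrtr_sqr.
Qed.
End Stab.

(** * Bounded random variables and independence *)

Section BM.
Context {R : realType} {d : measure_display} {Omega : measurableType d}.
Variable P : probability Omega R.

Definition Ex (X : Omega -> R) : R := Rintegral P setT X.

(** Expressions in cosines stay in this class, which makes their integrability automatic; only the
    noise and its linear combinations are merely integrable. *)
Definition bounded_measurable {d'} {T : measurableType d'} (X : T -> R) :=
  measurable_fun setT X /\ exists C : R, forall w, `|X w| <= C.

Section Closure.
Context {d'} {T : measurableType d'}.
Implicit Types X Y : T -> R.

Lemma bm_cst (c : R) : bounded_measurable (fun=> c : R : Type) (T:=T).
Proof. by split; [exact: measurable_cst|exists `|c|]. Qed.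

Lemma bmD X Y : bounded_measurable X -> bounded_measurable Y -> bounded_measurable (fun w => X w + Y w).
Proof.
move=> [mX [C hC]] [mY [D hD]]; split; first exact: measurable_funD.
by exists (C + D) => w; apply: (le_trans (ler_normD _ _)); rewrite lerD.
Qed.

Lemma bmM X Y : bounded_measurable X -> bounded_measurable Y -> bounded_measurable (fun w => X w * Y w).
Proof.
move=> [mX [C hC]] [mY [D hD]]; split; first exact: measurable_funM.
by exists (C * D) => w; rewrite normrM ler_pM.
Qed.

Lemma bmN X : bounded_measurable X -> bounded_measurable (fun w => - X w).
Proof.
move=> [mX [C hC]]; split; first exact: measurableT_comp.
by exists C => w; rewrite normrN.
Qed.

Lemma bmB X Y : bounded_measurable X -> bounded_measurable Y -> bounded_measurable (fun w => X w - Y w).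
Proof. by move=> hX hY; apply: bmD => //; exact: bmN. Qed.

Lemma bmX X n : bounded_measurable X -> bounded_measurable (fun w => X w ^+ n).
Proof.
move=> hX; elim: n => [|n IH]; first exact: bm_cst.
by under eq_fun do rewrite exprS; exact: bmM.
Qed.

Lemma bm_norm X : bounded_measurable X -> bounded_measurable (fun w => `|X w|).
Proof.
move=> [mX [C hC]]; split; first exact: measurableT_comp.
by exists C => w; rewrite normr_id.
Qed.

Lemma bm_sum I (s : seq I) (Q : pred I) (F : I -> T -> R) :
  (forall i, bounded_measurable (F i)) -> bounded_measurable (fun w => \sum_(i <- s | Q i) F i w).
Proof.
move=> hF; elim: s => [|i s IH].
  by under eq_fun do rewrite big_nil; exact: bm_cst.
under eq_fun do rewrite big_cons; case: (Q i) => //; exact: bmD.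
Qed.

Lemma bm_prod I (s : seq I) (Q : pred I) (F : I -> T -> R) :
  (forall i, bounded_measurable (F i)) -> bounded_measurable (fun w => \prod_(i <- s | Q i) F i w).
Proof.
move=> hF; elim: s => [|i s IH].
  by under eq_fun do rewrite big_nil; exact: bm_cst.
under eq_fun do rewrite big_cons; case: (Q i) => //; exact: bmM.
Qed.

Lemma bm_indic (A : set T) : measurable A -> bounded_measurable (\1_A : T -> R).
Proof.
move=> mA; split; first exact: measurable_indic.
exists 1 => w; rewrite indicE; case: (_ \in _); rewrite ?normr1 ?normr0 ?ler01//.
Qed.
End Closure.

Lemma bm_comp {d'} {T : measurableType d'} (f : T -> R) (Y : Omega -> T) :
  bounded_measurable f -> measurable_fun setT Y -> bounded_measurable (fun w => f (Y w)).
Proof.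
move=> [mf [C hC]] mY; split; first exact: (measurableT_comp mf).
by exists C.
Qed.

Implicit Types X Y : Omega -> R.

Lemma bm_integrable X : bounded_measurable X -> P.-integrable setT (EFin \o X).
Proof.
move=> [mX [C hC]]; apply: measurable_bounded_integrable => //.
  by rewrite -ge0_fin_numE ?fin_num_measure.
exists C; split; rewrite ?num_real// => M CM w _.
by apply: (le_trans (hC w)); exact: ltW.
Qed.

Lemma ExD X Y : P.-integrable setT (EFin \o X) -> P.-integrable setT (EFin \o Y) ->
  Ex (fun w => X w + Y w) = Ex X + Ex Y.
Proof. by move=> hX hY; rewrite /Ex RintegralD. Qed.

Lemma ExZ c X : P.-integrable setT (EFin \o X) -> Ex (fun w => c * X w) = c * Ex X.
Proof. by move=> hX; rewrite /Ex RintegralZl. Qed.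

Lemma ExB X Y : P.-integrable setT (EFin \o X) -> P.-integrable setT (EFin \o Y) ->
  Ex (fun w => X w - Y w) = Ex X - Ex Y.
Proof. by move=> hX hY; rewrite /Ex RintegralB. Qed.

Lemma Ex_le X Y : P.-integrable setT (EFin \o X) -> P.-integrable setT (EFin \o Y) ->
  (forall w, X w <= Y w) -> Ex X <= Ex Y.
Proof. by move=> hX hY h; apply: le_Rintegral. Qed.

Lemma Ex_cst (c : R) : Ex (fun=> c) = c.
Proof. rewrite /Ex Rintegral_cst//; have /= -> := probability_setT P; exact: mulr1. Qed.

Lemma Ex_ge0 X : (forall w, 0 <= X w) -> 0 <= Ex X.
Proof. by move=> h; apply: Rintegral_ge0. Qed.

Lemma Ex_norm X : P.-integrable setT (EFin \o X) -> `|Ex X| <= Ex (fun w => `|X w|).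
Proof. by move=> h; apply: le_normr_Rintegral. Qed.

Lemma integrable_sum I (s : seq I) (Q : pred I) (F : I -> Omega -> R) :
  (forall i, P.-integrable setT (EFin \o F i)) ->
  P.-integrable setT (EFin \o (fun w => \sum_(i <- s | Q i) F i w)).
Proof.
move=> hF; elim: s => [|i s IH].
  by under eq_fun do rewrite big_nil; apply/bm_integrable/bm_cst.
under eq_fun do rewrite big_cons; case: (Q i) => //.
have := integrableD measurableT (hF i) IH; apply: eq_integrable => //.
Qed.

Lemma Ex_sum I (s : seq I) (Q : pred I) (F : I -> Omega -> R) :
  (forall i, P.-integrable setT (EFin \o F i)) ->
  Ex (fun w => \sum_(i <- s | Q i) F i w) = \sum_(i <- s | Q i) Ex (F i).
Proof.
move=> hF; elim: s => [|i s IH].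
  by rewrite big_nil; under [X in Ex X]eq_fun do rewrite big_nil; exact: Ex_cst.
rewrite big_cons; under [X in Ex X]eq_fun do rewrite big_cons.
case: (Q i) => //; rewrite ExD ?IH//; exact: integrable_sum.
Qed.

End BM.

Ltac bounded_measurable_tac := repeat first
  [ assumption | exact: bm_cst | apply: bm_integrable | apply: bmX | apply: bmD | apply: bmN | apply: bmM
  | apply: bm_norm | apply: bm_sum => ? | apply: bm_prod => ? | progress intros].

(** * From indicators to bounded functions: independence and equality of laws *)

Section Indep.
Context {R : realType}.

(** The sum counts the positive integers up to [y], so it is the integer part of [y]. *)
Lemma layer_cake (y : R) n : 0 <= y -> y <= n%:R ->
  `|y - \sum_(j < n) (j.+1%:R <= y)%R%:R| <= 1.
Proof.
move=> y0; have h m : (m%:R <= y -> \sum_(j < m) (j.+1%:R <= y)%R%:R = m%:R :> R) /\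
   (y <= m%:R -> `|y - \sum_(j < m) (j.+1%:R <= y)%R%:R| <= 1).
  elim: m => [|m [IH1 IH2]].
    rewrite big_ord0 subr0; split=> // yle; have -> : y = 0 by lra.
    by rewrite normr0.
  rewrite big_ord_recr /=; split => h.
    by rewrite IH1 ?h ?natr1//; apply: le_trans h; rewrite ler_nat.
  have [h1|h1] := leP y m%:R.
    have [h2|h2] := leP m.+1%:R y; last by rewrite addr0; exact: IH2.
    by move: h2; rewrite -natr1; lra.
  rewrite IH1; last exact: ltW.
  have [h2|h2] := leP m.+1%:R y.
    by rewrite natr1 (_ : y = m.+1%:R) ?subrr ?normr0//; apply/eqP; rewrite eq_le h.
  by rewrite addr0 ger0_norm; move: h h2; rewrite -natr1; lra.
exact: (h n).2.
Qed.

Lemma bm_simple_approx {d} {T : measurableType d} (f : T -> R) (k : nat) : bounded_measurable f ->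
  exists (n : nat) (a : nat -> R) (B : nat -> set T), (forall j, measurable (B j)) /\
    forall x, `|f x - \sum_(j < n) a j * \1_(B j) x| <= k.+1%:R^-1.
Proof.
move=> [mf [C hC]].
pose m := (Num.trunc C).+1.
have hm x : `|f x| <= m%:R by apply: (le_trans (hC x)); rewrite ltW// truncnS_gt.
(* Shift to nonnegative values and scale: unit layers of [y] are layers of height 1/(k+1) of [f]. *)
pose y x := (f x + m%:R) * k.+1%:R.
(* Index 0 carries the constant that undoes the shift; an index [j > 0] carries the set where [y]
   reaches level [j]. *)
exists (((m + m) * k.+1).+1)%N, (fun j => if j is 0%N then - m%:R else k.+1%:R^-1),
  (fun j => if j is 0%N then setT else [set x | j%:R <= y x]); split.
  case=> [|j]; first exact: measurableT.
  have my : measurable_fun setT y.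
    by apply: measurable_funM => //; apply: measurable_funD.
  have := my measurableT _ (measurable_itv `[j.+1%:R, +oo[); rewrite setTI.
  by congr (measurable _); apply/seteqP; split => x /=; rewrite in_itv /= andbT.
move=> x; rewrite big_ord_recl /= indicT mulr1.
have k0 : 0 < k.+1%:R :> R by rewrite ltr0n.
rewrite opprD opprK addrA -mulr_sumr -(ler_pM2r k0) mulVf ?gt_eqF//.
rewrite -{2}(ger0_norm (ltW k0)) -normrM mulrBl mulrAC mulVf ?gt_eqF// mul1r.
have /ler_normlP[h1 h2] := hm x.
rewrite (eq_bigr (fun j : 'I__ => (j.+1%:R <= y x)%R%:R)); last first.
  move=> j _; rewrite indicE; congr (nat_of_bool _)%:R.
  by apply/idP/idP; rewrite inE.
apply: layer_cake; first by rewrite /y mulr_ge0//; lra.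
by rewrite /y natrM ler_pM2r// natrD lerD2r.
Qed.
End Indep.

Section Factor.
Context {R : realType} {d : measure_display} {Omega : measurableType d}.
Variable P : probability Omega R.

(** An identity known for indicators passes to bounded functions by uniform approximation. The two
    pairs serve two purposes: [Y = Y'] with [W'] constant gives the factorisation of a product,
    [W = W' = 1] gives equality of laws. *)
Lemma Ex_indic_ext {d'} {T : measurableType d'} (W W' : Omega -> R) (Y Y' : Omega -> T) :
  bounded_measurable W -> bounded_measurable W' -> measurable_fun setT Y -> measurable_fun setT Y' ->
  (forall B, measurable B ->
     Ex P (fun w => W w * \1_B (Y w)) = Ex P (fun w => W' w * \1_B (Y' w))) ->
  forall f, bounded_measurable f -> Ex P (fun w => W w * f (Y w)) = Ex P (fun w => W' w * f (Y' w)).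
Proof.
move=> bW bW' mY mY' h f bf; have [_ [C hC]] := bW; have [_ [C' hC']] := bW'.
have near (V : Omega -> R) (y : Omega -> T) D (g : T -> R) e : bounded_measurable V -> measurable_fun setT y ->
    (forall w, `|V w| <= D) -> bounded_measurable g -> (forall x, `|f x - g x| <= e) ->
    `|Ex P (fun w => V w * f (y w)) - Ex P (fun w => V w * g (y w))| <= D * e.
  move=> bV my hV bg hg; have bfy := bm_comp bf my; have bgy := bm_comp bg my.
  rewrite -ExB; [|by bounded_measurable_tac..].
  apply: (le_trans (Ex_norm _)); first by bounded_measurable_tac.
  rewrite -[leRHS](Ex_cst P); apply: Ex_le; [by bounded_measurable_tac..|] => w.
  by rewrite -mulrBr normrM ler_pM.
apply/eqP; rewrite -subr_eq0 -normr_le0; apply/ler_addgt0Pl => e e0; rewrite addr0.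
have [k hk] : exists k : nat, (`|C| + `|C'|) * k.+1%:R^-1 <= e.
  have [k hk] := @ltr_add_invr R 0 (e / (`|C| + `|C'| + 1)) (divr_gt0 e0 (ltr_wpDl (addr_ge0 (normr_ge0 _) (normr_ge0 _)) ltr01)).
  exists k; rewrite add0r ltr_pdivlMr in hk; last by rewrite ltr_wpDl// addr_ge0.
  by apply: le_trans (ltW hk); rewrite [X in X <= _]mulrC ler_wpM2l ?lerDl ?invr_ge0.
have [n [a [B [mB hB]]]] := bm_simple_approx k bf.
pose g x := \sum_(j < n) a j * \1_(B j) x.
have bg : bounded_measurable g by bounded_measurable_tac; exact: bm_indic.
have eg : Ex P (fun w => W w * g (Y w)) = Ex P (fun w => W' w * g (Y' w)).
  have E (V : Omega -> R) (y : Omega -> T) : bounded_measurable V -> measurable_fun setT y ->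
      Ex P (fun w => V w * g (y w)) = \sum_(j < n) a j * Ex P (fun w => V w * \1_(B j) (y w)).
    move=> bV my; have bB j : bounded_measurable (fun w => \1_(B j) (y w) : R).
      by apply: (bm_comp _ my); exact: bm_indic.
    under [in LHS]eq_fun do rewrite mulr_sumr.
    rewrite Ex_sum; last by move=> j; bounded_measurable_tac.
    apply: eq_bigr => j _; rewrite -ExZ; last by bounded_measurable_tac.
    by congr Ex; apply/funext => w; rewrite mulrCA.
  by rewrite !E//; apply: eq_bigr => j _; rewrite h.
apply: le_trans hk; rewrite mulrDl.
rewrite [X in `|X|](_ : _ = (Ex P (fun w => W w * f (Y w)) - Ex P (fun w => W w * g (Y w))) -
   (Ex P (fun w => W' w * f (Y' w)) - Ex P (fun w => W' w * g (Y' w)))); last by rewrite eg; ring.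
apply: (le_trans (ler_normB _ _)); apply: lerD; apply: near => // w.
- by apply: (le_trans (hC w)); exact: ler_norm.
- by apply: (le_trans (hC' w)); exact: ler_norm.
Qed.

Lemma Ex_indic (A : set Omega) : measurable A -> Ex P \1_A = fine (P A).
Proof.
by move=> mA; rewrite /Ex /Rintegral integral_indic// setIT.
Qed.

Variable X : nat -> Omega -> R.
Hypothesis mX : forall i, measurable_fun setT (X i).
Hypothesis indX : forall n, mutually_independent P (fun i : 'I_n => X i).

Lemma Ex_prod n (f : nat -> R -> R) : (forall i, bounded_measurable (f i)) ->
  Ex P (fun w => \prod_(i < n) f i (X i w)) = \prod_(i < n) Ex P (fun w => f i (X i w)).
Proof.
move=> bf.
(* Induct on the number [t] of factors that may be arbitrary, the others being indicators. For
   [t = 0] this is independence itself, and each step frees one factor through [Ex_indic_ext]. *)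
suff H t : (t <= n)%N -> forall g : nat -> R -> R, (forall i, bounded_measurable (g i)) ->
    (forall i, (t <= i)%N -> exists B, measurable B /\ g i = \1_B) ->
    Ex P (fun w => \prod_(i < n) g i (X i w)) = \prod_(i < n) Ex P (fun w => g i (X i w)).
  (* Past [n] the factors are filled with the indicator of the whole line, because the condition on
     [g] concerns all indices from [t] on. *)
  pose g i := if (i < n)%N then f i else \1_setT.
  transitivity (Ex P (fun w => \prod_(i < n) g i (X i w))).
    by congr Ex; apply/funext => w; apply: eq_bigr => i _; rewrite /g ltn_ord.
  rewrite (H n (leqnn n) g).
  - by apply: eq_bigr => i _; rewrite /g ltn_ord.
  - by move=> i; rewrite /g; case: ifP => // _; apply: bm_indic.
  - by move=> i; rewrite /g ltnNge => ->; exists setT.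
elim: t => [_ g bg hg|t IH tn g bg hg].
  have {}hg i := hg i (leq0n i).
  have /choice[B hB] : forall i, exists B, measurable B /\ g i = \1_B by [].
  have mBX i : measurable [set w | B i (X i w)].
    by rewrite -[X in measurable X]setTI; apply: mX => //; exact: (hB i).1.
  have E A : (fun w => \1_A w) = (\1_A : Omega -> R) by [].
  transitivity (Ex P \1_[set w | forall i : 'I_n, B i (X i w)]).
    congr Ex; apply/funext => w; rewrite [RHS]indicE.
    have [h|h] := pselect (forall i : 'I_n, B i (X i w)).
      rewrite mem_set//= big1// => i _.
      by rewrite (hB i).2 indicE mem_set.
    rewrite memNset//=; have /existsNP[i hi] := h.
    by rewrite (bigD1 i)//= (hB i).2 indicE memNset// mul0r.
  rewrite Ex_indic; last first.
    rewrite [X in measurable X](_ : _ =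
      \bigcap_i (if (i < n)%N then [set w | B i (X i w)] else setT)).
      by apply: bigcapT_measurable => i; case: ifP.
    apply/seteqP; split => w /=.
      by move=> h i _; case: ifP => // lt; exact: (h (Ordinal lt)).
    by move=> h i; have := h i I; rewrite ltn_ord.
  have -> := @indX n (fun i => B i) => /=; last by move=> i; exact: (hB i).1.
  apply: eq_bigr => i _; rewrite -Ex_indic//; congr Ex; apply/funext => w.
  by rewrite (hB i).2 !indicE; congr (nat_of_bool _)%:R; apply/idP/idP; rewrite !inE.
pose t' := Ordinal tn.
pose W w := \prod_(i < n | i != t') g i (X i w).
have bW : bounded_measurable W by apply: bm_prod => i; apply: (bm_comp _ (mX i)).
rewrite (bigD1 t')//= mulrC.
under [X in Ex _ X]eq_fun do rewrite (bigD1 t')//= mulrC.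
rewrite -ExZ; last by apply: bm_integrable; exact: (bm_comp (bg t) (mX t)).
apply: (@Ex_indic_ext _ _ W _ (X t) (X t)) => //; first exact: bm_cst.
move=> B mB; pose g' i := if i == t then \1_B else g i.
rewrite ExZ; last by apply: bm_integrable; apply: (bm_comp (bm_indic mB) (mX t)).
have g'E (i : 'I_n) : i != t' -> g' i = g i.
  by rewrite -val_eqE /g' /= => /negPf ->.
have eW : (fun w => \prod_(i < n) g' i (X i w)) = (fun w => W w * \1_B (X t w)).
  apply/funext => w; rewrite (bigD1 t')//= mulrC /g' eqxx; congr (_ * _).
  by apply: eq_bigr => i /g'E; rewrite /g' => ->.
have := IH (ltnW tn) g'; rewrite eW => ->.
- rewrite (bigD1 t')//= mulrC; congr (_ * _); last by rewrite /g' eqxx.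
  by apply: eq_bigr => i /g'E ->.
- by move=> i; rewrite /g'; case: ifP => // _; exact: bm_indic.
- move=> i ti; rewrite /g'; case: ifP => [_|/eqP it]; first by exists B.
  by apply: hg; rewrite ltn_neqAle ti andbT; apply/eqP => /esym.
Qed.

Definition window_product lo hi (F : Omega -> R) := exists (c : R) (f : nat -> R -> R),
  (forall i, bounded_measurable (f i)) /\ F = (fun w => c * \prod_(lo <= i < hi) f i (X i w)).

(* Finite sums of products of functions of the single variables [X lo, ..., X hi.-1]. By the addition formulas the
   cosine of a linear combination of these variables is of this form, so that independence of disjoint windows is
   only needed in product form. *)
Inductive cylinder lo hi : (Omega -> R) -> Prop :=
| cyl0 : cylinder lo hi (fun=> 0)
| cylS F G : window_product lo hi F -> cylinder lo hi G -> cylinder lo hi (fun w => F w + G w).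

Lemma cyl_mono lo hi F : window_product lo hi F -> cylinder lo hi F.
Proof.
move=> mF; have := cylS mF (cyl0 lo hi); congr cylinder.
by apply/funext => w; rewrite addr0.
Qed.

Lemma cylD lo hi F G : cylinder lo hi F -> cylinder lo hi G -> cylinder lo hi (fun w => F w + G w).
Proof.
move=> + cG; elim=> [|F1 F2 m1 c2 IH].
  by move: cG; congr cylinder; apply/funext => w; rewrite add0r.
by have := cylS m1 IH; congr cylinder; apply/funext => w; rewrite addrA.
Qed.

Lemma window_productM lo hi F G : window_product lo hi F -> window_product lo hi G -> window_product lo hi (fun w => F w * G w).
Proof.
move=> [c [f [bf ->]]] [c' [f' [bf' ->]]]; exists (c * c'), (fun i x => f i x * f' i x).
by split=> [i|]; [exact: bmM|apply/funext => w; rewrite mulrACA big_split].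
Qed.

Lemma cylM lo hi F G : cylinder lo hi F -> cylinder lo hi G -> cylinder lo hi (fun w => F w * G w).
Proof.
move=> + cG; elim=> [|F1 F2 m1 c2 IH].
  by rewrite (_ : (fun w => _) = (fun=> 0)); [exact: cyl0|apply/funext => w; rewrite mul0r].
rewrite (_ : (fun w => _) = (fun w => F1 w * G w + F2 w * G w)); last first.
  by apply/funext => w; rewrite mulrDl.
apply: cylD => //; elim: cG => [|G1 G2 m1' c2' IH'].
  by rewrite (_ : (fun w => _) = (fun=> 0)); [exact: cyl0|apply/funext => w; rewrite mulr0].
rewrite (_ : (fun w => _) = (fun w => F1 w * G1 w + F1 w * G2 w)); last first.
  by apply/funext => w; rewrite mulrDr.
by apply: cylD => //; apply: cyl_mono; exact: window_productM.
Qed.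

Lemma cyl_cst lo hi c : cylinder lo hi (fun=> c).
Proof.
apply: cyl_mono; exists c, (fun _ _ => 1); split=> [i|]; first exact: bm_cst.
by apply/funext => w; rewrite big1 ?mulr1.
Qed.

Lemma cylN lo hi F : cylinder lo hi F -> cylinder lo hi (fun w => - F w).
Proof.
move=> /(cylM (cyl_cst lo hi (-1))); congr cylinder; apply/funext => w.
by rewrite mulN1r.
Qed.

Lemma cylX lo hi F n : cylinder lo hi F -> cylinder lo hi (fun w => F w ^+ n).
Proof.
move=> cF; elim: n => [|n IH]; first exact: cyl_cst.
by under eq_fun do rewrite exprS; exact: cylM.
Qed.

Lemma cyl_sum lo hi I (s : seq I) (F : I -> Omega -> R) :
  (forall i, cylinder lo hi (F i)) -> cylinder lo hi (fun w => \sum_(i <- s) F i w).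
Proof.
move=> cF; elim: s => [|i s IH].
  by under eq_fun do rewrite big_nil; exact: cyl_cst.
by under eq_fun do rewrite big_cons; exact: cylD.
Qed.

Lemma cyl_atom lo hi i f : (lo <= i < hi)%N -> bounded_measurable f -> cylinder lo hi (fun w => f (X i w)).
Proof.
move=> ih bf; apply: cyl_mono; exists 1, (fun j => if j == i then f else fun=> 1).
split=> [j|]; first by case: ifP => // _; exact: bm_cst.
apply/funext => w; rewrite mul1r (bigD1_seq i) ?mem_index_iota ?iota_uniq//= eqxx.
by rewrite big1 ?mulr1// => j /negPf ->.
Qed.

Lemma cyl_widen lo hi lo' hi' F : (lo' <= lo)%N -> (hi <= hi')%N ->
  cylinder lo hi F -> cylinder lo' hi' F.
Proof.
move=> hlo hhi; elim=> [|{}F G [c [f [bf ->]]] _ cG]; first exact: cyl0.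
apply: cylD cG; apply: cyl_mono.
exists c, (fun i => if (lo <= i < hi)%N then f i else fun=> 1); split=> [i|].
  by case: ifP => // _; exact: bm_cst.
apply/funext => w; congr (_ * _).
rewrite [RHS](eq_bigr (fun i => if (lo <= i < hi)%N then f i (X i w) else 1)); last first.
  by move=> i _; case: ifP.
rewrite -big_mkcond /= (big_nat_widen _ _ hi')//.
rewrite (big_nat_widenl _ lo')//; apply: eq_bigl => i.
by rewrite andbC.
Qed.

Lemma cyl_bm lo hi F : cylinder lo hi F -> bounded_measurable F.
Proof.
elim=> [|{}F G [c [f [bf ->]]] _ bG]; first exact: bm_cst.
by apply: bmD => //; bounded_measurable_tac; apply: (bm_comp (bf _) (mX _)).
Qed.

Lemma Ex_mono lo hi c (f : nat -> R -> R) : (forall i, bounded_measurable (f i)) ->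
  Ex P (fun w => c * \prod_(lo <= i < hi) f i (X i w)) =
  c * \prod_(lo <= i < hi) Ex P (fun w => f i (X i w)).
Proof.
move=> bf; rewrite ExZ; last first.
  by bounded_measurable_tac; apply: (bm_comp (bf _) (mX _)).
congr (_ * _); pose g i := if (lo <= i)%N then f i else fun=> 1.
have bg i : bounded_measurable (g i) by rewrite /g; case: ifP => // _; exact: bm_cst.
transitivity (Ex P (fun w => \prod_(i < hi) g i (X i w))).
  congr Ex; apply/funext => w; rewrite big_geq_mkord big_mkcond /=.
  by apply: eq_bigr => i _; rewrite /g; case: ifP.
rewrite Ex_prod// big_geq_mkord big_mkcond [RHS]big_mkcond /=.
by apply: eq_bigr => i _; rewrite /g; case: ifP => // _; rewrite Ex_cst.
Qed.

(** By bilinearity both sums reduce to single products. Products over adjacent windows merge into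
    one product over [[lo, hi)], whose expectation splits into single factors that can be
    regrouped. *)
Lemma Ex_cylM lo mid hi F G : (lo <= mid)%N -> (mid <= hi)%N ->
  cylinder lo mid F -> cylinder mid hi G -> Ex P (fun w => F w * G w) = Ex P F * Ex P G.
Proof.
move=> h1 h2; elim=> [|F1 F2 [c [f [bf F1E]]] c2 IH] cG.
  by rewrite Ex_cst mul0r -[RHS](Ex_cst P); congr Ex; apply/funext => w; rewrite mul0r.
have m1 : window_product lo mid F1 by exists c, f.
have bG := cyl_bm cG; have b1 := cyl_bm (cyl_mono m1); have b2 := cyl_bm c2.
rewrite (_ : (fun w => _) = (fun w => F1 w * G w + F2 w * G w)); last first.
  by apply/funext => w; rewrite mulrDl.
rewrite !ExD; [|by bounded_measurable_tac..]; rewrite mulrDl IH//; congr (_ + _).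
elim: cG {IH bG} => [|G1 G2 [c' [f' [bf' G1E]]] c2' IH].
  by rewrite Ex_cst mulr0 -[RHS](Ex_cst P); congr Ex; apply/funext => w; rewrite mulr0.
have b1' : bounded_measurable G1 by apply: (@cyl_bm mid hi); apply: cyl_mono; exists c', f'.
have b2' := cyl_bm c2'.
rewrite (_ : (fun w => _) = (fun w => F1 w * G1 w + F1 w * G2 w)); last first.
  by apply/funext => w; rewrite mulrDr.
rewrite !ExD; [|by bounded_measurable_tac..]; rewrite mulrDr IH//; congr (_ + _).
pose g i := if (i < mid)%N then f i else f' i.
have E (H : nat -> (R -> R) -> R) : (\prod_(lo <= i < mid) H i (f i)) * (\prod_(mid <= i < hi) H i (f' i)) =
    \prod_(lo <= i < hi) H i (g i).
  rewrite (big_cat_nat h1 h2); congr (_ * _); rewrite !big_nat; apply: eq_bigr => i.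
    by case/andP => _ im; rewrite /g im.
  by case/andP => im _; rewrite /g ltnNge im.
rewrite F1E G1E !Ex_mono// mulrACA (E (fun i f => Ex P (fun w => f (X i w)))).
rewrite -Ex_mono; last by move=> i; rewrite /g; case: ifP.
by congr Ex; apply/funext => w; rewrite mulrACA (E (fun i f => f (X i w))).
Qed.

(** The phase [f] is carried along so that real and imaginary parts of a score can both be handled
    as cosines. *)
Lemma bm_cos (c f : R) : bounded_measurable (fun x : R => cos (f + c * x)).
Proof.
split; last by exists 1 => x; rewrite ler_norml cos_le1 cos_geN1.
apply: measurableT_comp; first by apply: continuous_measurable_fun; exact: continuous_cos.
by apply: measurable_funD => //; exact: measurable_funM.
Qed.

Lemma bm_sin (c f : R) : bounded_measurable (fun x : R => sin (f + c * x)).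
Proof.
split; last by exists 1 => x; rewrite ler_norml sin_le1 sin_geN1.
apply: measurableT_comp; first by apply: continuous_measurable_fun; exact: continuous_sin.
by apply: measurable_funD => //; exact: measurable_funM.
Qed.

(** Cosine and sine go together because the addition formula for either involves both. *)
Lemma cyl_cos_sin lo n (c : nat -> R) (f : R) :
  cylinder lo (lo + n) (fun w => cos (f + \sum_(lo <= i < lo + n) c i * X i w)) /\
  cylinder lo (lo + n) (fun w => sin (f + \sum_(lo <= i < lo + n) c i * X i w)).
Proof.
elim: n => [|n [IHc IHs]].
  by rewrite addn0; under eq_fun do rewrite big_geq//; split; [|under eq_fun do rewrite big_geq//]; exact: cyl_cst.
have wid F : cylinder lo (lo + n) F -> cylinder lo (lo + n.+1) F.
  by apply: cyl_widen => //; rewrite leq_add2l.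
have at_ g : bounded_measurable g -> cylinder lo (lo + n.+1) (fun w => g (X (lo + n)%N w)).
  by apply: cyl_atom; rewrite leq_addr ltn_add2l /=.
have := (at_ _ (bm_cos (c (lo + n)%N) 0), at_ _ (bm_sin (c (lo + n)%N) 0)) => -[ac as_].
rewrite addnS; split; under eq_fun do rewrite big_nat_recr ?leq_addr//= addrA.
- under eq_fun do rewrite cosD -[c _ * _]add0r.
  by rewrite -addnS; apply: cylD; [|apply: cylN]; apply: cylM => //; exact: wid.
- under eq_fun do rewrite sinD -[c _ * _]add0r.
  by rewrite -addnS; apply: cylD; apply: cylM => //; exact: wid.
Qed.

End Factor.

Section Law.
Context {R : realType} {d : measure_display} {Omega : measurableType d}.
Variable P : probability Omega R.

Lemma Ex_eq_law (Y Y' : Omega -> R) : measurable_fun setT Y -> measurable_fun setT Y' ->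
  (forall B : set R, measurable B -> P [set w | B (Y w)] = P [set w | B (Y' w)]) ->
  forall f, bounded_measurable f -> Ex P (fun w => f (Y w)) = Ex P (fun w => f (Y' w)).
Proof.
move=> mY mY' h f bf.
have E (y : Omega -> R) (g : R -> R) :
  Ex P (fun w => g (y w)) = Ex P (fun w => 1 * g (y w)).
  by congr Ex; apply/funext => w; rewrite mul1r.
rewrite E [RHS]E; apply: Ex_indic_ext => //; [exact: bm_cst..|] => B mB.
rewrite -!E.
have F (y : Omega -> R) : measurable_fun setT y ->
    Ex P (fun w => \1_B (y w)) = fine (P [set w | B (y w)]).
  move=> my; rewrite -Ex_indic; last by rewrite -[X in measurable X]setTI; apply: my.
  congr Ex; apply/funext => w; rewrite !indicE; congr (nat_of_bool _)%:R.
by rewrite !F// h.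
Qed.

(** Two linear combinations need to be compared only through their cosine and sine, and there the
    addition formulas reduce the question to the laws of the single variables, without joint
    laws. *)
Lemma Ex_cos_sin_law (X X' : nat -> Omega -> R) n (c : nat -> R) (f : R) :
  (forall i, measurable_fun setT (X i)) -> (forall i, measurable_fun setT (X' i)) ->
  (forall n, mutually_independent P (fun i : 'I_n => X i)) ->
  (forall n, mutually_independent P (fun i : 'I_n => X' i)) ->
  (forall i g, bounded_measurable g -> Ex P (fun w => g (X i w)) = Ex P (fun w => g (X' i w))) ->
  Ex P (fun w => cos (f + \sum_(0 <= i < n) c i * X i w)) =
  Ex P (fun w => cos (f + \sum_(0 <= i < n) c i * X' i w)) /\
  Ex P (fun w => sin (f + \sum_(0 <= i < n) c i * X i w)) =
  Ex P (fun w => sin (f + \sum_(0 <= i < n) c i * X' i w)).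
Proof.
move=> mX mX' iX iX' law; elim: n => [|n [IHc IHs]].
  by split; congr Ex; apply/funext => w; rewrite !big_geq.
have Ec (Y : nat -> Omega -> R) : (forall i, measurable_fun setT (Y i)) ->
  (forall n, mutually_independent P (fun i : 'I_n => Y i)) ->
  Ex P (fun w => cos (f + \sum_(0 <= i < n.+1) c i * Y i w)) =
  Ex P (fun w => cos (f + \sum_(0 <= i < n) c i * Y i w)) * Ex P (fun w => cos (0 + c n * Y n w)) -
  Ex P (fun w => sin (f + \sum_(0 <= i < n) c i * Y i w)) * Ex P (fun w => sin (0 + c n * Y n w)) /\
  Ex P (fun w => sin (f + \sum_(0 <= i < n.+1) c i * Y i w)) =
  Ex P (fun w => sin (f + \sum_(0 <= i < n) c i * Y i w)) * Ex P (fun w => cos (0 + c n * Y n w)) +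
  Ex P (fun w => cos (f + \sum_(0 <= i < n) c i * Y i w)) * Ex P (fun w => sin (0 + c n * Y n w)).
  move=> mY iY; have [cc cs] := @cyl_cos_sin R _ Omega Y 0 n c f.
  rewrite add0n in cc cs.
  have at_ g : bounded_measurable g -> cylinder Y n n.+1 (fun w => g (Y n w)).
    by apply: cyl_atom; rewrite leqnn /=.
  have ac := at_ _ (bm_cos (c n) 0); have as_ := at_ _ (bm_sin (c n) 0).
  have bcc := cyl_bm mY cc; have bcs := cyl_bm mY cs.
  have bac := cyl_bm mY ac; have bas := cyl_bm mY as_.
  rewrite -!(Ex_cylM mY iY (leq0n n) (leqnSn n))//.
  rewrite -ExB; [|by bounded_measurable_tac..]; rewrite -ExD; [|by bounded_measurable_tac..].
  split; congr Ex; apply/funext => w; rewrite big_nat_recr//= addrA ?[cos (_ + c n * _)]cosD ?[sin (_ + c n * _)]sinD ?cos0 ?sin0; ring.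
have [-> ->] := Ec X mX iX; have [-> ->] := Ec X' mX' iX'.
rewrite IHc IHs (law n _ (bm_cos (c n) 0)) (law n _ (bm_sin (c n) 0)).
by [].
Qed.
End Law.

(** * Moments of sums of weakly dependent variables *)

Section Moment.
Context {R : realType}.

(** Young's inequality with a free weight [l]: according to whether [y] is below or above [l * a],
    one of the two terms alone is large enough. *)
Lemma young_pow (k : nat) (a y l : R) : 0 <= a -> 0 <= y -> 0 < l ->
  a ^+ k * y <= l * a ^+ k.+1 + (l^-1) ^+ k * y ^+ k.+1.
Proof.
move=> a0 y0 l0; have li0 : 0 < l^-1 by rewrite invr_gt0.
have ak : 0 <= a ^+ k by rewrite exprn_ge0.
have [h|h] := leP y (l * a).
  apply: (@le_trans _ _ (a ^+ k * (l * a))); first by rewrite ler_wpM2l.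
  rewrite exprS [X in X <= _](_ : _ = l * (a * a ^+ k)); last by ring.
  by rewrite lerDl mulr_ge0// exprn_ge0// ltW.
apply: (@le_trans _ _ ((l^-1) ^+ k * y ^+ k.+1)); last first.
  by rewrite lerDr mulr_ge0// ?exprn_ge0// ltW.
have -> : l^-1 ^+ k * y ^+ k.+1 = (l^-1 * y) ^+ k * y by rewrite exprMn exprS; ring.
rewrite ler_wpM2r// lerXn2r// ?nnegrE ?mulr_ge0//; first exact: ltW.
by rewrite ler_pdivlMl// ltW.
Qed.

Lemma pow_le_1D (s : R) m n : (m <= n)%N -> `|s| ^+ m <= `|s| ^+ n + 1.
Proof.
move=> mn; have [h|h] := leP `|s| 1.
  by apply: (@le_trans _ _ 1); [exact: exprn_ile1|rewrite lerDr exprn_ge0].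
by apply: (@le_trans _ _ (`|s| ^+ n)); [rewrite ler_weXn2l// ltW|rewrite lerDl].
Qed.

(** First-order expansion of a power under a bounded increment. The bound 2 is that of a centered
    cosine; the added 1 covers small [s], so that one power of [s] suffices on the right. *)
Lemma pow_shift_bound n : exists2 A : R, 0 <= A & forall s x : R, `|x| <= 2 ->
  `|(s + x) ^+ n.+1 - s ^+ n.+1| <= A * (`|s| ^+ n + 1).
Proof.
elim: n => [|n [A A0 IH]].
  by exists 2 => // s x hx; rewrite !expr1 expr0 addrC addKr; lra.
exists (6 * A + 2) => [|s x hx]; first by lra.
rewrite (_ : _ - _ = (s + x) * ((s + x) ^+ n.+1 - s ^+ n.+1) + x * s ^+ n.+1); last by rewrite (exprS _ n.+1) (exprS s n.+1); ring.
apply: (le_trans (ler_normD _ _)); rewrite !normrM normrX.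
have h1 := IH s x hx; have h2 := ler_normD s x.
have s0 := normr_ge0 s; have s1 := exprn_ge0 n s0; have s2 := exprn_ge0 n.+1 s0.
have h3 := pow_le_1D s (leqnSn n); have h4 := @pow_le_1D s 1 n.+1 isT.
rewrite expr1 in h4.
have h5 : `|s + x| * `|(s + x) ^+ n.+1 - s ^+ n.+1| <= (`|s| + 2) * (A * (`|s| ^+ n + 1)).
  by apply: ler_pM => //; lra.
have h6 : `|x| * `|s| ^+ n.+1 <= 2 * `|s| ^+ n.+1 by apply: ler_wpM2r.
have h7 : (`|s| + 2) * (A * (`|s| ^+ n + 1)) =
   A * (`|s| ^+ n.+1 + `|s| + 2 * `|s| ^+ n + 2) by rewrite exprS; ring.
have h8 : A * (`|s| ^+ n.+1 + `|s| + 2 * `|s| ^+ n + 2) <= A * (6 * (`|s| ^+ n.+1 + 1)).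
  by apply: ler_wpM2l => //; lra.
by lra.
Qed.

Lemma pow_shift_bound2 n : exists2 A : R, 0 <= A & forall s x : R, `|x| <= 2 ->
  `|(s + x) ^+ n.+2 - s ^+ n.+2 - n.+2%:R * s ^+ n.+1 * x| <= A * (`|s| ^+ n + 1).
Proof.
elim: n => [|n [A A0 IH]].
  exists 4 => // s x hx; rewrite expr1 expr0.
  rewrite (_ : _ - _ = x ^+ 2); last by ring.
  rewrite normrX; have := normr_ge0 x; nra.
(* The lower powers of [s] are absorbed into [|s|^(n+1) + 1], which accounts for the 6; the second
   summand comes from [x^2 <= 4]. *)
exists (6 * A + 4 * n.+2%:R) => [|s x hx]; first by rewrite addr_ge0// mulr_ge0.
rewrite (_ : _ - _ = (s + x) * ((s + x) ^+ n.+2 - s ^+ n.+2 - n.+2%:R * s ^+ n.+1 * x) + n.+2%:R * s ^+ n.+1 * x ^+ 2); last first.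
  by rewrite (exprS _ n.+2) (exprS s n.+2) (exprS s n.+1) -(natr1 n.+2); ring.
apply: (le_trans (ler_normD _ _)); rewrite !normrM !normrX.
have h1 := IH s x hx; have h2 := ler_normD s x.
have s0 := normr_ge0 s; have s1 := exprn_ge0 n s0; have s2 := exprn_ge0 n.+1 s0.
have h3 := pow_le_1D s (leqnSn n); have h4 := @pow_le_1D s 1 n.+1 isT.
rewrite expr1 in h4.
set e := `|_ - n.+2%:R * _ * x| in h1 *.
have h5 : `|s + x| * e <= (`|s| + 2) * (A * (`|s| ^+ n + 1)).
  by apply: ler_pM => //; [exact: normr_ge0|lra].
have n0 : 0 <= `|n.+2%:R| * `|s| ^+ n.+1 by rewrite mulr_ge0.
have x4 : `|x| ^+ 2 <= 4 by have := normr_ge0 x; nra.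
have h6 : `|n.+2%:R| * `|s| ^+ n.+1 * `|x| ^+ 2 <= `|n.+2%:R| * `|s| ^+ n.+1 * 4.
  by apply: ler_wpM2l.
have h7 : (`|s| + 2) * (A * (`|s| ^+ n + 1)) =
   A * (`|s| ^+ n.+1 + `|s| + 2 * `|s| ^+ n + 2) by rewrite exprS; ring.
have h8 : A * (`|s| ^+ n.+1 + `|s| + 2 * `|s| ^+ n + 2) <= A * (6 * (`|s| ^+ n.+1 + 1)).
  by apply: ler_wpM2l => //; lra.
rewrite (ger0_norm (ler0n R n.+2)) in h6 n0 *.
rewrite [leRHS](_ : _ = A * (6 * (`|s| ^+ n.+1 + 1)) + (n.+2%:R * `|s| ^+ n.+1 * 4 + 4 * n.+2%:R)); last by ring.
apply: lerD; first by rewrite -h7 in h8; exact: le_trans h5 h8.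
by apply: (le_trans h6); rewrite lerDl mulr_ge0.
Qed.
End Moment.

Section MomentBound.
Context {R : realType} {d : measure_display} {Omega : measurableType d}.
Variable P : probability Omega R.

Lemma geometric_sum_le (r : R) n : 0 <= r < 1 -> \sum_(i < n) r ^+ i <= (1 - r)^-1.
Proof.
move=> /andP[r0 r1]; have r2 : 0 < 1 - r by lra.
rewrite -[leRHS]mul1r ler_pdivlMr// mulrC.
have -> : (1 - r) * (\sum_(i < n) r ^+ i) = 1 - r ^+ n.
  rewrite -opprB mulNr -subrX1; ring.
by rewrite gerBl exprn_ge0.
Qed.

Lemma telescope_down (f : nat -> R) n :
  f n - f 0%N = \sum_(j < n) (f (n - j)%N - f (n - j.+1)%N).
Proof.
elim: n => [|n IH]; first by rewrite big_ord0 subrr.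
rewrite big_ord_recl /= subn0 subn1 /=.
under eq_bigr do rewrite /bump /= add1n !subSS.
by rewrite -IH; ring.
Qed.

(* [xk n j] depends on the [j] most recent noise terms only, so that it is uncorrelated with functions of the older
   partial sums ([hS]); [S n ^+ k.*2.+1] is telescoped down through these partial sums. *)
Section Step.
Variables (k N : nat) (C r A1 A2 : R) (x : nat -> Omega -> R) (xk : nat -> nat -> Omega -> R).
Hypotheses (C0 : 0 <= C) (r01 : 0 < r < 1) (N0 : (0 < N)%N) (A10 : 0 <= A1) (A20 : 0 <= A2).
Hypothesis hA1 : forall s x : R, `|x| <= 2 ->
  `|(s + x) ^+ k.*2.+1 - s ^+ k.*2.+1| <= A1 * (`|s| ^+ k.*2 + 1).
Hypothesis hA2 : forall s x : R, `|x| <= 2 ->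
  `|(s + x) ^+ k.*2.+2 - s ^+ k.*2.+2 - k.*2.+2%:R * s ^+ k.*2.+1 * x| <= A2 * (`|s| ^+ k.*2 + 1).
Hypotheses (bx : forall n, bounded_measurable (x n)) (x2 : forall n w, `|x n w| <= 2).
Hypotheses (bxk : forall n j, bounded_measurable (xk n j)) (xk2 : forall n j w, `|xk n j w| <= 2).
Hypothesis hd : forall n j, (j <= n < N)%N ->
  Ex P (fun w => `|x n w - xk n j w|) <= C * r ^+ (k.+1 * j).
Let S m w := \sum_(i < m) x i w.
Hypothesis hS : forall m n j, (0 < j)%N -> (m + j <= n.+1)%N -> (n < N)%N ->
  Ex P (fun w => S m w ^+ k.*2.+1 * xk n j w) = 0.
Let e m := Ex P (fun w => S m w ^+ k.*2.+2).

Let bS m : bounded_measurable (S m).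
Proof. by rewrite /S; bounded_measurable_tac. Qed.

Let N1 : 1 <= N%:R :> R.
Proof. by rewrite ler1n. Qed.

Let Sabs m w l : `|S m w| ^+ l.*2 = (S m w ^+ 2) ^+ l.
Proof. by rewrite -mul2n exprM real_normK// num_real. Qed.

Let Spow m w : S m w ^+ k.*2.+2 = (S m w ^+ 2) ^+ k.+1.
Proof. by rewrite -doubleS -mul2n exprM. Qed.

(** Young's inequality with [y = 1] and weight 1/N trades the power 2k for 2k+2 at the price N^k; a
    second N^k covers the added 1. *)
Lemma moment_quadratic_term n :
  Ex P (fun w => `|S n w| ^+ k.*2 + 1) <= e n / N%:R + 2 * N%:R ^+ k.
Proof.
have bSn := bS n; have Nk : 1 <= N%:R ^+ k :> R by rewrite exprn_ege1.
apply: (@le_trans _ _ (Ex P (fun w => N%:R^-1 * S n w ^+ k.*2.+2 + 2 * N%:R ^+ k))).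
  apply: Ex_le; [by bounded_measurable_tac..|] => w.
  have := @young_pow _ k (S n w ^+ 2) 1 N%:R^-1 (sqr_ge0 _) ler01.
  by rewrite invr_gt0 ltr0n => /(_ N0); rewrite mulr1 invrK expr1n Sabs Spow; lra.
rewrite ExD; [|by bounded_measurable_tac..]; rewrite ExZ; last by bounded_measurable_tac.
by rewrite Ex_cst mulrC.
Qed.

(** The odd powers of two consecutive partial sums are uncorrelated with [xk n j], so [x n] may be
    replaced by [x n - xk n j], which [hd] makes small. Young's inequality with weight [l = r^j / N]
    then costs [l^-k = N^k r^(-jk)]: this is what k of the k+1 powers of [r^j] in [hd] pay for. The
    remaining power makes the sum over [j] converge. *)
Lemma moment_cross_term n j M : (0 < j <= n)%N -> (n < N)%N ->
  (forall m, (m <= n)%N -> e m <= M) ->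
  `|Ex P (fun w => (S (n - j.-1) w ^+ k.*2.+1 - S (n - j) w ^+ k.*2.+1) * x n w)|
   <= A1 * (r ^+ j * (M / N%:R + (4 ^+ k + 1) * C * N%:R ^+ k)).
Proof.
move=> /andP[j0 jn] nN hM; have bSn m := bS m.
have bxn := bx n; have bxkn := bxk n j.
have Nk : 1 <= N%:R ^+ k :> R by rewrite exprn_ege1.
have Nj : (n - j.-1 = (n - j).+1)%N by case: j j0 jn {bxkn} => // j _ jn; rewrite -subSn.
have /andP[r0 r1] := r01.
have -> : Ex P (fun w => (S (n - j.-1) w ^+ k.*2.+1 - S (n - j) w ^+ k.*2.+1) * x n w) =
    Ex P (fun w => (S (n - j.-1) w ^+ k.*2.+1 - S (n - j) w ^+ k.*2.+1) * (x n w - xk n j w)).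
  (* [hS] admits [m + j = n + 1], which is exactly the longer of the two sums. *)
  have e1 : Ex P (fun w => S (n - j.-1) w ^+ k.*2.+1 * xk n j w) = 0.
    by apply: hS => //; rewrite Nj addSn subnK.
  have e2 : Ex P (fun w => S (n - j) w ^+ k.*2.+1 * xk n j w) = 0.
    by apply: hS => //; rewrite subnK// leqnSn.
  transitivity (Ex P (fun w => (S (n - j.-1) w ^+ k.*2.+1 - S (n - j) w ^+ k.*2.+1) * x n w) -
     (Ex P (fun w => S (n - j.-1) w ^+ k.*2.+1 * xk n j w) - Ex P (fun w => S (n - j) w ^+ k.*2.+1 * xk n j w))).
    by rewrite e1 e2 !subr0.
  rewrite -ExB; [|by bounded_measurable_tac..]; rewrite -ExB; [|by bounded_measurable_tac..].
  by congr Ex; apply/funext => w; ring.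
apply: (le_trans (Ex_norm _)); first by bounded_measurable_tac.
pose y w := `|x n w - xk n j w|.
have y0 w : 0 <= y w by exact: normr_ge0.
(* Young's inequality produces [y^(k+1)]; this bound reduces it to [4^k * y], and [hd] controls only
   the first moment of [y]. *)
have y4 w : y w <= 4.
  by apply: (le_trans (ler_normB _ _)); have := x2 n w; have := xk2 n j w; lra.
have by_ : bounded_measurable y by rewrite /y; bounded_measurable_tac.
have rj : 0 < r ^+ j by rewrite exprn_gt0.
pose l := r ^+ j / N%:R.
have l0 : 0 < l by rewrite divr_gt0// ltr0n.
apply: (@le_trans _ _ (Ex P (fun w => A1 * ((l * S (n - j) w ^+ k.*2.+2) + ((l^-1 * 4) ^+ k + 1) * y w)))).
  apply: Ex_le; [by bounded_measurable_tac..|] => w.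
  rewrite normrM -/(y w) Nj [S (n - j).+1 w]/S big_ord_recr /=.
  have h1 := hA1 (S (n - j)%N w) (x2 (n - j) w).
  apply: (@le_trans _ _ (A1 * (`|S (n - j) w| ^+ k.*2 + 1) * y w)); first by apply: ler_wpM2r.
  rewrite -mulrA; apply: ler_wpM2l => //.
  have h2 := @young_pow _ k (S (n - j) w ^+ 2) (y w) l (sqr_ge0 _) (y0 w) l0.
  rewrite Sabs Spow mulrDl mul1r mulrDl mul1r addrA lerD2r; apply: (le_trans h2).
  rewrite lerD2l exprMn exprSr mulrA ler_wpM2r// ler_wpM2l ?exprn_ge0 ?invr_ge0//; first exact: ltW.
  by rewrite lerXn2r// nnegrE.
rewrite ExZ; last by bounded_measurable_tac.
apply: ler_wpM2l => //.
rewrite ExD; [|by bounded_measurable_tac..]; rewrite ExZ; last by bounded_measurable_tac.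
rewrite ExZ; last by bounded_measurable_tac.
have h3 := hM (n - j)%N (leq_subr _ _).
have h4 := hd (n := n) (j := j); rewrite jn nN in h4; have {}h4 := h4 isT.
rewrite -/(y) -/(e (n - j)%N) in h4 *.
have li : l^-1 = N%:R / r ^+ j by rewrite /l invf_div.
have c0 : 0 <= (l^-1 * 4) ^+ k by rewrite exprn_ge0// mulr_ge0// invr_ge0 ltW.
have h5 := ler_wpM2l (ltW l0) h3.
have h6 : ((l^-1 * 4) ^+ k + 1) * Ex P y <= ((l^-1 * 4) ^+ k + 1) * (C * r ^+ (k.+1 * j)).
  by apply: ler_wpM2l => //; rewrite addr_ge0.
apply: (le_trans (lerD h5 h6)).
have -> : l * M = r ^+ j * (M / N%:R) by rewrite /l; ring.
rewrite [leRHS]mulrDr lerD2l.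
have -> : r ^+ (k.+1 * j) = r ^+ j * (r ^+ j) ^+ k by rewrite mulSn exprD mulnC exprM.
have rk1 : (r ^+ j) ^+ k <= 1 by rewrite -exprM exprn_ile1// ltW.
have rk0 : 0 <= (r ^+ j) ^+ k by rewrite exprn_ge0// ltW.
have -> : ((l^-1 * 4) ^+ k + 1) * (C * (r ^+ j * (r ^+ j) ^+ k)) =
   r ^+ j * (C * (4 ^+ k * N%:R ^+ k + (r ^+ j) ^+ k)).
  have : (l^-1 * 4) ^+ k * (r ^+ j) ^+ k = 4 ^+ k * N%:R ^+ k.
    rewrite -!exprMn li; congr (_ ^+ _); field; exact: lt0r_neq0.
  by move=> <-; ring.
rewrite ler_pM2l// -mulrA [leRHS]mulrCA; apply: ler_wpM2l => //.
by rewrite mulrDl mul1r lerD2l; lra.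
Qed.

Let c1 := k.*2.+2%:R * (A1 * ((1 - r)^-1 * (1 + (4 ^+ k + 1) * C))) + 2 * A2.

(** Second-order expansion of [(S n + x n)^(2k+2)]. The linear term is telescoped into cross terms
    whose bounds form a geometric series; what is left is the quadratic term. *)
Lemma moment_step n M : (n < N)%N -> (forall m, (m <= n)%N -> e m <= M) -> 0 <= M ->
  e n.+1 <= M + c1 * (M / N%:R + N%:R ^+ k).
Proof.
move=> nN hM M0; have bSn m := bS m; have bxn := bx n.
have Nk : 1 <= N%:R ^+ k :> R by rewrite exprn_ege1.
have /andP[r0 r1] := r01.
have h1 : e n.+1 <= Ex P (fun w => (S n w ^+ k.*2.+2 + k.*2.+2%:R * (S n w ^+ k.*2.+1 * x n w)) +
    A2 * (`|S n w| ^+ k.*2 + 1)).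
  apply: Ex_le; [by bounded_measurable_tac..|] => w.
  have := hA2 (S n w) (x2 n w); rewrite /S big_ord_recr /= -/(S n w).
  by move=> /(le_trans (ler_norm _)); rewrite -!mulrA; lra.
apply: (le_trans h1); rewrite ExD; [|by bounded_measurable_tac..]; rewrite ExD; [|by bounded_measurable_tac..].
rewrite ExZ; last by bounded_measurable_tac.
rewrite [X in _ + X]ExZ; last by bounded_measurable_tac.
have q := moment_quadratic_term n.
have h2 : Ex P (fun w => S n w ^+ k.*2.+1 * x n w) <=
    A1 * ((1 - r)^-1 * (M / N%:R + (4 ^+ k + 1) * C * N%:R ^+ k)).
  have -> : Ex P (fun w => S n w ^+ k.*2.+1 * x n w) =
     \sum_(j < n) Ex P (fun w => (S (n - j) w ^+ k.*2.+1 - S (n - j.+1) w ^+ k.*2.+1) * x n w).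
    rewrite -Ex_sum; last by move=> j; bounded_measurable_tac.
    congr Ex; apply/funext => w; rewrite -mulr_suml.
    rewrite -(telescope_down (fun m => S m w ^+ k.*2.+1)).
    by rewrite [S 0%N w]big_ord0 expr0n subr0.
  set Q := M / _ + _.
  have Q0 : 0 <= Q by rewrite addr_ge0 ?divr_ge0// mulr_ge0// mulr_ge0// addr_ge0// exprn_ge0.
  apply: (@le_trans _ _ (\sum_(j < n) A1 * (r ^+ j.+1 * Q))).
    apply: ler_sum => j _; apply: (le_trans (ler_norm _)).
    by have := @moment_cross_term n j.+1 M; rewrite /= ltn_ord; exact.
  rewrite -mulr_sumr; apply: ler_wpM2l => //; rewrite -mulr_suml; apply: ler_wpM2r => //.
  apply: (@le_trans _ _ (\sum_(j < n) r ^+ j)); last by apply: geometric_sum_le; rewrite r1 ltW.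
  by apply: ler_sum => j _; rewrite exprS ler_piMl ?exprn_ge0// ltW.
have h3 := hM n (leqnn n).
have N0' : 0 <= N%:R^-1 :> R by rewrite invr_ge0.
have MN : 0 <= M / N%:R by rewrite divr_ge0.
have h5 := ler_wpM2r N0' h3.
have -> : M + c1 * (M / N%:R + N%:R ^+ k) = M + k.*2.+2%:R * (A1 * ((1 - r)^-1 * ((1 + (4 ^+ k + 1) * C) * (M / N%:R + N%:R ^+ k)))) + A2 * (2 * (M / N%:R + N%:R ^+ k)) by rewrite /c1; ring.
apply: lerD; first apply: lerD => //; apply: ler_wpM2l => //.
  apply: (le_trans h2); apply: ler_wpM2l => //; apply: ler_wpM2l => //; first by rewrite invr_ge0; lra.
  by rewrite [leRHS](_ : _ = M / N%:R + (4 ^+ k + 1) * C * N%:R ^+ k + (N%:R ^+ k + (4 ^+ k + 1) * C * (M / N%:R))); [rewrite lerDl addr_ge0// ?mulr_ge0// ?addr_ge0// exprn_ge0|ring].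
by apply: (le_trans q); lra.
Qed.

(** A discrete Gronwall argument: each of the N steps multiplies the bound by [q = 1 + c1 / N] and
    adds [c1 * N^k], while [q^N <= exp c1]. *)
Lemma weak_dependence_moment : e N <= c1 * expR c1 * N%:R ^+ k.+1.
Proof.
have /andP[r0 r1] := r01.
have Nk : 0 <= N%:R ^+ k :> R by rewrite exprn_ge0.
have NN : 0 < N%:R :> R by rewrite ltr0n.
have c10 : 0 <= c1.
  rewrite addr_ge0// ?mulr_ge0//; first by rewrite invr_ge0; lra.
  by rewrite addr_ge0// mulr_ge0// addr_ge0// exprn_ge0.
pose q := 1 + c1 / N%:R.
have q1 : 1 <= q by rewrite lerDl divr_ge0.
pose B n := c1 * N%:R ^+ k * n%:R * q ^+ n.
have B0 n : 0 <= B n by rewrite /B !mulr_ge0// exprn_ge0//; lra.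
have BS n : B n * q + c1 * N%:R ^+ k <= B n.+1.
  have -> : B n.+1 = B n * q + c1 * N%:R ^+ k * q ^+ n.+1 by rewrite /B -natr1 exprS; ring.
  by rewrite lerD2l ler_peMr// ?mulr_ge0// exprn_ege1.
have H n : (n <= N)%N -> forall m, (m <= n)%N -> e m <= B n.
  elim: n => [_ m|n IH nN m].
    rewrite leqn0 => /eqP ->; apply: le_trans (B0 _); rewrite /e.
    by under [X in Ex _ X]eq_fun do rewrite /S big_ord0 expr0n; rewrite Ex_cst.
  have {}IH := IH (ltnW nN).
  rewrite leq_eqVlt => /predU1P[->|]; last first.
    rewrite ltnS => /IH h; apply: le_trans (BS n); apply: (le_trans h).
    by rewrite -[leLHS]addr0 lerD// ?mulr_ge0// ler_peMr.
  apply: le_trans (BS n); apply: (le_trans (moment_step nN IH (B0 n))).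
  by rewrite le_eqVlt; apply/orP; left; apply/eqP; rewrite /q; ring.
apply: (le_trans (H N (leqnn N) N (leqnn N))).
rewrite /B exprSr -!mulrA ler_wpM2l//.
rewrite [leRHS]mulrC -mulrA; apply: ler_wpM2l => //; apply: ler_wpM2l => //.
apply: (@le_trans _ _ (expR (c1 / N%:R) ^+ N)).
  by rewrite lerXn2r ?nnegrE ?expR_ge0 ?expR_ge1Dx//; lra.
by rewrite -expRM_natl mulrC divfK ?gt_eqF.
Qed.
End Step.
End MomentBound.

(** * Cascaded linear filters *)

Section Filt.
Context {R : realType}.

Lemma geometric_tail_series (f : nat -> R) (A rho : R) : 0 <= rho < 1 ->
  (forall i, `|f i| <= A * rho ^+ i) ->
  exists l : R, (\sum_(i < T) f i @[T --> \oo] --> l) /\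
    forall T, `|l - \sum_(i < T) f i| <= A * (rho ^+ T / (1 - rho)).
Proof.
move=> /andP[r0 r1] h.
have r2 : 0 < 1 - rho by lra.
have A0 : 0 <= A by have := h 0%N; rewrite expr0 mulr1; apply: le_trans.
have cv : cvgn (series f).
  apply: normed_cvg; apply: (@series_le_cvg _ _ (geometric A rho)) => [i|i|i|].
  - exact: normr_ge0.
  - by rewrite /geometric /= mulr_ge0// exprn_ge0.
  - exact: h.
  - by apply: is_cvg_geometric_series; rewrite ger0_norm.
have E : series f = (fun T => \sum_(i < T) f i).
  by apply/funext => T; rewrite /series /= big_mkord.
exists (limn (series f)); split; first by rewrite -E.
move=> T; have {}cv : (series f T' - \sum_(i < T) f i) @[T' --> \oo] --> limn (series f) - \sum_(i < T) f i.
  by apply: cvgB => //; exact: cvg_cst.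
rewrite -(cvg_lim _ (cvg_norm cv))//; apply: limr_le; first by apply: cvgP; exact: cvg_norm cv.
near=> T'.
have TT : (T <= T')%N by near: T'; exact: nbhs_infty_ge.
have E2 (u v : R) : u + v - u = v by ring.
rewrite E -(subnKC TT) big_split_ord /= E2.
apply: (le_trans (ler_norm_sum _ _ _)).
apply: (@le_trans _ _ (\sum_(i < (T' - T)%N) A * (rho ^+ T * rho ^+ i))).
  by apply: ler_sum => i _; rewrite -exprD; exact: h.
rewrite -mulr_sumr -mulr_sumr !ler_wpM2l ?exprn_ge0//.
rewrite -[leRHS]mul1r ler_pdivlMr// mulrC.
have -> : (1 - rho) * (\sum_(i < (T' - T)%N) rho ^+ i) = 1 - rho ^+ (T' - T)%N.
  by rewrite -opprB mulNr -subrX1; ring.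
by rewrite gerBl exprn_ge0.
Unshelve. all: by end_near. Qed.

Lemma cvg_big_sum {T : Type} (F : set_system T) {FF : Filter F} I (s : seq I) (f : I -> T -> R) (l : I -> R) :
  (forall i, f i t @[t --> F] --> l i) ->
  \sum_(i <- s) f i t @[t --> F] --> \sum_(i <- s) l i.
Proof.
move=> h; elim: s => [|i s IH].
  by rewrite big_nil; under eq_fun do rewrite big_nil; exact: cvg_cst.
by rewrite big_cons; under eq_fun do rewrite big_cons; apply: cvgD.
Qed.

(** The left side is the geometric sum with each of its [n + 1] terms replaced by the smallest
    one. *)
Lemma natmul_exp_le (r : R) n : 0 <= r < 1 -> n.+1%:R * r ^+ n <= (1 - r)^-1.
Proof.
move=> /andP[r0 r1]; have r2 : 0 < 1 - r by lra.
rewrite -[leRHS]mul1r ler_pdivlMr//.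
apply: (@le_trans _ _ ((1 - r) * \sum_(i < n.+1) r ^+ i)); last first.
  have -> : (1 - r) * (\sum_(i < n.+1) r ^+ i) = 1 - r ^+ n.+1.
    by rewrite -opprB mulNr -subrX1; ring.
  by rewrite gerBl exprn_ge0.
have -> : n.+1%:R * r ^+ n = \sum_(i < n.+1) r ^+ n by rewrite sumr_const card_ord mulr_natl.
rewrite mulrC ler_wpM2l//; first exact: ltW.
rewrite ler_sum// => i _; apply: ler_wiXn2l; rewrite ?(ltW r1)//.
by rewrite -ltnS.
Qed.

(** The impulse response (Markov parameters) of the filter; the leading 1 is the direct feedthrough
    of the innovation form. *)
Definition impulse {m} (F : 'M[R]_m) (G : 'cV[R]_m) (C : 'rV[R]_m) (i : nat) : R :=
  if i is i'.+1 then (C *m iter i' (mulmx F) G) 0 0 else 1.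

Lemma filter_fromE {m} (F : 'M[R]_m) (G : 'cV[R]_m) (C : 'rV[R]_m) x n0 k :
  Defs.filter_from F G C x n0 k =
  \sum_(i < k.+1) impulse F G C i * x (n0 + (k - i)%N%:Z).
Proof.
have st l : filter_state F G x n0 l =
    \sum_(i < l) x (n0 + (l - i.+1)%N%:Z) *: iter i (mulmx F) G.
  elim: l => [|l IH]; first by rewrite big_ord0.
  rewrite big_ord_recl /= IH mulmx_sumr addrC subn1 /=; congr (_ + _).
  by apply: eq_bigr => i _; rewrite -scalemxAr /bump /= add1n subSS.
rewrite /Defs.filter_from big_ord_recl /= subn0 mul1r addrC; congr (_ + _).
rewrite st mulmx_sumr summxE; apply: eq_bigr => i _.
by rewrite -scalemxAr mxE mulrC /bump /= add1n.
Qed.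

(* Of the three powers of [r] one pays for the growth of the past noise, one for the convolution and one remains. *)
Variables (r A : R) (a g : nat -> R).
Hypotheses (r01 : 0 < r < 1) (A0 : 0 <= A).
Hypothesis ha : forall i, `|a i| <= A * r ^+ (3 * i).
Hypothesis hg : forall i, `|g i| <= A * r ^+ (3 * i).

(** The coefficient of [x (n - i)] at time [n], when the filter [a] runs from the infinite past and
    its output is fed into [g] started at time 0. The cutoff [j <= n] expresses this start, so
    [cascade i i] is the coefficient of the stationary cascade. *)
Definition cascade (n i : nat) : R := \sum_(j < i.+1 | (j <= n)%N) g j * a (i - j)%N.

Lemma cascade_stable n i : (i <= n)%N -> cascade n i = cascade i i.
Proof.
move=> ni; rewrite /cascade; apply: eq_bigl => j.
by rewrite (leq_trans _ ni) -ltnS ltn_ord.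
Qed.

Lemma cascade_le n i : `|cascade n i| <= A ^+ 2 / (1 - r) * (r ^+ 2) ^+ i.
Proof.
have /andP[r0 r1] := r01; have r2 : 0 < 1 - r by lra.
apply: (le_trans (ler_norm_sum _ _ _)).
apply: (@le_trans _ _ (\sum_(j < i.+1) A ^+ 2 * (r ^+ j * (r ^+ 2) ^+ i))).
  rewrite big_mkcond /=; apply: ler_sum => j _.
  have ji : (j <= i)%N by rewrite -ltnS.
  have B0 : 0 <= A ^+ 2 * (r ^+ j * (r ^+ 2) ^+ i).
    by rewrite !mulr_ge0// ?exprn_ge0// ?exprn_ge0// ltW.
  case: ifP => // _; rewrite normrM.
  apply: (@le_trans _ _ ((A * r ^+ (3 * j)) * (A * r ^+ (3 * (i - j))))); first exact: ler_pM.
  have -> : (A * r ^+ (3 * j)) * (A * r ^+ (3 * (i - j))) = A ^+ 2 * r ^+ (3 * i).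
    by rewrite mulrACA -expr2 -exprD -mulnDr subnKC.
  rewrite ler_wpM2l ?exprn_ge0// -exprM -exprD ler_wiXn2l// ?ltW//.
  by rewrite (mulSn 2 i) leq_add2r.
have ri : 0 <= (r ^+ 2) ^+ i by rewrite !exprn_ge0// ltW.
rewrite -mulr_sumr -mulr_suml mulrA ler_wpM2r//.
rewrite ler_wpM2l ?exprn_ge0//.
rewrite -[leRHS]mul1r ler_pdivlMr// mulrC.
have -> : (1 - r) * (\sum_(i < i.+1) r ^+ i) = 1 - r ^+ i.+1.
  by rewrite -opprB mulNr -subrX1; ring.
by rewrite gerBl exprn_ge0// ltW.
Qed.

Variable x : int -> R.
Hypothesis hx : exists B : R, forall j : nat, `|x (- j%:Z)| * r ^+ j <= B.

Lemma past_growth (n : int) : exists2 B : R, 0 <= B & forall i : nat, `|x (n - i%:Z)| <= B / r ^+ i.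
Proof.
have /andP[r0 r1] := r01.
have [B0 hB0] := hx.
have key (k : nat) : exists2 B : R, 0 <= B & forall i : nat, `|x (k%:Z - i%:Z)| <= B / r ^+ i.
  elim: k => [|k [B Bge hB]].
    exists B0 => [|i]; first by apply: le_trans (hB0 0%N); rewrite mulr_ge0// exprn_ge0// ltW.
    by rewrite sub0r ler_pdivlMr ?exprn_gt0.
  exists (B + `|x k.+1|) => [|[|i]]; first by rewrite addr_ge0.
    by rewrite subr0 expr0 divr1 lerDr.
  have -> : k.+1%:Z - i.+1%:Z = k%:Z - i%:Z by lia.
  apply: (le_trans (hB i)); apply: (@le_trans _ _ (B / r ^+ i.+1)).
    rewrite ler_wpM2l// lef_pV2 ?posrE ?exprn_gt0//.
    by rewrite exprS ler_piMl ?exprn_ge0// ltW.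
  by rewrite ler_wpM2r ?lerDl// invr_ge0 exprn_ge0// ltW.
case: n => k; first exact: key.
have [B Bge hB] := key 0%N; exists (B / r ^+ k.+1) => [|i].
  by rewrite divr_ge0// exprn_ge0// ltW.
have := hB (k.+1 + i)%N; rewrite NegzE exprD invfM mulrA.
by congr (`|x _| <= _); lia.
Qed.

Let y (n : int) : R := limn (fun T => \sum_(i < T) a i * x (n - i%:Z)).

Lemma output_tail (n : int) (B : R) : 0 <= B -> (forall i : nat, `|x (n - i%:Z)| <= B / r ^+ i) ->
  ((\sum_(i < T) a i * x (n - i%:Z)) @[T --> \oo] --> y n) /\
  forall T, `|y n - \sum_(i < T) a i * x (n - i%:Z)| <= A * B * ((r ^+ 2) ^+ T / (1 - r ^+ 2)).
Proof.
move=> B0 hB; have /andP[r0 r1] := r01.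
have [||l [cl hl]] := @geometric_tail_series (fun i => a i * x (n - i%:Z)) (A * B) (r ^+ 2).
- by rewrite exprn_ge0 ?ltW//= expr_lt1// ltW.
- move=> i; rewrite normrM.
  apply: (@le_trans _ _ ((A * r ^+ (3 * i)) * (B / r ^+ i))); first exact: ler_pM.
  rewrite -exprM mulSn exprD le_eqVlt; apply/orP; left; apply/eqP; field.
  by rewrite expf_neq0// gt_eqF.
by rewrite /y (cvg_lim _ cl)//; split.
Qed.

Lemma cascade_reindex (q : int) n T :
  \sum_(i < T) cascade n i * x (q - i%:Z) =
  \sum_(j < T | (j <= n)%N) g j * \sum_(i < (T - j)%N) a i * x (q - j%:Z - i%:Z).
Proof.
rewrite /cascade.
under eq_bigr do rewrite mulr_suml.
rewrite (eq_bigr (fun i : 'I_T => \sum_(j < T | (j <= n)%N && (j <= i)%N) g j * a (i - j)%N * x (q - i%:Z))); last first.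
  by move=> i _; rewrite (big_ord_widen_cond T (fun j => (j <= n)%N) (fun j => g j * a (i - j)%N * x (q - i%:Z))) ?ltn_ord//.
rewrite (exchange_big_dep (fun j : 'I_T => (j <= n)%N))/=; last by move=> i j _ /andP[].
apply: eq_bigr => j jn; rewrite mulr_sumr.
rewrite (eq_bigl (fun i : 'I_T => (j <= i)%N)); last by move=> i; rewrite jn.
rewrite -(big_geq_mkord j T xpredT (fun i : nat => g j * a (i - j)%N * x (q - i%:Z))).
rewrite -{1}(add0n (val j)) big_addn big_mkord; apply: eq_bigr => i _.
rewrite addnK -mulrA; congr (_ * (_ * x _)); rewrite PoszD opprD; ring.
Qed.

(** Once [T > n], all of the finitely many inner sums are present, and each converges to an output
    of the first filter. *)
Lemma transient_cascade (n : nat) :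
  \sum_(i < T) cascade n i * x (n%:Z - i%:Z) @[T --> \oo] -->
  \sum_(j < n.+1) g j * y (n%:Z - j%:Z).
Proof.
apply: (@cvg_trans _ ((\sum_(j < n.+1) g j * \sum_(i < (T - j)%N) a i * x (n%:Z - j%:Z - i%:Z)) @[T --> \oo])).
  apply: near_eq_cvg; near=> T.
  have nT : (n.+1 <= T)%N by near: T; exact: nbhs_infty_ge.
  rewrite cascade_reindex.
  by rewrite (big_ord_widen T (fun j => g j * \sum_(i < (T - j)%N) a i * x (n%:Z - j%:Z - i%:Z))).
apply: cvg_big_sum => j; apply: cvgM; first exact: cvg_cst.
have [B B0 hB] := past_growth (n%:Z - j%:Z).
have [cv _] := output_tail B0 hB.
by rewrite -(@cvg_shiftn j) /=; under eq_fun do rewrite addnK.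
Unshelve. all: by end_near. Qed.

(** The left truncation runs over a triangle of lags, the right one contains full inner series.
    Their difference consists of T inner tails, each of order r^(2T), and [natmul_exp_le] absorbs
    the factor T. *)
Lemma stationary_cascade :
  exists2 l : R, (\sum_(i < T) cascade i i * x (0 - i%:Z) @[T --> \oo] --> l) &
    (\sum_(j < T) g j * y (0 - j%:Z) @[T --> \oo] --> l).
Proof.
have /andP[r0 r1] := r01.
have [B B0 hB] := past_growth 0.
have rr : 0 <= r ^+ 2 < 1 by rewrite exprn_ge0 ?ltW//= expr_lt1// ltW.
have /andP[rr0 rr1] := rr.
have [||l [cl _]] := @geometric_tail_series (fun i => cascade i i * x (0 - i%:Z)) (A ^+ 2 / (1 - r) * B) r.
- by rewrite r1 ltW.
- move=> i; rewrite normrM.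
  apply: (@le_trans _ _ ((A ^+ 2 / (1 - r) * (r ^+ 2) ^+ i) * (B / r ^+ i))).
    by apply: ler_pM => //; exact: cascade_le.
  rewrite -exprM mulSn mul1n exprD le_eqVlt; apply/orP; left; apply/eqP; field.
  by rewrite expf_neq0 ?gt_eqF// subr_gt0.
exists l => //.
pose e T := \sum_(j < T) g j * y (0 - j%:Z) - \sum_(i < T) cascade i i * x (0 - i%:Z).
have eE : (fun T => \sum_(j < T) g j * y (0 - j%:Z)) = (fun T => e T + \sum_(i < T) cascade i i * x (0 - i%:Z)).
  by apply/funext => T; rewrite /e subrK.
rewrite eE -[l]add0r; apply: cvgD => //.
pose D := A * (A * B / (1 - r ^+ 2)) / (1 - r).
have eb T : `|e T| <= D * r ^+ T.
  rewrite /e; have -> : \sum_(i < T) cascade i i * x (0 - i%:Z) = \sum_(i < T) cascade T i * x (0 - i%:Z).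
    by apply: eq_bigr => i _; rewrite (@cascade_stable T) ?cascade_stable// ltnW.
  rewrite cascade_reindex [X in _ - X](eq_bigl xpredT); last by move=> j; exact: (ltnW (ltn_ord j)).
  rewrite -sumrB; apply: (le_trans (ler_norm_sum _ _ _)).
  apply: (@le_trans _ _ (\sum_(j < T) A * (A * B / (1 - r ^+ 2)) * (r ^+ 2) ^+ T)).
    apply: ler_sum => j _; rewrite -mulrBr normrM.
    have [||_ tl] := @output_tail (0 - j%:Z) (B / r ^+ j).
    - by rewrite divr_ge0// exprn_ge0// ltW.
    - move=> i; have := hB (j + i)%N; rewrite exprD invfM mulrA.
      by congr (`|x _| <= _); rewrite PoszD; ring.
    apply: (@le_trans _ _ ((A * r ^+ (3 * j)) * (A * (B / r ^+ j) * ((r ^+ 2) ^+ (T - j) / (1 - r ^+ 2))))).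
      by apply: ler_pM => //; exact: tl.
    have jT : (j <= T)%N by rewrite ltnW.
    have -> : (r ^+ 2) ^+ T = (r ^+ 2) ^+ (T - j) * r ^+ (2 * j) by rewrite exprM -exprD subnK.
    rewrite (mulSn 2) exprD.
    rewrite le_eqVlt; apply/orP; left; apply/eqP; field.
    by rewrite expf_neq0 ?gt_eqF//= subr_gt0.
  rewrite sumr_const card_ord -mulr_natr /D -[leLHS]mulrA -[leRHS]mulrA; apply: ler_wpM2l.
    by rewrite mulr_ge0// divr_ge0 ?mulr_ge0//; lra.
  rewrite mulrC -exprM mulSn mul1n exprD mulrA; apply: ler_wpM2r; first by rewrite exprn_ge0// ltW.
  apply: le_trans (@natmul_exp_le r T _); last by rewrite r1 ltW.
  by rewrite ler_wpM2r// ?ler_nat// exprn_ge0// ltW.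
apply: norm_cvg0; apply: (@squeeze_cvgr _ _ _ _ (fun=> 0) (geometric D r)).
- by near=> T; rewrite normr_ge0 eb.
- exact: cvg_cst.
- by apply: cvg_geometric; rewrite gtr0_norm.
Unshelve. all: by end_near. Qed.

End Filt.

(** * Effect of truncating a series on expected cosines *)

Section Tail.
Context {R : realType} {d : measure_display} {Omega : measurableType d}.
Variable P : probability Omega R.

Lemma cos_lipschitz (a b : R) : `|cos a - cos b| <= `|a - b|.
Proof.
wlog ab : a b / b <= a => [h|].
  have [ba|/ltW ab] := leP b a; first exact: h.
  by rewrite -normrN opprB -[X in _ <= X]normrN opprB; exact: h.
have [|x _ ->] := @MVT_segment R cos (fun x => - sin x) b a ab.
- by apply: continuous_subspaceT; exact: continuous_cos.
rewrite normrM normrN ler_piMl// ler_norml sin_le1 andbT.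
exact: sin_geN1.
Qed.

Lemma bm_cosT (u f : R) (X : Omega -> R) : measurable_fun setT X ->
  bounded_measurable (fun w => cos (f + u * X w)).
Proof. by move=> mX; apply: (bm_comp (bm_cos u f) mX). Qed.

Lemma Ex_dct (F : nat -> Omega -> R) (G : Omega -> R) (C : R) :
  (forall n, measurable_fun setT (F n)) -> measurable_fun setT G ->
  (forall n w, `|F n w| <= C) -> {ae P, forall w, F n w @[n --> \oo] --> G w} ->
  Ex P (F n) @[n --> \oo] --> Ex P G.
Proof.
move=> mF mG hF FG.
have [|||||h1 h2 h3] := @dominated_convergence _ _ _ P setT measurableT
  (fun n => EFin \o F n) (EFin \o G) (cst C%:E).
- by move=> n; exact/measurable_EFinP.
- exact/measurable_EFinP.
- apply: filterS FG => w h _; apply: cvg_EFin; last exact: h.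
  by apply: nearW.
- by apply/bm_integrable/bm_cst.
- by apply: aeW => w n _ /=; rewrite lee_fin.
have bF n : bounded_measurable (F n) by split; [|exists C].
rewrite /Ex /Rintegral; apply: fine_cvg; rewrite fineK ?integrable_fin_num//.
Qed.

Lemma Ex_abs_sum_tail (Y : nat -> Omega -> R) (b : nat -> R) (D rho mu : R) T T' :
  0 <= rho < 1 -> 0 <= D -> (forall i, P.-integrable setT (EFin \o Y i)) ->
  (forall i, Ex P (fun w => `|Y i w|) <= mu) -> (forall i, `|b i| <= D * rho ^+ i) -> (T <= T')%N ->
  Ex P (fun w => `|\sum_(i < T') b i * Y i w - \sum_(i < T) b i * Y i w|) <= D * mu / (1 - rho) * rho ^+ T.
Proof.
move=> /andP[r0 r1] D0 iY hY hb TT.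
have iaY i : P.-integrable setT (EFin \o (fun w => `|Y i w|)).
  by have := integrable_abse (iY i); apply: eq_integrable.
have iZ (c : R) (Z : Omega -> R) : P.-integrable setT (EFin \o Z) -> P.-integrable setT (EFin \o (fun w => c * Z w)).
  by move=> iZ; have := integrableZl measurableT c iZ; apply: eq_integrable.
have mu0 : 0 <= mu by apply: le_trans (hY 0%N); apply: Ex_ge0.
have E2 (u v : R) : u + v - u = v by ring.
have -> : (fun w => `|\sum_(i < T') b i * Y i w - \sum_(i < T) b i * Y i w|) =
    (fun w => `|\sum_(i < T' - T) b (T + i)%N * Y (T + i)%N w|).
  by apply/funext => w; rewrite -[in X in X - _](subnKC TT) big_split_ord /= E2.
apply: (@le_trans _ _ (Ex P (fun w => \sum_(i < T' - T) D * rho ^+ (T + i) * `|Y (T + i)%N w|))).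
  apply: Ex_le.
  - have : P.-integrable setT (EFin \o (fun w => \sum_(i < T' - T) b (T + i)%N * Y (T + i)%N w)).
      by apply: integrable_sum => i; exact: iZ.
    by move/integrable_abse; apply: eq_integrable.
  - by apply: integrable_sum => i; exact: iZ.
  - move=> w; apply: (le_trans (ler_norm_sum _ _ _)); apply: ler_sum => i _.
    by rewrite normrM ler_wpM2r.
rewrite Ex_sum; last by move=> i; exact: iZ.
under eq_bigr do rewrite ExZ//.
apply: (@le_trans _ _ (\sum_(i < T' - T) D * mu * rho ^+ T * rho ^+ i)).
  apply: ler_sum => i _; rewrite exprD.
  rewrite [leRHS](_ : _ = D * (rho ^+ T * rho ^+ i) * mu); last by ring.
  by rewrite ler_wpM2l// !mulr_ge0// exprn_ge0.
rewrite -mulr_sumr [leRHS](_ : _ = D * mu * rho ^+ T * (1 - rho)^-1); last by ring.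
rewrite ler_wpM2l ?mulr_ge0 ?exprn_ge0//.
by apply: geometric_sum_le; rewrite r0.
Qed.

(** Two finite truncations are compared by the Lipschitz property of the cosine. The bound for [e]
    follows by letting [T'] grow: dominated convergence applies to the bounded cosines, with no
    integrability of [e] itself. *)
Lemma Ex_cos_tail (Y : nat -> Omega -> R) (b : nat -> R) (D rho mu u f : R) (e : Omega -> R) :
  0 <= rho < 1 -> 0 <= D -> (forall i, measurable_fun setT (Y i)) -> (forall i, P.-integrable setT (EFin \o Y i)) ->
  (forall i, Ex P (fun w => `|Y i w|) <= mu) -> (forall i, `|b i| <= D * rho ^+ i) ->
  measurable_fun setT e -> {ae P, forall w, \sum_(i < T) b i * Y i w @[T --> \oo] --> e w} ->
  (forall T T', (T <= T')%N -> Ex P (fun w => `|cos (f + u * \sum_(i < T') b i * Y i w) - cos (f + u * \sum_(i < T) b i * Y i w)|) <= `|u| * (D * mu / (1 - rho)) * rho ^+ T) /\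
  forall T, Ex P (fun w => `|cos (f + u * e w) - cos (f + u * \sum_(i < T) b i * Y i w)|) <= `|u| * (D * mu / (1 - rho)) * rho ^+ T.
Proof.
move=> r01 D0 mY iY hY hb me ee.
have mS T : measurable_fun setT (fun w => \sum_(i < T) b i * Y i w).
  by apply: measurable_sum => i; apply: measurable_funM.
have iS T : P.-integrable setT (EFin \o (fun w => \sum_(i < T) b i * Y i w)).
  apply: integrable_sum => i; have := integrableZl measurableT (b i) (iY i).
  exact: eq_integrable.
have bS T := bm_cosT u f (mS T); have be := bm_cosT u f me.
have H T T' : (T <= T')%N -> Ex P (fun w => `|cos (f + u * \sum_(i < T') b i * Y i w) - cos (f + u * \sum_(i < T) b i * Y i w)|) <= `|u| * (D * mu / (1 - rho)) * rho ^+ T.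
  move=> TT; rewrite -mulrA.
  apply: le_trans (ler_wpM2l (normr_ge0 u) (Ex_abs_sum_tail r01 D0 iY hY hb TT)).
  have iD : P.-integrable setT (EFin \o (fun w => `|\sum_(i < T') b i * Y i w - \sum_(i < T) b i * Y i w|)).
    have := integrable_abse (integrableB measurableT (iS T') (iS T)).
    exact: eq_integrable.
  rewrite -ExZ//; apply: Ex_le; first by bounded_measurable_tac.
    by have := integrableZl measurableT `|u| iD; apply: eq_integrable.
  move=> w; apply: (le_trans (cos_lipschitz _ _)).
  by rewrite -normrM le_eqVlt; apply/orP; left; apply/eqP; congr `|_|; ring.
split=> // T.
have cv : Ex P (fun w => `|cos (f + u * \sum_(i < T') b i * Y i w) - cos (f + u * \sum_(i < T) b i * Y i w)|) @[T' --> \oo] -->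
   Ex P (fun w => `|cos (f + u * e w) - cos (f + u * \sum_(i < T) b i * Y i w)|).
  apply: (@Ex_dct _ _ 2).
  - by move=> n; apply: (bm_norm (bmB (bS n) (bS T))).1.
  - exact: (bm_norm (bmB be (bS T))).1.
  - move=> n w; rewrite normr_id; apply: (le_trans (ler_normB _ _)).
    have c1 (z : R) : `|cos z| <= 1 by rewrite ler_norml cos_le1 cos_geN1.
    by have := c1 (f + u * \sum_(i < n) b i * Y i w); have := c1 (f + u * \sum_(i < T) b i * Y i w); lra.
  - apply: filterS ee => w h; apply: cvg_norm; apply: cvgB; last exact: cvg_cst.
    apply: (cvg_comp (fun T => f + u * \sum_(i < T) b i * Y i w) cos); last exact: (@continuous_cos R (f + u * e w)).
    by apply: cvgD; [exact: cvg_cst|apply: cvgMr].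
rewrite -(cvg_lim _ cv)//; apply: limr_le; first by apply: cvgP; exact: cv.
by near=> T'; apply: H; near: T'; exact: nbhs_infty_ge.
Unshelve. all: by end_near. Qed.
End Tail.

(** * Moments of the averaged scores *)

Section Process.
Context {R : realType} {d : measure_display} {Omega : measurableType d}.
Variable P : probability Omega R.
Variable X : int -> Omega -> R.
Hypothesis mX : forall n, measurable_fun setT (X n).
Hypothesis iX : forall n, P.-integrable setT (EFin \o X n).
Hypothesis indX : forall (a : int) n, mutually_independent P (fun i : 'I_n => X (a + i%:Z)).
Hypothesis lawX : forall n m f, bounded_measurable f -> Ex P (fun w => f (X n w)) = Ex P (fun w => f (X m w)).
Variable mu : R.
Hypothesis muX : forall n, Ex P (fun w => `|X n w|) <= mu.
Variables (D rho : R) (c : nat -> nat -> R).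
Hypotheses (D0 : 0 <= D) (rho01 : 0 < rho < 1).
Hypothesis hc : forall n i, `|c n i| <= D * rho ^+ i.
Hypothesis cc : forall n i, (i <= n)%N -> c n i = c i i.
Variables (e : nat -> Omega -> R) (s : Omega -> R).
Hypotheses (me : forall n, measurable_fun setT (e n)) (ms : measurable_fun setT s).
Hypothesis ec : forall n, {ae P, forall w, \sum_(i < T) c n i * X (n%:Z - i%:Z) w @[T --> \oo] --> e n w}.
Hypothesis sc : {ae P, forall w, \sum_(i < T) c i i * X (0 - i%:Z) w @[T --> \oo] --> s w}.
Variables (u f : R).

Let cosT n T w := cos (f + u * \sum_(i < T) c n i * X (n%:Z - i%:Z) w).
Let E := `|u| * (D * mu / (1 - rho)).

Let r01 : 0 <= rho < 1.
Proof. by move: rho01 => /andP[/ltW -> ->]. Qed.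

Let mu0 : 0 <= mu.
Proof. by apply: le_trans (muX 0); apply: Ex_ge0. Qed.

Let E0 : 0 <= E.
Proof. by rewrite /E mulr_ge0// divr_ge0 ?mulr_ge0//; move: r01 => /andP[_ /ltW]; rewrite subr_ge0. Qed.

Let tail n := Ex_cos_tail u f r01 D0 (fun i => mX (n%:Z - i%:Z)) (fun i => iX (n%:Z - i%:Z)) (fun i => muX (n%:Z - i%:Z)) (hc n) (me n) (ec n).
Let hcs i : `|c i i| <= D * rho ^+ i.
Proof. exact: hc. Qed.
Let tails := Ex_cos_tail u f r01 D0 (fun i => mX (0 - i%:Z)) (fun i => iX (0 - i%:Z)) (fun i => muX (0 - i%:Z)) hcs ms sc.

Let bcosT n T : bounded_measurable (cosT n T).
Proof.
by apply: bm_cosT; apply: measurable_sum => i; apply: measurable_funM.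
Qed.

Let cos1 (z : R) : `|cos z| <= 1.
Proof. by rewrite ler_norml cos_le1 cos_geN1. Qed.

Let Ex1 n T : `|Ex P (cosT n T)| <= 1.
Proof.
apply: (le_trans (Ex_norm (bm_integrable P (bcosT n T)))).
rewrite -[leRHS](Ex_cst P); apply: Ex_le => //; last by move=> w; exact: cos1.
  by have := bcosT n T; bounded_measurable_tac.
by bounded_measurable_tac.
Qed.

(** The origin is moved to time [1 - T'], the earliest one reached by [T'.+1] lags from time 1, so
    that every noise variable in play gets a natural index. *)
Lemma cylinder_window T' n j : (j <= n + T'.+1)%N ->
  cylinder (fun i : nat => X (1 - T'%:Z + i%:Z)) (n + T'.+1 - j) (n + T'.+1) (cosT n.+1 j).
Proof.
move=> jn; pose Y (i : nat) := X (1 - T'%:Z + i%:Z).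
have [h _] := cyl_cos_sin Y (n + T'.+1 - j) j (fun l => u * c n.+1 (n + T' - l)) f.
move: h; rewrite subnK//; congr cylinder; apply/funext => w; rewrite /cosT; congr (cos (_ + _)).
rewrite mulr_sumr -(big_mkord xpredT (fun i => u * (c n.+1 i * X (n.+1%:Z - i%:Z) w))).
rewrite -{1}[(n + T'.+1 - j)%N]add0n big_addn subKn// big_nat_rev /= !big_nat.
apply: eq_bigr => i /andP[_ ij].
rewrite add0n mulrA; congr (_ * c _ _ * X _ w); lia.
Qed.

(** Supplies a rate of which several powers can be spent separately. *)
Lemma root_lt1 (k : nat) : exists2 r : R, 0 < r < 1 & r ^+ k.+1 = rho.
Proof.
have /andP[r0 r1] := rho01.
have kk : 0 < k.+1%:R^-1 :> R by rewrite invr_gt0.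
exists (rho `^ (k.+1%:R^-1)).
  rewrite powR_gt0//=; have := @gt0_ltr_powR R _ kk rho 1.
  by rewrite powR1; apply; rewrite ?nnegrE// ltW.
by rewrite -powR_mulrn ?powR_ge0// -powRrM mulVf ?powRr1 ?ltW// pnatr_eq0.
Qed.

(** Truncation to [T] lags turns the scores into cylinder functions. It matters that [B] does not
    depend on [T], since [T] will be chosen in terms of [N]. *)
Lemma truncated_moment (k : nat) : exists2 B : R, 0 <= B & forall N T, (0 < N)%N -> (N <= T)%N ->
  Ex P (fun w => (\sum_(i < N) (cosT i.+1 T w - Ex P (cosT i.+1 T))) ^+ k.*2.+2) <= B * N%:R ^+ k.+1.
Proof.
have [r r0 rk] := root_lt1 k.
have [A1 A10 hA1] := @pow_shift_bound R k.*2.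
have [A2 A20 hA2] := @pow_shift_bound2 R k.*2.
(* Centering doubles the truncation error [E]. *)
pose C := 2 * E.
have C0 : 0 <= C by rewrite mulr_ge0.
pose B := k.*2.+2%:R * (A1 * ((1 - r)^-1 * (1 + (4 ^+ k + 1) * C))) + 2 * A2.
exists (B * expR B).
  have /andP[_ r1] := r0.
  rewrite mulr_ge0 ?expR_ge0// addr_ge0 ?mulr_ge0//; first by rewrite invr_ge0; lra.
  by rewrite addr_ge0// mulr_ge0// addr_ge0// exprn_ge0.
move=> N [|T'] N0 NT; first by move: NT; rewrite leqn0; case: N N0.
pose x n w := cosT n.+1 T'.+1 w - Ex P (cosT n.+1 T'.+1).
pose xk n j w := cosT n.+1 j w - Ex P (cosT n.+1 j).
have b1 n j w : `|xk n j w| <= 2.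
  by apply: (le_trans (ler_normB _ _)); have := cos1 (f + u * \sum_(i < j) c n.+1 i * X (n.+1%:Z - i%:Z) w); have := Ex1 n.+1 j; rewrite /cosT; lra.
have bxk n j : bounded_measurable (xk n j) by have := bcosT n.+1 j; rewrite /xk; bounded_measurable_tac.
pose Y (i : nat) := X (1 - T'%:Z + i%:Z).
have mY i : measurable_fun setT (Y i) by rewrite /Y.
have iY n : mutually_independent P (fun i : 'I_n => Y i) by exact: indX.
have cx n j : (j <= n + T'.+1)%N -> cylinder Y (n + T'.+1 - j) (n + T'.+1) (xk n j).
  by move=> jn; apply: cylD; [exact: cylinder_window|apply: cylN; exact: cyl_cst].
apply: (@weak_dependence_moment _ _ _ P k N C r A1 A2 x xk C0 r0 N0 A10 A20 hA1 hA2) => //.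
- by move=> n; exact: bxk.
- by move=> n; exact: b1.
- move=> n j /andP[jn nN]; rewrite exprM rk.
  have bn := bcosT n.+1 T'.+1; have bj := bcosT n.+1 j.
  have jT : (j <= T'.+1)%N by rewrite (leq_trans jn)// (leq_trans (ltnW nN)).
  have t := (tail n.+1).1 j T'.+1 jT; rewrite -/E in t.
  apply: (@le_trans _ _ (Ex P (fun w => `|cosT n.+1 T'.+1 w - cosT n.+1 j w| + E * rho ^+ j))).
    apply: Ex_le; [by rewrite /x /xk; bounded_measurable_tac..|] => w.
    have -> : x n w - xk n j w = (cosT n.+1 T'.+1 w - cosT n.+1 j w) - (Ex P (cosT n.+1 T'.+1) - Ex P (cosT n.+1 j)) by rewrite /x /xk; ring.
    apply: (le_trans (ler_normB _ _)); rewrite lerD2l -ExB; [|by bounded_measurable_tac..].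
    by apply: le_trans t; apply: Ex_norm; bounded_measurable_tac.
  rewrite ExD; [|by bounded_measurable_tac..]; have -> : C * rho ^+ j = E * rho ^+ j + E * rho ^+ j by rewrite /C; ring.
  rewrite Ex_cst lerD2r.
  exact: t.
- move=> m n j j0 mj nN.
  have jn : (j <= n + T'.+1)%N by rewrite addnS -addSn (leq_trans _ (leq_addr _ _))// (leq_trans _ mj)// leq_addl.
  (* The sum reaches noise up to time [m] only, while [xk n j] begins at time [n + 2 - j], which
     exceeds [m]: the windows are disjoint. *)
  have cS : cylinder Y 0 (n + T'.+1 - j) (fun w => \sum_(i < m) x i w).
    rewrite (_ : (fun w => _) = (fun w => \sum_(i < m) (if (i < m)%N then x i w else 0))); last first.
      by apply/funext => w; apply: eq_bigr => i _; rewrite ltn_ord.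
    apply: cyl_sum => i; rewrite (_ : (fun w => _) = (if (i < m)%N then x i else fun=> 0)); last first.
      by apply/funext => w; case: ifP.
    case: ifP => im; last exact: cyl_cst.
    apply: cyl_widen (cx i T'.+1 _) => //; last by rewrite leq_addl.
    by clear -im mj; lia.
  rewrite (Ex_cylM mY iY (leq0n _) (leq_subr _ _) (cylX k.*2.+1 cS) (cx n j jn)).
  have bj := bcosT n.+1 j.
  by rewrite /xk ExB ?Ex_cst ?subrr ?mulr0//; bounded_measurable_tac.
Qed.

Lemma independent_backward (n : int) m : mutually_independent P (fun i : 'I_m => X (n - i%:Z)).
Proof.
case: m => [|m] B mB.
  have := @indX 0 0%N B mB; rewrite !big_ord0 => <-; congr (P _).
  by apply/seteqP; split => w /= _ [].
have := @indX (n - m%:Z) m.+1 (fun i => B (rev_ord i)) (fun i => mB (rev_ord i)).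
have E3 (i : 'I_m.+1) : n - m%:Z + (rev_ord i)%:Z = n - i%:Z.
  by have := ltn_ord i; rewrite /=; lia.
have E4 (i : 'I_m.+1) : n - m%:Z + i%:Z = n - (rev_ord i)%:Z.
  by rewrite -E3 rev_ordK.
rewrite [in RHS](reindex_inj rev_ord_inj) /= => h.
transitivity (P [set w | forall i : 'I_m.+1, B (rev_ord i) (X (n - m%:Z + i%:Z) w)]).
  congr (P _); apply/seteqP; split => w hw i.
    by have := hw (rev_ord i); rewrite -E4.
  by have := hw (rev_ord i); rewrite rev_ordK E3.
rewrite h; congr (_%:E); apply: eq_bigr => i _; congr (fine (P _)).
have E5 : n - m%:Z + (m.+1 - i.+1)%N%:Z = n - i%:Z := E3 i.
by apply/seteqP; split => w; rewrite /mkset rev_ordK E5.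
Qed.

Let z := Ex P (fun w => cos (f + u * s w)).

(** The filter started at 0 shares its first [n] coefficients with the stationary one, so the two
    truncations to [n] lags have the same expected cosine. The bias is thus geometric in [n], and
    its sum over time stays bounded. *)
Lemma truncated_mean_le n T : (n <= T)%N -> `|Ex P (cosT n T) - z| <= 2 * E * rho ^+ n.
Proof.
move=> nT; have bn := bcosT n n; have bT := bcosT n T.
have bs := bm_cosT u f ms.
pose csT w := cos (f + u * \sum_(i < n) c i i * X (0 - i%:Z) w).
have bsT : bounded_measurable csT by apply: bm_cosT; apply: measurable_sum => i; apply: measurable_funM.
have law : Ex P (cosT n n) = Ex P csT.
  have := (@Ex_cos_sin_law _ _ _ P (fun i => X (n%:Z - i%:Z)) (fun i => X (0 - i%:Z)) n (fun i => u * c i i) f).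
  move=> /(_ (fun=> mX _) (fun=> mX _) (independent_backward _) (independent_backward _)).
  move=> /(_ (fun i g bg => lawX _ _ bg))[+ _]; congr (_ = _); congr Ex; apply/funext => w.
    rewrite /cosT big_mkord mulr_sumr; congr (cos (_ + _)).
    by apply: eq_bigr => i _; rewrite (cc (ltnW (ltn_ord i))) mulrA.
  rewrite /csT big_mkord mulr_sumr; congr (cos (_ + _)).
  by apply: eq_bigr => i _; rewrite mulrA.
have -> : Ex P (cosT n T) - z = (Ex P (cosT n T) - Ex P (cosT n n)) - (z - Ex P csT) by rewrite law; ring.
apply: (le_trans (ler_normB _ _)).
have -> : 2 * E * rho ^+ n = E * rho ^+ n + E * rho ^+ n by ring.
apply: lerD.
  rewrite -ExB; [|by bounded_measurable_tac..]; apply: le_trans ((tail n).1 n T nT).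
  by apply: Ex_norm; bounded_measurable_tac.
rewrite -ExB; [|by bounded_measurable_tac..]; apply: le_trans (tails.2 n).
by apply: Ex_norm; bounded_measurable_tac.
Qed.

Lemma pow_sum3 p (x y t : R) : (x + y + t) ^+ p.*2 <= 3 ^+ p.*2 * (x ^+ p.*2 + y ^+ p.*2 + t ^+ p.*2).
Proof.
have ev (v : R) : v ^+ p.*2 = `|v| ^+ p.*2 by rewrite -mul2n !exprM real_normK// num_real.
rewrite (ev (x + y + t)) (ev x) (ev y) (ev t); set m := Num.max `|x| (Num.max `|y| `|t|).
have m0 : 0 <= m by rewrite le_max normr_ge0.
apply: (@le_trans _ _ ((3 * m) ^+ p.*2)).
  rewrite lerXn2r ?nnegrE// ?mulr_ge0//.
  apply: (le_trans (ler_normD _ _)); apply: (le_trans (lerD (ler_normD _ _) (lexx _))).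
  have hx : `|x| <= m by rewrite le_max lexx.
  have hy : `|y| <= m by rewrite !le_max lexx orbT.
  have ht : `|t| <= m by rewrite !le_max lexx !orbT.
  by lra.
rewrite exprMn ler_wpM2l ?exprn_ge0//.
have p0 (v : R) : 0 <= `|v| ^+ p.*2 by rewrite exprn_ge0.
have := (p0 x, p0 y, p0 t) => -[[px py] pt].
have [->|[->|->]] : m = `|x| \/ m = `|y| \/ m = `|t|; [|rewrite -addrA lerDl addr_ge0|rewrite -addrA addrCA lerDl addr_ge0|rewrite lerDr addr_ge0]; rewrite ?exprn_ge0//.
by rewrite /m maxEle; case: ifP => _; [right; rewrite maxEle; case: ifP; [right|left]|left].
Qed.

(** The sum splits into a centered truncated part [a], a truncation error [b] and an accumulated
    bias [t]. Only the bound for [a] grows with N: [b] is made small through the choice of [T], and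
    [t] is bounded by a geometric sum. *)
Theorem process_moment (k : nat) : exists2 B : R, 0 <= B & forall N, (0 < N)%N ->
  Ex P (fun w => (\sum_(i < N) (cos (f + u * e i.+1 w) - z)) ^+ k.*2.+2) <= B * N%:R ^+ k.+1.
Proof.
have [B B0 hB] := truncated_moment k.
have /andP[rho0 rho1] := rho01.
pose c3 := 2 * E / (1 - rho).
have EE : 0 <= 2 * E by apply: mulr_ge0 => //; exact: E0.
have c30 : 0 <= c3.
  apply: divr_ge0; last by rewrite subr_ge0 ltW.
  exact: EE.
exists (3 ^+ k.*2.+2 * (B + 1 + c3 ^+ k.*2.+2)).
  by rewrite mulr_ge0 ?exprn_ge0// !addr_ge0// exprn_ge0.
move=> N N0.
have N1 : 1 <= N%:R :> R by rewrite ler1n.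
(* All but one of the factors of [b^(2k+2)] are bounded crudely by 2N. The mean of the last is at
   most [N * E * rho^T], so a large [T] brings the product below 1. *)
have [T NT hT] : exists2 T, (N <= T)%N & (2 * N%:R) ^+ k.*2.+1 * (N%:R * E) * rho ^+ T <= 1.
  have : geometric ((2 * N%:R) ^+ k.*2.+1 * (N%:R * E)) rho T @[T --> \oo] --> 0.
    by apply: cvg_geometric; rewrite gtr0_norm.
  move=> /cvgrPdist_le/(_ 1 ltr01)[M _ hM]; exists (maxn M N); first exact: leq_maxr.
  have := hM (maxn M N) (leq_maxl _ _); rewrite /= sub0r normrN.
  by apply: le_trans; exact: ler_norm.
have be n := bm_cosT u f (me n).
have bT n := bcosT n T.
pose a w := \sum_(i < N) (cosT i.+1 T w - Ex P (cosT i.+1 T)).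
pose b w := \sum_(i < N) (cos (f + u * e i.+1 w) - cosT i.+1 T w).
pose t := \sum_(i < N) (Ex P (cosT i.+1 T) - z).
have ba : bounded_measurable a by rewrite /a; bounded_measurable_tac.
have bb : bounded_measurable b by rewrite /b; bounded_measurable_tac.
have absum w : \sum_(i < N) (cos (f + u * e i.+1 w) - z) = a w + b w + t.
  by rewrite /a /b /t -!big_split /=; apply: eq_bigr => i _; ring.
have ht : t ^+ k.*2.+2 <= c3 ^+ k.*2.+2.
  have ht : `|t| <= c3.
    apply: (le_trans (ler_norm_sum _ _ _)).
    apply: (@le_trans _ _ (\sum_(i < N) 2 * E * rho ^+ i)).
      apply: ler_sum => i _; apply: (le_trans (truncated_mean_le (leq_trans (ltn_ord i) NT))).
      apply: ler_wpM2l => //; rewrite exprS; apply: ler_piMl; [rewrite exprn_ge0|]; rewrite ?ltW//.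
    rewrite -mulr_sumr; apply: ler_wpM2l => //.
    exact: geometric_sum_le.
  have -> : t ^+ k.*2.+2 = `|t| ^+ k.*2.+2 by rewrite -doubleS -mul2n !exprM real_normK// num_real.
  by rewrite lerXn2r.
have hb : Ex P (fun w => b w ^+ k.*2.+2) <= 1.
  apply: le_trans hT.
  pose b' w := \sum_(i < N) `|cos (f + u * e i.+1 w) - cosT i.+1 T w|.
  have bb' : bounded_measurable b' by rewrite /b'; bounded_measurable_tac.
  apply: (@le_trans _ _ (Ex P (fun w => (2 * N%:R) ^+ k.*2.+1 * b' w))).
    apply: Ex_le; [by bounded_measurable_tac..|] => w.
    have -> : b w ^+ k.*2.+2 = `|b w| ^+ k.*2.+2 by rewrite -doubleS -mul2n !exprM real_normK// num_real.
    have h1 : `|b w| <= b' w by exact: ler_norm_sum.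
    have h2 : `|b w| <= 2 * N%:R.
      apply: (le_trans h1); rewrite mulrC mulr_natl -[N in leRHS]card_ord -sumr_const.
      apply: ler_sum => i _; apply: (le_trans (ler_normB _ _)).
      by have := cos1 (f + u * e i.+1 w); have := cos1 (f + u * \sum_(j < T) c i.+1 j * X (i.+1%:Z - j%:Z) w); rewrite /cosT; lra.
    rewrite exprSr; apply: ler_pM => //.
    by rewrite lerXn2r// nnegrE mulr_ge0.
  rewrite ExZ; last by bounded_measurable_tac.
  rewrite -mulrA ler_wpM2l ?exprn_ge0 ?mulr_ge0//.
  rewrite Ex_sum; last by move=> i; have := be i.+1; have := bT i.+1; bounded_measurable_tac.
  rewrite -mulrA mulr_natl -[N in leRHS]card_ord -sumr_const.
  by apply: ler_sum => i _; exact: (tail i.+1).2.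
apply: (@le_trans _ _ (Ex P (fun w => 3 ^+ k.*2.+2 * (a w ^+ k.*2.+2 + b w ^+ k.*2.+2 + c3 ^+ k.*2.+2)))).
  apply: Ex_le.
  - by have be1 i := be i; bounded_measurable_tac.
  - by bounded_measurable_tac.
  - move=> w; rewrite absum -doubleS; apply: (le_trans (pow_sum3 _ _ _ _)).
    by rewrite ler_wpM2l ?exprn_ge0// lerD2l.
rewrite ExZ; last by bounded_measurable_tac.
rewrite -mulrA ler_wpM2l ?exprn_ge0//.
rewrite ExD; [|by bounded_measurable_tac..]; rewrite ExD; [|by bounded_measurable_tac..]; rewrite Ex_cst.
have ha := hB N T N0 NT; rewrite -/(a) in ha.
have Nk : 1 <= N%:R ^+ k.+1 :> R by rewrite exprn_ege1.
rewrite !mulrDl mul1r; apply: lerD; first apply: lerD => //.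
  exact: le_trans hb Nk.
by rewrite ler_peMr// exprn_ge0.
Qed.

End Process.

(** * The increments of the Lévy process *)

Section Levy.
Context {R : realType} {d : measure_display} {Omega : measurableType d}.
Variable P : probability Omega R.

(** The expectation is the difference of the integrals of positive and negative part, which is a
    finite number only if both are. In this way the zero mean of the increments yields their
    integrability. *)
Lemma expectation_fin_integrable (X : Omega -> R) : measurable_fun setT X ->
  ('E_P[X])%E \is a fin_num -> P.-integrable setT (EFin \o X).
Proof.
move=> mX; rewrite unlock integralE => h.
have mEX : measurable_fun setT (EFin \o X) by exact/measurable_EFinP.
set f := fun w => (X w)%:E in h.
have p0 : (0 <= \int[P]_x (f ^\+)%E x)%E by apply: integral_ge0.
have n0 : (0 <= \int[P]_x (f ^\-)%E x)%E by apply: integral_ge0.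
apply/integrableP; split=> //.
have -> : (\int[P]_x `|(EFin \o X) x| = \int[P]_x ((f ^\+)%E x + (f ^\-)%E x))%E.
  by apply: eq_integral => w _; rewrite -[RHS]/((f ^\+ \+ f ^\-)%E w) -fune_abse.
rewrite ge0_integralD//; last 2 first.
- exact: measurable_funepos.
- exact: measurable_funeneg.
move: h p0 n0; case: (\int[P]_x (f ^\+)%E x)%E => [p| |] //; case: (\int[P]_x (f ^\-)%E x)%E => [q| |] //.
by move=> _ _ _; rewrite -EFinD ltry.
Qed.

(** The absolute value is unbounded, so instead of approximating it both integrals are carried to
    the line, where the image measures agree. *)
Lemma Ex_abs_eq_law (Y Y' : Omega -> R) : measurable_fun setT Y -> measurable_fun setT Y' ->
  (forall B : set R, measurable B -> P [set w | B (Y w)] = P [set w | B (Y' w)]) ->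
  Ex P (fun w => `|Y w|) = Ex P (fun w => `|Y' w|).
Proof.
move=> mY mY' h; rewrite /Ex /Rintegral; congr fine.
have E (y : Omega -> R) : measurable_fun setT y ->
   (\int[P]_x (`|y x|)%:E = \int[pushforward P y]_z (`|z : R|)%:E)%E.
  move=> my; rewrite ge0_integral_pushforward//; exact/measurable_EFinP.
rewrite !E//; apply: eq_measure_integral => A mA _.
exact: h.
Qed.

(** The series of [|X j| r^j] has finite expectation, hence is almost surely finite, and its sum
    bounds each term. This is the growth condition on the past under which the filters converge. *)
Lemma geometric_weight_bounded (X : nat -> Omega -> R) (mu r : R) : 0 < r < 1 ->
  (forall i, P.-integrable setT (EFin \o X i)) ->
  (forall i, Ex P (fun w => `|X i w|) <= mu) ->
  {ae P, forall w, exists B : R, forall j, `|X j w| * r ^+ j <= B}.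
Proof.
move=> /andP[r0 r1] iX muX.
pose g j w : \bar R := (`|X j w| * r ^+ j)%:E.
have mX i : measurable_fun setT (X i) by have /integrableP[/measurable_EFinP] := iX i.
have mg j : measurable_fun setT (g j).
  by apply/measurable_EFinP; apply: measurable_funM => //; exact: measurableT_comp.
have g0 j w : (0 <= g j w)%E by rewrite lee_fin mulr_ge0// exprn_ge0// ltW.
have iG : P.-integrable setT (fun w => \sum_(j <oo) g j w)%E.
  apply/integrableP; split.
    by apply: (@ge0_emeasurable_sum _ _ _ _ g xpredT) => // k; exact: mg.
  under eq_integral do rewrite gee0_abs ?nneseries_ge0//.
  rewrite integral_nneseries//.
  apply: (@le_lt_trans _ _ (\sum_(j <oo) (mu * r ^+ j)%:E)%E).
    apply: lee_nneseries => [j _ _|j _]; first exact: integral_ge0.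
    have E : (\int[P]_x g j x = (Ex P (fun w => `|X j w| * r ^+ j))%:E)%E.
      rewrite /Ex /Rintegral fineK// integrable_fin_num//.
      have := integrableZr measurableT (r ^+ j) (integrable_abse (iX j)).
      exact: eq_integrable.
    rewrite E lee_fin /Ex RintegralZr//; last first.
      by have := integrable_abse (iX j); apply: eq_integrable.
    by apply: ler_wpM2r; [rewrite exprn_ge0// ltW|exact: muX].
  have : series (geometric mu r) n @[n --> \oo] --> mu / (1 - r).
    by apply: cvg_geometric_series; rewrite gtr0_norm.
  move=> cg; rewrite (_ : (\sum_(j <oo) _)%E = (mu / (1 - r))%:E) ?ltry//.
  apply/cvg_lim => //.
  rewrite (_ : (fun n => _) = EFin \o series (geometric mu r)).
    by apply: cvg_EFin => //; exact: nearW.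
  by apply/funext => n; rewrite /series /= sumEFin.
have := integrable_ae measurableT iG; apply: filterS => w /(_ I) fw.
exists (fine (\sum_(j <oo) g j w)%E) => j.
rewrite -lee_fin fineK//.
rewrite -[X in (X <= _)%E]/(g j w) (@nneseriesD1 _ (fun j => g j w) j xpredT)//.
by rewrite leeDl// nneseries_ge0.
Qed.

Variables (b : R) (nu : {measure set R -> \bar R}) (Z : R -> {RV P >-> R}) (h : R).
Hypotheses (hZ : levy_process b nu Z) (h0 : 0 < h).

Lemma measurable_increment n : measurable_fun setT (increment Z h n).
Proof. by apply: measurable_funB. Qed.

Lemma increment_independent (a : int) n :
  mutually_independent P (fun i : 'I_n => increment Z h (a + i%:Z)).
Proof.
have [_ _ + _ _] := hZ.
move=> /(_ n (fun j => (a - 1 + j%:Z)%:~R * h)) H.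
have {}H : mutually_independent P (fun (i : 'I_n) w => Z ((a - 1 + i.+1%:Z)%:~R * h) w - Z ((a - 1 + i%:Z)%:~R * h) w).
  apply: H => i j ij; rewrite ler_pM2r// ler_int lerD2l; exact: ij.
move: H; congr (mutually_independent _ _); apply/funext => i; apply/funext => w.
rewrite /increment; congr (Z (_ * h) w - Z (_ * h) w); congr (_%:~R); lia.
Qed.

Lemma increment_law (n m : int) (B : set R) : measurable B ->
  P [set w | B (increment Z h n w)] = P [set w | B (increment Z h m w)].
Proof.
move=> mB; have [_ _ _ H _] := hZ.
have E k : P [set w | B (increment Z h k w)] = P [set w | B (Z h w)].
  rewrite -(H h ((k - 1)%:~R * h) B (ltW h0) mB); congr (P _); apply/seteqP.
  have -> : (k - 1)%:~R * h + h = k%:~R * h by rewrite intrB; ring.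
  by split.
by rewrite !E.
Qed.

End Levy.

(** * Innovations as series in the noise increments *)

Section FilterProcess.
Context {R : realType}.

Lemma stable_impulse_geometric {m} (F : 'M[R]_m) (G : 'cV[R]_m) (C : 'rV[R]_m) :
  stable_mx F -> exists A s : R, [/\ 0 <= A, 0 < s < 1 & forall i, `|impulse F G C i| <= A * s ^+ i].
Proof.
move=> /(@stable_impulse_decay _ _ F G C)[D [s0 [D0 /andP[s00 s01] h]]].
(* The rate is raised to a positive one, since powers of it will be divided by. *)
pose s := (s0 + 1) / 2.
have s_0 : 0 < s by rewrite /s; lra.
have s_1 : s < 1 by rewrite /s; lra.
have s0s : s0 <= s by rewrite /s; lra.
exists (1 + D / s), s; split; rewrite ?s_0//; first by rewrite addr_ge0// divr_ge0// ltW.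
case=> [|i] /=.
  by rewrite normr1 expr0 mulr1 lerDl divr_ge0// ltW.
apply: (le_trans (h i)).
apply: (@le_trans _ _ (D * s ^+ i)).
  by rewrite ler_wpM2l// lerXn2r// nnegrE// ltW.
have -> : (1 + D / s) * s ^+ i.+1 = s ^+ i.+1 + D * s ^+ i by rewrite exprS; field; rewrite gt_eqF.
by rewrite lerDr exprn_ge0// ltW.
Qed.

Lemma common_impulse_rate {m1 m2} (F1 : 'M[R]_m1) (G1 : 'cV[R]_m1) (C1 : 'rV[R]_m1)
    (F2 : 'M[R]_m2) (G2 : 'cV[R]_m2) (C2 : 'rV[R]_m2) : stable_mx F1 -> stable_mx F2 ->
  exists A r : R, [/\ 0 <= A, 0 < r < 1, forall i, `|impulse F1 G1 C1 i| <= A * r ^+ (3 * i) &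
    forall i, `|impulse F2 G2 C2 i| <= A * r ^+ (3 * i)].
Proof.
move=> /(@stable_impulse_geometric _ F1 G1 C1)[A1 [s1 [A10 /andP[s10 s11] h1]]].
move=> /(@stable_impulse_geometric _ F2 G2 C2)[A2 [s2 [A20 /andP[s20 s21] h2]]].
pose s := Num.max s1 s2.
have s01 : 0 < s < 1 by rewrite lt_max s10 gt_max s11.
(* The cube root provides the three powers of [r] spent in the cascade estimates. *)
have [r r01 rs] := root_lt1 s01 2.
exists (A1 + A2), r; split=> // [|i|i]; first by rewrite addr_ge0.
  apply: (le_trans (h1 i)); rewrite exprM rs; apply: ler_pM; rewrite ?exprn_ge0 ?lerDl//; first exact: ltW.
  by rewrite lerXn2r ?nnegrE ?le_max ?lexx// ltW.
apply: (le_trans (h2 i)); rewrite exprM rs; apply: ler_pM; rewrite ?exprn_ge0 ?lerDr//; first exact: ltW.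
by rewrite lerXn2r ?nnegrE ?le_max ?lexx ?orbT// ltW.
Qed.

Lemma filter_stationaryE {m} (F : 'M[R]_m) (G : 'cV[R]_m) (C : 'rV[R]_m) (x : int -> R) n l :
  (\sum_(i < T) impulse F G C i * x (n - i%:Z) @[T --> \oo] --> l) ->
  Defs.filter_stationary F G C x n = l.
Proof.
move=> h; apply: cvg_lim => //.
rewrite (_ : (fun k : nat => _) = (fun k : nat => \sum_(i < k.+1) impulse F G C i * x (n - i%:Z))).
  by rewrite (@cvg_shiftS _ (fun T => \sum_(i < T) impulse F G C i * x (n - i%:Z))).
apply/funext => k; rewrite filter_fromE; apply: eq_bigr => i _; congr (_ * x _).
by have := ltn_ord i; lia.
Qed.

Context {d : measure_display} {Omega : measurableType d}.
Variable P : probability Omega R.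
Variable X : int -> Omega -> R.
Hypothesis mX : forall n, measurable_fun setT (X n).
Hypothesis iX : forall n, P.-integrable setT (EFin \o X n).
Variable mu : R.
Hypothesis muX : forall n, Ex P (fun w => `|X n w|) <= mu.
Variables (m1 m2 : nat) (F1 : 'M[R]_m1) (G1 : 'cV[R]_m1) (C1 : 'rV[R]_m1)
  (F2 : 'M[R]_m2) (G2 : 'cV[R]_m2) (C2 : 'rV[R]_m2).
Hypotheses (sF1 : stable_mx F1) (sF2 : stable_mx F2).

Let y w : int -> R := Defs.filter_stationary F1 G1 C1 (X^~ w).

(** The series converge on the full-measure set [O] of paths with moderate past. Multiplying by its
    indicator gives versions [e] and [s] that are measurable as pointwise limits and agree almost
    surely with the filters. *)
Lemma filter_process : exists (D rho : R) (c : nat -> nat -> R) (e : nat -> Omega -> R) (s : Omega -> R),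
  [/\ 0 <= D, 0 < rho < 1, forall n i, `|c n i| <= D * rho ^+ i & forall n i, (i <= n)%N -> c n i = c i i] /\
  [/\ forall n, measurable_fun setT (e n), measurable_fun setT s,
     forall n, {ae P, forall w, \sum_(i < T) c n i * X (n%:Z - i%:Z) w @[T --> \oo] --> e n w},
     {ae P, forall w, \sum_(i < T) c i i * X (0 - i%:Z) w @[T --> \oo] --> s w} &
     {ae P, forall w, (forall n, e n w = Defs.filter_from F2 G2 C2 (y w) 0 n) /\
        s w = Defs.filter_stationary F2 G2 C2 (y w) 0}].
Proof.
have [A [r [A0 r01 h1 h2]]] := common_impulse_rate G1 C1 G2 C2 sF1 sF2.
have /andP[r0 r1] := r01.
pose a := impulse F1 G1 C1; pose g := impulse F2 G2 C2; pose c := cascade a g.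
have [N [mN PN hN]] := geometric_weight_bounded (X := fun j : nat => X (- j%:Z)) r01 (fun i => iX _) (fun i => muX _).
pose O := ~` N; have mO : measurable O by exact: measurableC.
have good w : O w -> exists B : R, forall j : nat, `|X (- j%:Z) w| * r ^+ j <= B.
  by move=> Ow; apply: contrapT => h; apply: Ow; exact: hN.
pose Y w (n : int) : R := limn (fun T => \sum_(i < T) a i * X (n - i%:Z) w).
have yY w : O w -> y w = Y w.
  move=> /good gw; apply/funext => n; apply: filter_stationaryE.
  have [B B0 hB] := @past_growth R r A r01 A0 (X^~ w) gw n.
  by have [] := @output_tail R r A a r01 h1 (X^~ w) n B B0 hB.
have cvE n w : O w -> \sum_(i < T) c n i * X (n%:Z - i%:Z) w @[T --> \oo] --> Defs.filter_from F2 G2 C2 (y w) 0 n.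
  move=> Ow; rewrite (yY w Ow) filter_fromE.
  have h := @transient_cascade R r A a g r01 A0 h1 (X^~ w) (good w Ow) n.
  rewrite (eq_bigr (fun j : 'I_n.+1 => g j * Y w (n%:Z - j%:Z))); first exact: h.
  by move=> j _; congr (_ * Y w _); have := ltn_ord j; lia.
have cvS w : O w -> \sum_(i < T) c i i * X (0 - i%:Z) w @[T --> \oo] --> Defs.filter_stationary F2 G2 C2 (y w) 0.
  move=> Ow; rewrite (yY w Ow).
  have [l h1' h2'] := @stationary_cascade R r A a g r01 A0 h1 h2 (X^~ w) (good w Ow).
  by rewrite (filter_stationaryE h2').
have mind : measurable_fun setT (\1_O : Omega -> R) by exact: measurable_indic.
have mlim (b : nat -> R) (i0 : nat -> int) (f : Omega -> R) :
    (forall w, O w -> \sum_(i < T) b i * X (i0 i) w @[T --> \oo] --> f w) ->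
    measurable_fun setT (fun w => \1_O w * f w).
  move=> h; apply: (@measurable_fun_cvg _ _ _ setT (fun T w => \1_O w * \sum_(i < T) b i * X (i0 i) w)).
    move=> T; apply: measurable_funM => //; apply: measurable_sum => i; exact: measurable_funM.
  move=> w _; have [Ow|Ow] := pselect (O w).
    by rewrite indicE mem_set//= mul1r; under eq_fun do rewrite mul1r; exact: h.
  by rewrite indicE memNset//= mul0r; under eq_fun do rewrite mul0r; exact: cvg_cst.
have aeO (Q : Omega -> Prop) : (forall w, O w -> Q w) -> {ae P, forall w, Q w}.
  move=> h; exists N; split=> // w; apply: contra_notP => Nw; exact: h.
have indE (v : R) w : O w -> \1_O w * v = v by move=> Ow; rewrite indicE mem_set//= mul1r.
exists (A ^+ 2 / (1 - r)), (r ^+ 2), c, (fun n w => \1_O w * Defs.filter_from F2 G2 C2 (y w) 0 n),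
  (fun w => \1_O w * Defs.filter_stationary F2 G2 C2 (y w) 0).
split; split.
- by rewrite divr_ge0 ?exprn_ge0//; lra.
- by rewrite exprn_gt0//= expr_lt1// ltW.
- by move=> n i; exact: cascade_le.
- by move=> n i ni; exact: cascade_stable.
- move=> n; apply: (mlim (c n) (fun i => n%:Z - i%:Z)); exact: cvE.
- apply: (mlim (fun i => c i i) (fun i => 0 - i%:Z)); exact: cvS.
- by move=> n; apply: aeO => w Ow; rewrite indE//; exact: cvE.
- by apply: aeO => w Ow; rewrite indE//; exact: cvS.
- by apply: aeO => w Ow; split=> [n|]; rewrite indE.
Qed.

End FilterProcess.

(** * Perturbed critical points *)

Section Ck.
Context {R : realType} {n : nat}.
Implicit Types (U : set 'cV[R]_n) (f g : 'cV[R]_n -> R).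

Lemma ck_continuous k U f : ck k U f -> forall x, U x -> {for x, continuous f}.
Proof. by case: k => [|k] []. Qed.

Lemma ck_derivable k U f i x : ck k.+1 U f -> U x -> derivable f x (delta_mx i 0).
Proof. by move=> [_ /(_ i)[h _]]; exact: h. Qed.

Lemma ck_partial k U f i : ck k.+1 U f -> ck k U (partial f i).
Proof. by move=> [_ /(_ i)[]]. Qed.

Lemma ck_weaken k U f : ck k.+1 U f -> ck k U f.
Proof.
elim: k f => [|k IH] f [cf df]; first by split.
by split=> // i; have [d1 d2] := df i; split=> //; exact: IH.
Qed.

Lemma ck_subset k U V f : V `<=` U -> ck k U f -> ck k V f.
Proof.
move=> VU; elim: k f => [|k IH] f [cf df].
  by split=> // x /VU; exact: cf.
split=> [x /VU|i]; first exact: cf.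
by have [d1 d2] := df i; split=> [x /VU|]; [exact: d1|exact: IH].
Qed.

Lemma near_open U f g x : open U -> (forall y, U y -> f y = g y) -> U x ->
  \forall y \near x, f y = g y.
Proof.
move=> oU fg Ux; have nU : nbhs x U by exact: open_nbhs_nbhs.
exact: filterS nU.
Qed.

Lemma eq_partial U f g i x : open U -> (forall y, U y -> f y = g y) -> U x ->
  partial f i x = partial g i x.
Proof. by move=> oU fg Ux; apply: near_eq_derive; exact: near_open oU fg Ux. Qed.

(** The rules of differentiation hold on [U] only, so the closure properties of [ck] need invariance
    under equality on [U]. *)
Lemma ck_ext k U f g : open U -> (forall x, U x -> f x = g x) -> ck k U f -> ck k U g.
Proof.
move=> oU; have cont f' g' : (forall x, U x -> f' x = g' x) ->
    (forall x, U x -> {for x, continuous f'}) -> forall x, U x -> {for x, continuous g'}.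
  move=> fg cf x Ux.
  have h : f' y @[y --> x] --> g' x by rewrite -(fg x Ux); exact: cf.
  have nU : nbhs x U by exact: open_nbhs_nbhs.
  have e : \near x, f' x = g' x by apply: filterS nU => y Uy; rewrite fg.
  exact: cvg_trans (near_eq_cvg e) h.
elim: k f g => [|k IH] f g fg [cf df].
  by split=> //; exact: cont cf.
split; first exact: cont cf.
move=> i; have [d1 d2] := df i; split.
  by move=> x Ux; apply: near_eq_derivable (d1 x Ux); exact: near_open oU fg Ux.
by apply: (IH _ _ _ d2) => x Ux; exact: (eq_partial i oU fg Ux).
Qed.

Lemma ck_cst k U (c : R) : ck k U (fun=> c).
Proof.
elim: k c => [|k IH] c; first by split=> // x _; exact: cst_continuous.
split=> [x _|i]; first exact: cst_continuous.
split=> [x _|]; first exact: derivable_cst.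
rewrite (_ : partial _ i = fun=> 0); first exact: IH.
by apply/funext => x; rewrite /partial derive_cst.
Qed.

Lemma ckD k U f g : open U -> ck k U f -> ck k U g -> ck k U (fun x => f x + g x).
Proof.
move=> oU; elim: k f g => [|k IH] f g [cf df] [cg dg].
  by split=> // x Ux; exact: (continuousD (cf x Ux) (cg x Ux)).
split=> [x Ux|i]; first by exact: (continuousD (cf x Ux) (cg x Ux)).
have [d1 d2] := df i; have [e1 e2] := dg i; split.
  by move=> x Ux; apply: derivableD; [exact: d1|exact: e1].
apply: ck_ext (IH _ _ d2 e2) => // x Ux.
by rewrite /partial -deriveD//; [exact: d1|exact: e1].
Qed.

Lemma ckM k U f g : open U -> ck k U f -> ck k U g -> ck k U (fun x => f x * g x).
Proof.
move=> oU; elim: k f g => [|k IH] f g hf hg.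
  by have [cf _] := hf; have [cg _] := hg; split=> // x Ux; exact: (continuousM (cf x Ux) (cg x Ux)).
have [cf df] := hf; have [cg dg] := hg.
split=> [x Ux|i]; first by exact: (continuousM (cf x Ux) (cg x Ux)).
have [d1 d2] := df i; have [e1 e2] := dg i; split.
  by move=> x Ux; apply: derivableM; [exact: d1|exact: e1].
apply: ck_ext (ckD oU (IH _ _ (ck_weaken hf) e2) (IH _ _ (ck_weaken hg) d2)) => // x Ux.
by rewrite /partial deriveM//; [exact: d1|exact: e1].
Qed.

Lemma ck_sum k U I (s : seq I) (F : I -> 'cV[R]_n -> R) : open U ->
  (forall i, ck k U (F i)) -> ck k U (fun x => \sum_(i <- s) F i x).
Proof.
move=> oU hF; elim: s => [|i s IH].
  by under eq_fun do rewrite big_nil; exact: ck_cst.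
by under eq_fun do rewrite big_cons; exact: ckD.
Qed.

Lemma partialD U f g i x : ck 1 U f -> ck 1 U g -> U x ->
  partial (fun y => f y + g y) i x = partial f i x + partial g i x.
Proof.
move=> hf hg Ux; have df := ck_derivable (i := i) hf Ux; have dg := ck_derivable (i := i) hg Ux.
by rewrite /partial -deriveD.
Qed.

Lemma partialZ U (c : R) f i x : ck 1 U f -> U x ->
  partial (fun y => c * f y) i x = c * partial f i x.
Proof.
move=> hf Ux; have df := ck_derivable (i := i) hf Ux.
by rewrite /partial -[RHS](deriveZ c df).
Qed.

Lemma partial_cst (c : R) i (x : 'cV[R]_n) : partial (fun=> c) i x = 0 :> R.
Proof. by rewrite /partial derive_cst. Qed.

Lemma partial_sum U I (s : seq I) (F : I -> 'cV[R]_n -> R) i x : open U ->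
  (forall i, ck 1 U (F i)) -> U x ->
  partial (fun y => \sum_(j <- s) F j y) i x = \sum_(j <- s) partial (F j) i x.
Proof.
move=> oU hF Ux; elim: s => [|j s IH].
  by under [X in partial X]eq_fun do rewrite big_nil; rewrite big_nil partial_cst.
under [X in partial X]eq_fun do rewrite big_cons.
by rewrite big_cons (partialD _ (hF j) (ck_sum s oU hF))// IH.
Qed.

Lemma norm_leP (x : 'cV[R]_n) (e : R) : 0 <= e ->
  (`|x| <= e) <-> (forall i, `|x i 0| <= e).
Proof.
move=> e0; rewrite /Num.Def.normr /= mx_normrE; split.
  move=> h i; apply: le_trans h.
  by apply: (le_bigmax _ (fun ij : 'I_n * 'I_1 => `|x ij.1 ij.2|) (i, 0)).
move=> h; apply/bigmax_leP; split=> // -[i j] _ /=.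
by rewrite ord1; exact: h.
Qed.

Lemma norm_coord (x : 'cV[R]_n) i : `|x i 0| <= `|x|.
Proof. by have /norm_leP := lexx `|x|; apply. Qed.

Lemma derive_line f (x : 'cV[R]_n) i (t : R) : derivable f (x + t *: delta_mx i 0) (delta_mx i 0) ->
  is_derive t 1 (fun s : R => f (x + s *: delta_mx i 0)) (partial f i (x + t *: delta_mx i 0)).
Proof.
set v := delta_mx i 0 => df.
have E : (fun h : R => h^-1 *: ((f \o shift (x + t *: v)) (h *: v) - f (x + t *: v))) =
   (fun h : R => h^-1 *: (((fun s : R => f (x + s *: v)) \o shift t) (h *: (1 : R)) - f (x + t *: v))).
  apply/funext => h; congr (_ *: (f _ - _)) => /=.
  by rewrite [h%:A]mulr1 scalerDl addrCA.
apply: DeriveDef; first by rewrite /derivable -E.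
by rewrite /partial /derive -E.
Qed.

Lemma coord_mvt f (x : 'cV[R]_n) i (t K : R) :
  let btw s := (0 <= s <= t) || (t <= s <= 0) in
  (forall s, btw s -> derivable f (x + s *: delta_mx i 0) (delta_mx i 0)) ->
  (forall s, btw s -> {for x + s *: delta_mx i 0, continuous f}) ->
  (forall s, btw s -> `|partial f i (x + s *: delta_mx i 0)| <= K) ->
  `|f (x + t *: delta_mx i 0) - f x| <= K * `|t|.
Proof.
set v := delta_mx i 0 => btw df cf bf.
pose g (s : R) := f (x + s *: v).
have cg s : btw s -> {for s, continuous g}.
  move=> hs; apply: (cvg_comp (fun s : R => x + s *: v) f); last exact: (cf s hs).
  by apply: cvgD; [exact: cvg_cst|apply: cvgZr_tmp; exact: cvg_id].
have main a b : a <= b -> (forall s, s \in `[a, b]%R -> btw s) -> `|g b - g a| <= K * `|b - a|.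
  move=> ab hs; have [||c cab ->] := @MVT_segment R g (fun s => partial f i (x + s *: v)) a b ab.
  - move=> s /subset_itv_oo_cc /hs st; apply: derive_line; exact: df.
  - apply: continuous_in_subspaceT => s; rewrite inE /= => /hs; exact: cg.
  - by rewrite normrM ler_wpM2r// bf// hs.
have -> : f x = g 0 by rewrite /g scale0r addr0.
have [t0|t0] := leP 0 t.
  rewrite -[X in _ * `|X|]subr0; apply: main => // s; rewrite in_itv /= => st.
  by rewrite /btw st.
rewrite distrC -[X in _ * X]normrN -[- t]add0r; apply: main; first exact: ltW.
by move=> s; rewrite in_itv /= => st; rewrite /btw st orbT.
Qed.

(** Only partial derivatives are controlled, so [y] is carried to [x] by changing one coordinate at
    a time. The ball of the max norm is a box and contains this whole path; each of the [n] moves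
    contributes [K * |x - y|]. *)
Lemma box_mvt f (a : 'cV[R]_n) (rho K : R) :
  (forall z i, `|z - a| <= rho -> derivable f z (delta_mx i 0)) ->
  (forall z, `|z - a| <= rho -> {for z, continuous f}) ->
  (forall z i, `|z - a| <= rho -> `|partial f i z| <= K) -> 0 <= K ->
  forall x y, `|x - a| <= rho -> `|y - a| <= rho -> `|f x - f y| <= n%:R * K * `|x - y|.
Proof.
move=> df cf bf K0 x y hx hy.
have rho0 : 0 <= rho by exact: le_trans hx.
pose p (k : nat) : 'cV[R]_n := \col_i (if (i < k)%N then x i 0 else y i 0).
have pn : p n = x by apply/colP => i; rewrite mxE ltn_ord.
have p0 : p 0%N = y by apply/colP => i; rewrite mxE.
have step (k : 'I_n) : `|f (p k.+1) - f (p k)| <= K * `|x - y|.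
  have E : p k.+1 = p k + (x k 0 - y k 0) *: delta_mx k 0.
    apply/colP => i; rewrite !mxE ltnS eqxx andbT.
    have [->|ik] := eqVneq i k; first by rewrite leqnn ltnn mulr1 addrC subrK.
    by rewrite mulr0 addr0 leq_eqVlt (negPf (ik : val i != val k)).
  have inb s : (0 <= s <= x k 0 - y k 0) || (x k 0 - y k 0 <= s <= 0) -> `|p k + s *: delta_mx k 0 - a| <= rho.
    move=> hs; apply/norm_leP => // i; rewrite !mxE eqxx andbT.
    have := le_trans (norm_coord (x - a) i) hx; have := le_trans (norm_coord (y - a) i) hy.
    rewrite !mxE; have [->|ik] := eqVneq i k.
      by rewrite ltnn mulr1 !ler_norml; move: hs => /orP[]/andP[s1 s2] /andP[h1 h2] /andP[h3 h4]; apply/andP; split; lra.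
    by rewrite mulr0 addr0; case: ifP.
  rewrite E; apply: (@le_trans _ _ (K * `|x k 0 - y k 0|)).
    by apply: coord_mvt => s /inb h; [exact: df|exact: cf|exact: bf].
  by rewrite ler_wpM2l//; have := norm_coord (x - y) k; rewrite !mxE.
rewrite -{1}pn -{1}p0 -(telescope_sumr (fun k => f (p k)) (leq0n n)) big_mkord.
apply: (le_trans (ler_norm_sum _ _ _)).
apply: (@le_trans _ _ (\sum_(k < n) K * `|x - y|)); first by apply: ler_sum => k _; exact: step.
by rewrite sumr_const card_ord -mulrA mulr_natl.
Qed.

End Ck.

Section Local.
Context {R : realType} {n : nat}.
Implicit Types (U : set 'cV[R]_n) (f g : 'cV[R]_n -> R) (a : 'cV[R]_n).

(** Local statements are put in the form of holding for all small radii, so that finitely many of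
    them share one radius. *)
Lemma nbhs_small_ball a (Q : 'cV[R]_n -> Prop) : nbhs a Q ->
  \forall rho \near 0^'+, forall z, `|z - a| <= rho -> Q z.
Proof.
move=> /nbhs_ballP[e /= e0 h]; near=> rho => z hz; apply: h.
rewrite -ball_normE /= distrC; apply: le_lt_trans hz _.
by near: rho; exact: nbhs_right_lt.
Unshelve. all: by end_near. Qed.

Lemma is_derive_coord j (x v : 'cV[R]_n) : is_derive x v (fun y : 'cV[R]_n => y j 0 : R) (v j 0).
Proof.
have cv : (fun h : R => h^-1 *: (((fun y : 'cV[R]_n => y j 0) \o shift x) (h *: v) - x j 0)) @ 0^' --> v j 0.
  apply: (@cvg_trans _ (cst (v j 0) @ 0^')); last exact: cvg_cst.
  apply: near_eq_cvg; near=> h; rewrite /= !mxE addrK /cst scalerA mulVf ?scale1r//.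
  by near: h; exact: nbhs_dnbhs_neq.
apply: DeriveDef; first by apply: cvgP; exact: cv.
exact: cvg_lim cv.
Unshelve. all: by end_near. Qed.

Lemma ck_coord k U j : ck k U (fun x : 'cV[R]_n => x j 0).
Proof.
case: k => [|k]; first by split=> // x _; exact: coord_continuous.
split=> [x _|i]; first exact: coord_continuous.
split=> [x _|]; first by have := is_derive_coord j x (delta_mx i 0) => -[].
rewrite (_ : partial _ i = fun=> (delta_mx i 0 : 'cV[R]_n) j 0); first exact: ck_cst.
by apply/funext => x; rewrite /partial; have := is_derive_coord j x (delta_mx i 0) => -[].
Qed.

Lemma near_ck1_lipschitz U f a : open U -> U a -> ck 1 U f ->
  exists2 L : R, 0 <= L & \forall rho \near 0^'+, forall x y, `|x - a| <= rho -> `|y - a| <= rho ->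
    `|f x - f y| <= L * `|x - y|.
Proof.
move=> oU Ua hf.
pose K := \sum_i `|partial f i a| + 1.
have K0 : 0 <= K by rewrite addr_ge0// sumr_ge0.
exists (n%:R * K); first by rewrite mulr_ge0.
have nU : nbhs a U by exact: open_nbhs_nbhs.
have nK : \forall z \near a, forall i, `|partial f i z| <= K.
  apply: (@filter_forall _ _ (fun i z => `|partial f i z| <= K) (nbhs a) _) => i.
  have cp := ck_continuous (ck_partial i hf) Ua.
  have cl : nbhs a (fun z => `| `|partial f i a| - `|partial f i z| | < 1).
    exact: (@cvgr_dist_lt _ _ _ _ _ _ _ (cvg_norm cp) 1 ltr01).
  apply: (@filterS _ (nbhs a) _ _ _ _ cl) => z hz.
  have h1 : `|partial f i a| <= \sum_i `|partial f i a| by rewrite (bigD1 i)//= lerDl sumr_ge0.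
  by move: hz; rewrite distrC ltr_norml => /andP[_ h2]; rewrite /K; lra.
near=> rho => x y hx hy.
apply: (@box_mvt _ _ f a rho) => //.
- move=> z i hz; apply: (ck_derivable hf); move: z hz; near: rho; exact: nbhs_small_ball.
- move=> z hz; apply: (ck_continuous hf); move: z hz; near: rho; exact: nbhs_small_ball.
- move=> z i hz; move: i; move: z hz; near: rho; exact: nbhs_small_ball.
Unshelve. all: by end_near. Qed.

(** [f] with its linear part at [a] removed. Its partial derivatives vanish at [a], which turns mean
    value bounds into expansions. *)
Let lin f a (x : 'cV[R]_n) := f x + \sum_(j < n) - partial f j a * x j 0.

Lemma ck_sub_linear k U f a : open U -> ck k U f -> ck k U (lin f a).
Proof.
move=> oU hf; apply: ckD => //; apply: ck_sum => // j; apply: ckM => //; [exact: ck_cst|exact: ck_coord].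
Qed.

Lemma partial_sub_linear U f a i x : open U -> ck 1 U f -> U x ->
  partial (lin f a) i x = partial f i x - partial f i a.
Proof.
move=> oU hf Ux; rewrite /lin.
have hc j : ck 1 U (fun x => - partial f j a * x j 0).
  by apply: ckM => //; [exact: ck_cst|exact: ck_coord].
rewrite (partialD _ hf (ck_sum _ oU hc))// (partial_sum _ _ oU hc)//; congr (_ + _).
rewrite (bigD1 i)//= big1 => [|j ji].
  rewrite (partialZ _ _ (ck_coord 1 U i))// addr0 /partial.
  by have [_ ->] := is_derive_coord i x (delta_mx i 0); rewrite mxE !eqxx mulr1.
rewrite (partialZ _ _ (ck_coord 1 U j))// /partial.
by have [_ ->] := is_derive_coord j x (delta_mx i 0); rewrite mxE (negPf ji) mulr0.
Qed.

Lemma sub_linearB f a x y :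
  lin f a x - lin f a y = f x - f y - \sum_(j < n) partial f j a * (x - y) j 0.
Proof.
rewrite /lin opprD addrACA -sumrB -sumrN; congr (_ + _).
by apply: eq_bigr => j _; rewrite !mxE; ring.
Qed.

Lemma near_ck1_linear U f a (e : R) : open U -> U a -> ck 1 U f -> 0 < e ->
  \forall rho \near 0^'+, forall x y, `|x - a| <= rho -> `|y - a| <= rho ->
    `|f x - f y - \sum_(j < n) partial f j a * (x - y) j 0| <= e * `|x - y|.
Proof.
move=> oU Ua hf e0.
have nU : nbhs a U by exact: open_nbhs_nbhs.
pose e' := e / n.+1%:R.
have e'0 : 0 < e' by rewrite divr_gt0.
have nK : \forall z \near a, forall i, `|partial f i z - partial f i a| <= e'.
  apply: (@filter_forall _ _ (fun i z => `|partial f i z - partial f i a| <= e') (nbhs a) _) => i.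
  have cp := ck_continuous (ck_partial i hf) Ua.
  have cl : nbhs a (fun z => `|partial f i a - partial f i z| <= e').
    exact: (@cvgr_dist_le _ _ _ _ _ _ _ cp e' e'0).
  apply: (@filterS _ (nbhs a) _ _ _ _ cl) => z hz.
  by rewrite distrC.
near=> rho => x y hx hy; rewrite -sub_linearB.
have hg := ck_sub_linear a oU hf.
have rU z : `|z - a| <= rho -> U z by move: z; near: rho; exact: nbhs_small_ball.
apply: (@le_trans _ _ (n%:R * e' * `|x - y|)).
  apply: (@box_mvt _ _ (lin f a) a rho) => //.
  - by move=> z i /rU; exact: (ck_derivable hg).
  - by move=> z /rU; exact: (ck_continuous hg).
  - move=> z i hz; rewrite (partial_sub_linear _ _ oU hf (rU _ hz)).
    by move: i; move: z hz; near: rho; exact: nbhs_small_ball.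
  - exact: ltW.
rewrite ler_wpM2r// /e' mulrCA ler_piMr ?(ltW e0)//.
by rewrite ler_pdivrMr// mul1r ler_nat.
Unshelve. all: by end_near. Qed.

Lemma near_ck2_taylor U f a : open U -> U a -> ck 2 U f ->
  exists2 C : R, 0 <= C & \forall rho \near 0^'+, forall x, `|x - a| <= rho ->
    `|f x - f a - \sum_(j < n) partial f j a * (x - a) j 0| <= C * `|x - a| ^+ 2.
Proof.
move=> oU Ua hf2; have hf := ck_weaken hf2.
have nU : nbhs a U by exact: open_nbhs_nbhs.
have /choice[L hL] : forall i, exists L : R, 0 <= L /\ \forall rho \near 0^'+, forall x y,
    `|x - a| <= rho -> `|y - a| <= rho -> `|partial f i x - partial f i y| <= L * `|x - y|.
  by move=> i; have [L L0 h] := near_ck1_lipschitz oU Ua (ck_partial i hf2); exists L.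
pose K := \sum_i L i.
have LK i : L i <= K by rewrite /K (bigD1 i)//= lerDl sumr_ge0// => j _; have [] := hL j.
have K0 : 0 <= K by apply: sumr_ge0 => i _; have [] := hL i.
exists (n%:R * K); first by rewrite mulr_ge0.
have nL : \forall rho \near 0^'+, forall i x y,
    `|x - a| <= rho -> `|y - a| <= rho -> `|partial f i x - partial f i y| <= L i * `|x - y|.
  by apply: filter_forall => i; have [] := hL i.
near=> rho => x hx; rewrite -sub_linearB.
have hg := ck_sub_linear a oU hf.
have rU z : `|z - a| <= rho -> U z by move: z; near: rho; exact: nbhs_small_ball.
have rL i z : `|z - a| <= rho -> `|partial f i z - partial f i a| <= K * `|z - a|.
  move=> hz; apply: (@le_trans _ _ (L i * `|z - a|)); last by rewrite ler_wpM2r.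
  have h : forall i x y, `|x - a| <= rho -> `|y - a| <= rho -> `|partial f i x - partial f i y| <= L i * `|x - y|.
    by near: rho.
  by apply: h => //; rewrite subrr normr0 (le_trans _ hz).
apply: (@le_trans _ _ (n%:R * (K * `|x - a|) * `|x - a|)); last by rewrite expr2 !mulrA.
(* The box is taken with radius [|x - a|] itself: there the partial derivatives are at most
   [K * |x - a|], which yields the square. *)
apply: (@box_mvt _ _ (lin f a) a `|x - a|) => //.
- by move=> z i hz; apply: (ck_derivable hg); apply: rU; exact: le_trans hx.
- by move=> z hz; apply: (ck_continuous hg); apply: rU; exact: le_trans hx.
- move=> z i hz; have hzr := le_trans hz hx.
  rewrite (partial_sub_linear _ _ oU hf (rU _ hzr)).
  by apply: (le_trans (rL i z hzr)); rewrite ler_wpM2l.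
- by rewrite mulr_ge0.
- by rewrite subrr normr0.
Unshelve. all: by end_near. Qed.

End Local.

(** Registers the completeness that the Banach fixed point theorem requires. *)
HB.instance Definition _ (T : realType) (m k : nat) := Complete.on 'M[T]_(m, k).

(** * Euclidean norm against max norm, and the distance to a set *)

Section EnormDist.
Context {R : realType} {n : nat}.
Implicit Types x y z : 'cV[R]_n.

Lemma enorm_ge0 x : 0 <= enorm x. Proof. exact: sqrtr_ge0. Qed.

Lemma enorm_sqr x : enorm x ^+ 2 = \sum_i x i 0 ^+ 2.
Proof. by rewrite sqr_sqrtr// sumr_ge0// => i _; exact: sqr_ge0. Qed.

Lemma norm_le_enorm x : `|x| <= enorm x.
Proof.
apply/norm_leP => [|i]; first exact: enorm_ge0.
rewrite -[leLHS](@ger0_norm _ `|x i 0|)// -ler_sqr ?nnegrE ?enorm_ge0// normr_id enorm_sqr.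
rewrite real_normK ?num_real// (bigD1 i)//= lerDl sumr_ge0// => j _; exact: sqr_ge0.
Qed.

Lemma enorm_le_norm x : enorm x <= n%:R * `|x|.
Proof.
rewrite -ler_sqr ?nnegrE ?enorm_ge0 ?mulr_ge0// enorm_sqr.
apply: (@le_trans _ _ (\sum_(i < n) `|x| ^+ 2)).
  apply: ler_sum => i _; rewrite -[leLHS]real_normK ?num_real//.
  by rewrite ler_sqr ?nnegrE// norm_coord.
have -> : \sum_(i < n) `|x| ^+ 2 = n%:R * `|x| ^+ 2 by rewrite sumr_const card_ord mulr_natl.
rewrite exprMn ler_wpM2r ?exprn_ge0//.
rewrite -natrX ler_nat; case: n x => // k _.
by rewrite expnS leq_pmulr// expn_gt0.
Qed.

Lemma enorm0 : enorm (0 : 'cV[R]_n) = 0.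
Proof. by rewrite /enorm big1 ?sqrtr0// => i _; rewrite mxE expr0n. Qed.

Lemma enormN x : enorm (- x) = enorm x.
Proof. by congr Num.sqrt; apply: eq_bigr => i _; rewrite mxE sqrrN. Qed.

Lemma enorm_eq0 x : enorm x = 0 -> x = 0.
Proof.
move=> h; apply/eqP; rewrite -normr_le0 -h; exact: norm_le_enorm.
Qed.

(** Cauchy-Schwarz, by summing 2ab <= a^2 + b^2 over the coordinates of the normalised vectors. *)
Lemma enorm_dot x y : \sum_i x i 0 * y i 0 <= enorm x * enorm y.
Proof.
have [x0|x0] := eqVneq (enorm x) 0.
  by rewrite (enorm_eq0 x0) enorm0 mul0r big1// => i _; rewrite mxE mul0r.
have [y0|y0] := eqVneq (enorm y) 0.
  by rewrite (enorm_eq0 y0) enorm0 mulr0 big1// => i _; rewrite mxE mulr0.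
have xp : 0 < enorm x by rewrite lt_def x0 enorm_ge0.
have yp : 0 < enorm y by rewrite lt_def y0 enorm_ge0.
have h i : x i 0 * y i 0 <= enorm x * enorm y / 2 * (x i 0 ^+ 2 / enorm x ^+ 2 + y i 0 ^+ 2 / enorm y ^+ 2).
  have := sqr_ge0 (x i 0 / enorm x - y i 0 / enorm y).
  have -> : (x i 0 / enorm x - y i 0 / enorm y) ^+ 2 = (x i 0 ^+ 2 / enorm x ^+ 2 + y i 0 ^+ 2 / enorm y ^+ 2) - 2 * (x i 0 * y i 0) / (enorm x * enorm y).
    by field; rewrite x0 y0.
  rewrite subr_ge0 ler_pdivrMr ?mulr_gt0// => h; lra.
apply: (le_trans (ler_sum _ (fun i _ => h i))).
rewrite -mulr_sumr big_split /= -!mulr_suml -!enorm_sqr !mulfV ?expf_neq0//.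
by lra.
Qed.

Lemma enormD x y : enorm (x + y) <= enorm x + enorm y.
Proof.
rewrite -ler_sqr ?nnegrE ?addr_ge0 ?enorm_ge0// enorm_sqr sqrrD !enorm_sqr.
have -> : \sum_i (x + y) i 0 ^+ 2 = \sum_i x i 0 ^+ 2 + (\sum_i x i 0 * y i 0) *+ 2 + \sum_i y i 0 ^+ 2.
  rewrite -sumrMnl -!big_split /=; apply: eq_bigr => i _.
  by rewrite !mxE sqrrD.
by rewrite lerD2r lerD2l lerMn2r enorm_dot orbT.
Qed.

Variable A : set 'cV[R]_n.

Lemma dist_to_le x y : A y -> dist_to A x <= enorm (x - y).
Proof.
move=> Ay; apply: inf_lbound; last by exists y.
by exists 0 => _ [z _ <-]; exact: enorm_ge0.
Qed.

Lemma dist_to_ge0 x : 0 <= dist_to A x.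
Proof.
have [[y Ay]|A0] := pselect (A !=set0); last first.
  rewrite /dist_to (_ : [set _ | _ in _] = set0) ?inf0//.
  by apply/seteqP; split => // z [y Ay _]; apply: A0; exists y.
apply: lb_le_inf; first by exists (enorm (x - y)), y.
by move=> _ [z _ <-]; exact: enorm_ge0.
Qed.

Lemma dist_toD x y : A !=set0 -> dist_to A x <= dist_to A y + enorm (x - y).
Proof.
move=> [a Aa]; rewrite -lerBlDr; apply: lb_le_inf; first by exists (enorm (y - a)), a.
move=> _ [z Az <-]; rewrite lerBlDr; apply: (le_trans (dist_to_le x Az)).
have -> : x - z = (x - y) + (y - z) by rewrite addrA subrK.
by rewrite [leRHS]addrC enormD.
Qed.

Lemma dist_to_continuous : A !=set0 -> continuous (dist_to A).
Proof.
move=> A0 x; apply/(@cvgrPdist_le _ _ _ (nbhs x) (nbhs_filter x)) => e e0.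
have n0 : 0 < n%:R + 1 :> R by rewrite ltr_wpDl.
apply/nbhs_ballP; exists (e / (n%:R + 1)); first by rewrite /= divr_gt0.
move=> y; rewrite -ball_normE /= => hy.
have h : enorm (x - y) <= e.
  apply: (le_trans (enorm_le_norm _)); apply: (@le_trans _ _ ((n%:R + 1) * `|x - y|)).
    by rewrite ler_wpM2r// lerDl.
  by rewrite mulrC -ler_pdivlMr// ltW.
rewrite ler_norml; have := dist_toD x y A0; have := dist_toD y x A0.
rewrite -(opprB x y) enormN => h1 h2; apply/andP; split; lra.
Qed.

Lemma dist_to_eq0 x : A !=set0 -> closed A -> dist_to A x = 0 -> A x.
Proof.
move=> A0 cA d0; apply: cA => B /nbhs_ballP[e /= e0 hB].
have hi : has_inf [set enorm (x - y) | y in A].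
  split; first by have [a Aa] := A0; exists (enorm (x - a)), a.
  by exists 0 => _ [z _ <-]; exact: enorm_ge0.
have [_ [y Ay <-]] := inf_adherent e0 hi.
rewrite -/(dist_to A x) d0 add0r => hy; exists y; split=> //; apply: hB.
by rewrite -ball_normE /=; exact: le_lt_trans (norm_le_enorm _) hy.
Qed.

End EnormDist.

Section Grad.
Context {R : realType} {n : nat}.
Implicit Types (U : set 'cV[R]_n) (f : 'cV[R]_n -> R) (a : 'cV[R]_n).

(** A crude bound for the operator norm with respect to the max norm. *)
Definition mxsum {p q} (A : 'M[R]_(p, q)) : R := \sum_i \sum_j `|A i j|.

Lemma mxsum_ge0 {p q} (A : 'M[R]_(p, q)) : 0 <= mxsum A.
Proof. by apply: sumr_ge0 => i _; exact: sumr_ge0. Qed.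

Lemma norm_mulmx_le (A : 'M[R]_n) (v : 'cV[R]_n) : `|A *m v| <= mxsum A * `|v|.
Proof.
apply/norm_leP => [|i]; first by rewrite mulr_ge0 ?mxsum_ge0.
rewrite mxE; apply: (le_trans (ler_norm_sum _ _ _)).
apply: (@le_trans _ _ (\sum_j `|A i j| * `|v|)).
  by apply: ler_sum => j _; rewrite normrM ler_wpM2l// norm_coord.
rewrite -mulr_suml ler_wpM2r// /mxsum [leRHS](bigD1 i)//= lerDl.
by apply: sumr_ge0 => k _; exact: sumr_ge0.
Qed.

Lemma near_gradient_lipschitz U f a : open U -> U a -> ck 2 U f ->
  exists2 L : R, 0 <= L & \forall rho \near 0^'+, forall x y, `|x - a| <= rho -> `|y - a| <= rho ->
    `|gradient f x - gradient f y| <= L * `|x - y|.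
Proof.
move=> oU Ua hf.
have /choice[L hL] : forall i, exists L : R, 0 <= L /\ \forall rho \near 0^'+, forall x y,
    `|x - a| <= rho -> `|y - a| <= rho -> `|partial f i x - partial f i y| <= L * `|x - y|.
  by move=> i; have [L L0 h] := near_ck1_lipschitz oU Ua (ck_partial i hf); exists L.
pose K := \sum_i L i.
have LK i : L i <= K by rewrite /K (bigD1 i)//= lerDl sumr_ge0// => j _; have [] := hL j.
have K0 : 0 <= K by apply: sumr_ge0 => i _; have [] := hL i.
exists K => //; near=> rho => x y hx hy.
apply/norm_leP => [|i]; first by rewrite mulr_ge0.
rewrite !mxE; apply: (@le_trans _ _ (L i * `|x - y|)); last by rewrite ler_wpM2r.
move: i x y hx hy; near: rho; apply: filter_forall => i; have [_ h] := hL i.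
exact: h.
Unshelve. all: by end_near. Qed.

Lemma near_gradient_linear U f a (e : R) : open U -> U a -> ck 2 U f -> 0 < e ->
  \forall rho \near 0^'+, forall x y, `|x - a| <= rho -> `|y - a| <= rho ->
    `|gradient f x - gradient f y - hessian f a *m (x - y)| <= e * `|x - y|.
Proof.
move=> oU Ua hf e0; near=> rho => x y hx hy.
apply/norm_leP => [|i]; first by rewrite mulr_ge0// ltW.
rewrite !mxE; under eq_bigr do rewrite mxE.
move: i x y hx hy; near: rho; apply: filter_forall => i.
exact: near_ck1_linear oU Ua (ck_partial i hf) e0.
Unshelve. all: by end_near. Qed.

Lemma near_gradient_taylor U f a : open U -> U a -> ck 3 U f ->
  exists2 C : R, 0 <= C & \forall rho \near 0^'+, forall x, `|x - a| <= rho ->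
    `|gradient f x - gradient f a - hessian f a *m (x - a)| <= C * `|x - a| ^+ 2.
Proof.
move=> oU Ua hf.
have /choice[L hL] : forall i, exists L : R, 0 <= L /\ \forall rho \near 0^'+, forall x,
    `|x - a| <= rho -> `|partial f i x - partial f i a - \sum_(j < n) partial (partial f i) j a * (x - a) j 0| <= L * `|x - a| ^+ 2.
  by move=> i; have [L L0 h] := near_ck2_taylor oU Ua (ck_partial i hf); exists L.
pose K := \sum_i L i.
have LK i : L i <= K by rewrite /K (bigD1 i)//= lerDl sumr_ge0// => j _; have [] := hL j.
have K0 : 0 <= K by apply: sumr_ge0 => i _; have [] := hL i.
exists K => //; near=> rho => x hx.
apply/norm_leP => [|i]; first by rewrite mulr_ge0// exprn_ge0.
rewrite !mxE; under eq_bigr do rewrite mxE.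
apply: (@le_trans _ _ (L i * `|x - a| ^+ 2)); last by rewrite ler_wpM2r// exprn_ge0.
move: i x hx; near: rho; apply: filter_forall => i; have [_ h] := hL i.
exact: h.
Unshelve. all: by end_near. Qed.

Lemma compact_continuous_bounded (D : set 'cV[R]_n) f : compact D ->
  (forall x, D x -> {for x, continuous f}) -> exists2 B : R, 0 <= B & forall x, D x -> `|f x| <= B.
Proof.
move=> cD cf.
have : compact (f @` D).
  apply: continuous_compact cD; apply: continuous_in_subspaceT => x.
  by rewrite inE; exact: cf.
move=> /compact_bounded[B [_ hB]]; exists (`|B| + 1); first by rewrite addr_ge0.
move=> x Dx; apply: (hB (`|B| + 1)); last by exists x.
by rewrite (le_lt_trans (ler_norm _))// ltrDl.
Qed.

Lemma gradient_bounded U (D : set 'cV[R]_n) f : D `<=` U -> compact D -> ck 1 U f ->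
  exists2 B : R, 0 <= B & forall x, D x -> `|gradient f x| <= B.
Proof.
move=> DU cD hf.
have /choice[B hB] : forall i, exists B : R, 0 <= B /\ forall x, D x -> `|partial f i x| <= B.
  move=> i; have [|B B0 h] := compact_continuous_bounded (f := partial f i) cD; last by exists B.
  by move=> x /DU; exact: ck_continuous (ck_partial i hf) _.
exists (\sum_i B i); first by apply: sumr_ge0 => i _; have [] := hB i.
move=> x Dx; apply/norm_leP => [|i]; first by apply: sumr_ge0 => i _; have [] := hB i.
rewrite mxE; have [_ h] := hB i; apply: (le_trans (h x Dx)).
by rewrite (bigD1 i)//= lerDl sumr_ge0// => j _; have [] := hB j.
Qed.

(* The quantity [sum |partial f| + dist_to D'] vanishes on [D] only at [a]; this is what the selection rule of the
   estimator is matched to. *)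
Lemma near_zero_near_root U (D D' : set 'cV[R]_n) f a (rho : R) :
  open U -> D `<=` U -> compact D -> closed D' -> D' a -> ck 1 U f ->
  (forall x, D' x -> gradient f x = 0 -> x = a) -> 0 < rho ->
  exists2 e : R, 0 < e & forall x, D x -> `|gradient f x| <= e -> dist_to D' x <= e -> `|x - a| <= rho.
Proof.
move=> oU DU cD cD' D'a hf uniq rho0.
pose K := D `&` [set x | rho <= `|x - a|].
have cK : compact K.
  apply: compact_closedI => //.
  apply: (@closed_comp _ _ (fun x => `|x - a|) [set t : R | rho <= t]); last exact: closed_ge.
  move=> x _; apply: (@continuous_comp _ _ _ (fun y : 'cV[R]_n => y - a) (fun y : 'cV[R]_n => `|y|)).
    by apply: continuousB; [exact: cvg_id|exact: cst_continuous].
  exact: norm_continuous.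
pose g x := \sum_i `|partial f i x| + dist_to D' x.
have D'0 : D' !=set0 by exists a.
have g0 x : 0 <= g x by rewrite addr_ge0 ?dist_to_ge0// sumr_ge0.
have cg x : U x -> {for x, continuous g}.
  move=> Ux; apply: continuousD; last exact: dist_to_continuous.
  have cs (s : seq 'I_n) : {for x, continuous (fun x => \sum_(i <- s) `|partial f i x|)}.
    elim: s => [|i s IH].
      by under [X in {for _, continuous X}]eq_fun do rewrite big_nil; exact: cst_continuous.
    under [X in {for _, continuous X}]eq_fun do rewrite big_cons.
    apply: continuousD IH.
    exact: (cvg_norm (ck_continuous (ck_partial i hf) Ux)).
  exact: cs.
have cgK : closed (g @` K).
  apply: compact_closed; first exact: Rhausdorff.
  apply: continuous_compact cK; apply: continuous_in_subspaceT => x.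
  by rewrite inE => -[/DU + _]; exact: cg.
have gK0 : ~ (g @` K) 0.
  move=> [x [Dx xa] gx]; have := gx => /eqP; rewrite paddr_eq0 ?dist_to_ge0 ?sumr_ge0//.
  move=> /andP[/eqP s0 /eqP d0].
  have xe : x = a.
    apply: uniq; first exact: dist_to_eq0 d0.
    apply/colP => i; rewrite !mxE; apply/eqP; rewrite -normr_eq0.
    by move: s0 => /eqP; rewrite psumr_eq0// => /allP/(_ i); rewrite mem_index_enum => /(_ isT).
  by move: xa; rewrite xe /= subrr normr0 leNgt rho0.
have : nbhs (0 : R) (~` (g @` K)) by apply: open_nbhs_nbhs; split=> //; exact: closed_openC.
move=> /nbhs_ballP[e /= e0 he].
exists (e / (n%:R + 2)); first by rewrite divr_gt0// ltr_wpDl.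
move=> x Dx gx dx; rewrite leNgt; apply/negP => xa.
have : ball (0 : R) e (g x).
  rewrite -ball_normE /= sub0r normrN ger0_norm//.
  have n2 : 0 < n%:R + 2 :> R by rewrite ltr_wpDl.
  set e' := e / (n%:R + 2) in gx dx.
  have ee : e = e' * (n%:R + 2) by rewrite divfK ?gt_eqF.
  have e'0 : 0 < e' by rewrite divr_gt0.
  have h : \sum_i `|partial f i x| <= n%:R * e'.
    have -> : n%:R * e' = \sum_(i < n) e' by rewrite sumr_const card_ord mulr_natl.
    by apply: ler_sum => i _; apply: le_trans gx; have := norm_coord (gradient f x) i; rewrite mxE.
  rewrite ee /g; lra.
move=> /he; apply; exists x => //; split=> //=; exact: ltW.
Qed.

End Grad.

Lemma sqr_sum_le {R : realType} {I : finType} (x : I -> R) :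
  (\sum_i x i) ^+ 2 <= #|I|%:R * \sum_i x i ^+ 2.
Proof.
rewrite expr2 mulr_suml.
apply: (@le_trans _ _ (\sum_i \sum_j (x i ^+ 2 + x j ^+ 2) / 2)).
  apply: ler_sum => i _; rewrite mulr_sumr; apply: ler_sum => j _.
  by have := sqr_ge0 (x i - x j); rewrite sqrrB; lra.
set Q := \sum_i x i ^+ 2.
rewrite (eq_bigr (fun i => (#|I|%:R * x i ^+ 2 + Q) / 2)); last first.
  by move=> i _; rewrite -mulr_suml big_split /= sumr_const [#|I|%:R * _]mulr_natl.
rewrite -mulr_suml big_split /= -mulr_sumr sumr_const -[Q *+ _]mulr_natl.
by have -> : #|xpredT : pred I| = #|I| by []; rewrite -/Q; lra.
Qed.

(** * Solutions of the perturbed equation near the critical point *)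

Section Det.
Context {R : realType} {n : nat} {I : finType}.
Variables (U D D' : set 'cV[R]_n) (V0 : 'cV[R]_n -> R) (phi : I -> 'cV[R]_n -> R) (a : 'cV[R]_n).
Hypotheses (oU : open U) (DU : D `<=` U) (cD : compact D) (cD' : closed D') (D'D : D' `<=` D°).
Hypotheses (hV : ck 3 U V0) (hphi : forall l, ck 3 U (phi l)).
Hypotheses (D'a : D' a) (Va : gradient V0 a = 0) (uniq : forall x, D' x -> gradient V0 x = 0 -> x = a).
Hypothesis Hu : hessian V0 a \in unitmx.

(** [delta] will be the errors of the score averages, and [c] collects what the cost contains
    independently of [eta]. *)
Definition perturb (delta : I -> R) (c : R) : 'cV[R]_n -> R :=
  fun x => V0 x + c + \sum_l delta l * phi l x.

Let Delta (delta : I -> R) := \sum_l `|delta l|.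
Let H := hessian V0 a.
Let c0 := mxsum (invmx H).
Let gphi (delta : I -> R) x := \sum_l delta l *: gradient (phi l) x.

Let ck1 k U' (f : 'cV[R]_n -> R) : ck k.+2 U' f -> ck k.+1 U' f := @ck_weaken R n k.+1 U' f.

Lemma gradient_perturb delta c x : U x ->
  gradient (perturb delta c) x = gradient V0 x + gphi delta x.
Proof.
move=> Ux; have h1 := ck1 (ck1 hV); have h2 l := ck1 (ck1 (hphi l)).
have hc : ck 1 U (fun=> c) by exact: ck_cst.
have hz l : ck 1 U (fun x => delta l * phi l x).
  exact: (ckM oU (ck_cst _ _ _) (h2 l)).
apply/colP => i; rewrite !mxE summxE.
rewrite (partialD _ (ckD oU h1 hc) (ck_sum _ oU hz))// (partialD _ h1 hc)// partial_cst addr0.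
rewrite (partial_sum _ _ oU hz)//; congr (_ + _); apply: eq_bigr => l _.
by rewrite (partialZ _ _ (h2 l))// !mxE.
Qed.

Lemma gphi_norm delta x B : (forall l, `|gradient (phi l) x| <= B) -> `|gphi delta x| <= B * Delta delta.
Proof.
move=> h; apply: (le_trans (ler_norm_sum _ _ _)); rewrite /Delta mulr_sumr.
by apply: ler_sum => l _; rewrite normrZ mulrC ler_wpM2r.
Qed.

Lemma gphiB_norm delta x y L : (forall l, `|gradient (phi l) x - gradient (phi l) y| <= L) ->
  `|gphi delta x - gphi delta y| <= L * Delta delta.
Proof.
move=> h; rewrite /gphi -sumrB; apply: (le_trans (ler_norm_sum _ _ _)); rewrite /Delta mulr_sumr.
by apply: ler_sum => l _; rewrite -scalerBr normrZ mulrC ler_wpM2r.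
Qed.

Let Hinv_norm (v : 'cV[R]_n) : `|invmx H *m v| <= c0 * `|v|.
Proof. exact: norm_mulmx_le. Qed.

Let c00 : 0 <= c0. Proof. exact: mxsum_ge0. Qed.

Let DeltaG delta : 0 <= Delta delta. Proof. exact: sumr_ge0. Qed.

Let Da : D a. Proof. by apply: interior_subset; exact: D'D. Qed.
Let Ua : U a. Proof. exact: DU. Qed.

(* Newton's map for the perturbed gradient contracts a fixed ball around [a]. *)
Lemma perturbed_root (rho L B : R) delta c : 0 < rho ->
  (forall z, `|z - a| <= rho -> D z) ->
  (forall x y, `|x - a| <= rho -> `|y - a| <= rho ->
     `|gradient V0 x - gradient V0 y - H *m (x - y)| <= (4 * (c0 + 1))^-1 * `|x - y|) ->
  (forall l x y, `|x - a| <= rho -> `|y - a| <= rho ->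
     `|gradient (phi l) x - gradient (phi l) y| <= L * `|x - y|) ->
  (forall l, `|gradient (phi l) a| <= B) ->
  c0 * (L * Delta delta) <= 4^-1 -> c0 * (B * Delta delta) <= rho / 2 ->
  exists2 y, `|y - a| <= 2 * (c0 * (B * Delta delta)) & D y /\ gradient (perturb delta c) y = 0.
Proof.
move=> rho0 hD hlin hlip hB hL hrho.
pose V := perturb delta c.
pose S : set 'cV[R]_n := [set x | `|x - a| <= rho].
pose T (x : 'cV[R]_n) := x - invmx H *m gradient V x.
have SU x : S x -> U x by move=> /hD; exact: DU.
have aS : S a by rewrite /S /= subrr normr0 ltW.
have c1 : 0 < c0 + 1 by rewrite ltr_wpDl.
(* One quarter comes from the nonlinearity of [gradient V0], the other from the perturbation. *)
have TT x y : S x -> S y -> `|T x - T y| <= 2^-1 * `|x - y|.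
  move=> Sx Sy.
  have -> : T x - T y = - (invmx H *m (gradient V0 x - gradient V0 y - H *m (x - y))) -
      invmx H *m (gphi delta x - gphi delta y).
    rewrite /T /V !gradient_perturb; [|exact: SU..].
    rewrite !mulmxBr !mulmxDr !mulKmx//.
    move: (invmx H *m gradient V0 x) (invmx H *m gradient V0 y) (invmx H *m gphi delta x) (invmx H *m gphi delta y) => p q r s.
    by apply/colP => i; rewrite !mxE; ring.
  apply: (le_trans (ler_normB _ _)); rewrite normrN.
  have h1 := Hinv_norm (gradient V0 x - gradient V0 y - H *m (x - y)).
  have h2 := Hinv_norm (gphi delta x - gphi delta y).
  have h3 := ler_wpM2l c00 (hlin x y Sx Sy).
  have h4 : `|gphi delta x - gphi delta y| <= (L * `|x - y|) * Delta delta.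
    by apply: gphiB_norm => l; exact: hlip.
  have h5 := ler_wpM2l c00 h4.
  have h6 : c0 * ((4 * (c0 + 1))^-1 * `|x - y|) <= 4^-1 * `|x - y|.
    rewrite mulrA ler_wpM2r// invfM mulrCA ler_piMr//.
    by rewrite ler_pdivrMr// mul1r lerDl.
  have h7 : c0 * (L * `|x - y| * Delta delta) <= 4^-1 * `|x - y|.
    rewrite (_ : _ * _ = c0 * (L * Delta delta) * `|x - y|); last by ring.
    by rewrite ler_wpM2r.
  lra.
have Ta : `|T a - a| <= c0 * (B * Delta delta).
  rewrite /T addrAC subrr add0r normrN; apply: (le_trans (Hinv_norm _)).
  rewrite ler_wpM2l// gradient_perturb// Va add0r; exact: gphi_norm.
have TS x : S x -> S (T x).
  move=> Sx; rewrite /S /=.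
  have -> : T x - a = (T x - T a) + (T a - a) by rewrite addrA subrK.
  apply: (le_trans (ler_normD _ _)).
  have h1 := TT x a Sx aS; have h2 : `|x - a| <= rho := Sx.
  by move: (le_trans Ta hrho); lra.
have Tfun : {homo T : x / S x >-> S x} by [].
pose fT : {fun S >-> S} := mkfun Tfun.
have [| | |y Sy yE] := banach_fixed_point (f := fT).
- exists (2^-1)%:nng; split; first by rewrite /=; lra.
  by move=> -[x y] [/= Sx Sy]; exact: TT.
- apply: (@closed_comp _ _ (fun x => `|x - a|) [set t : R | t <= rho]); last exact: closed_le.
  move=> x _; apply: (@continuous_comp _ _ _ (fun y : 'cV[R]_n => y - a) (fun y : 'cV[R]_n => `|y|)).
    by apply: continuousB; [exact: cvg_id|exact: cst_continuous].
  exact: norm_continuous.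
- by exists a.
have yT : y = T y by exact: yE.
(* With contraction factor 1/2 the fixed point lies within twice the first Newton step from [a]. *)
exists y.
  have h1 := TT y a Sy aS; rewrite -yT in h1.
  have h2 : `|y - a| <= `|y - T a| + `|T a - a|.
    by have -> : y - a = (y - T a) + (T a - a) by [rewrite addrA subrK]; exact: ler_normD.
  by move: Ta; lra.
split; first exact: hD.
have : invmx H *m gradient V y = 0.
  by apply/eqP; rewrite -oppr_eq0; apply/eqP; apply: (addrI y); rewrite addr0; exact: (esym yT).
by move=> /(congr1 (mulmx H)); rewrite mulKVmx// mulmx0.
Qed.

Lemma perturbed_root_expansion : exists2 C : R, 0 <= C & forall delta c y, D y ->
  ((exists x, D x /\ gradient (perturb delta c) x = 0) ->
    (D y /\ gradient (perturb delta c) y = 0) /\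
    forall x, D x /\ gradient (perturb delta c) x = 0 -> dist_to D' y <= dist_to D' x) ->
  enorm ((y - a) - (- (invmx (hessian V0 a) *m gradient (perturb delta c) a))) <= C * \sum_l delta l ^+ 2.
Proof.
pose e := (4 * (c0 + 1))^-1.
have e0 : 0 < e by rewrite invr_gt0 mulr_gt0// ltr_wpDl.
have /choice[L hL] : forall l, exists L : R, 0 <= L /\ \forall rho \near 0^'+, forall x y, `|x - a| <= rho -> `|y - a| <= rho ->
    `|gradient (phi l) x - gradient (phi l) y| <= L * `|x - y|.
  by move=> l; have [L L0 h] := near_gradient_lipschitz oU Ua (ck1 (hphi l)); exists L.
pose LL := \sum_l L l.
have LLl l : L l <= LL by rewrite /LL (bigD1 l)//= lerDl sumr_ge0// => j _; have [] := hL j.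
have LL0 : 0 <= LL by apply: sumr_ge0 => i _; have [] := hL i.
have nL : \forall rho \near 0^'+, forall l x y, `|x - a| <= rho -> `|y - a| <= rho ->
    `|gradient (phi l) x - gradient (phi l) y| <= L l * `|x - y|.
  by apply: filter_forall => l; have [] := hL l.
have nD : \forall rho \near 0^'+, forall z, `|z - a| <= rho -> D z.
  by apply: nbhs_small_ball; exact: D'D.
have nlin := near_gradient_linear oU Ua (ck1 hV) e0.
have [CT CT0 nT] := near_gradient_taylor oU Ua hV.
have [rho [rho0 [[hLr hDr] [hlin hT]]]] : exists rho : R, 0 < rho /\ 
   (((forall l x y, `|x - a| <= rho -> `|y - a| <= rho ->
    `|gradient (phi l) x - gradient (phi l) y| <= L l * `|x - y|) /\ (forall z, `|z - a| <= rho -> D z)) /\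
   ((forall x y, `|x - a| <= rho -> `|y - a| <= rho ->
    `|gradient V0 x - gradient V0 y - hessian V0 a *m (x - y)| <= e * `|x - y|) /\
    (forall x, `|x - a| <= rho ->
    `|gradient V0 x - gradient V0 a - hessian V0 a *m (x - a)| <= CT * `|x - a| ^+ 2))).
  near (0:R)^'+ => rho; exists rho; split; first by near: rho; exact: nbhs_right_gt.
  by split; split; near: rho.
have hLL l x y : `|x - a| <= rho -> `|y - a| <= rho -> `|gradient (phi l) x - gradient (phi l) y| <= LL * `|x - y|.
  by move=> hx hy; apply: (le_trans (hLr l x y hx hy)); rewrite ler_wpM2r.
have /choice[B hB] : forall l, exists B : R, 0 <= B /\ forall x, D x -> `|gradient (phi l) x| <= B.
  by move=> l; have [B B0 h] := gradient_bounded DU cD (ck1 (ck1 (hphi l))); exists B.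
pose BB := \sum_l B l.
have BBl l x : D x -> `|gradient (phi l) x| <= BB.
  have [_ h] := hB l; move=> /h h1; apply: (le_trans h1).
  by rewrite /BB (bigD1 l)//= lerDl sumr_ge0// => j _; have [] := hB j.
have BB0 : 0 <= BB by apply: sumr_ge0 => i _; have [] := hB i.
have [ep ep0 hep] := near_zero_near_root oU DU cD cD' D'a (ck1 (ck1 hV)) uniq rho0.
have [Rad hRad] : exists Rad, forall x, D x -> `|x| <= Rad.
  have [M [_ hM]] := compact_bounded cD; exists (`|M| + 1) => x Dx.
  by apply: hM Dx; rewrite (le_lt_trans (ler_norm _))// ltrDl.
(* Each summand after the 1 encodes one smallness condition on [Delta delta]: Newton's map
   contracts; it preserves the ball; a solution has [gradient V0] below [ep]; the Newton root is
   within [ep] of [D']. *)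
pose M := 1 + 4 * (c0 * LL) + 2 * (c0 * BB) / rho + BB / ep + 2 * n%:R * (c0 * BB) / ep.
have M0 : 1 <= M.
  by rewrite /M -!addrA lerDl !addr_ge0// ?divr_ge0 ?mulr_ge0// ?mulr_ge0// ltW.
have Rad0 : 0 <= Rad by apply: le_trans (hRad a Da).
pose Cg := c0 * (CT * (2 * (c0 * BB)) ^+ 2) + c0 * (LL * (2 * (c0 * BB))).
pose Cb := 2 * Rad * M ^+ 2 + c0 * BB * M.
have Cg0 : 0 <= Cg by rewrite addr_ge0// !mulr_ge0// exprn_ge0// !mulr_ge0.
have Cb0 : 0 <= Cb by rewrite addr_ge0// !mulr_ge0// ?exprn_ge0//; lra.
exists (n%:R * (Cg + Cb) * #|I|%:R); first by rewrite !mulr_ge0// addr_ge0.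
move=> delta c y Dy hsol.
set err := _ - - _.
suff main : `|err| <= (Cg + Cb) * Delta delta ^+ 2.
  apply: (le_trans (enorm_le_norm _)); rewrite -!mulrA ler_wpM2l//.
  apply: (le_trans main); apply: ler_wpM2l; first exact: (addr_ge0 Cg0 Cb0).
  apply: (le_trans (sqr_sum_le (fun l => `|delta l|))); rewrite ler_wpM2l//.
  by apply: ler_sum => l _; rewrite real_normK// num_real.
have D0 := DeltaG delta.
have E1 : err = (y - a) + invmx H *m gphi delta a.
  by rewrite /err opprK gradient_perturb// Va add0r.
(* If [M * Delta delta > 1], the square of this number dominates the diameter of [D], and the number
   itself turns the linear term into a quadratic one. This is the origin of [Cb]. *)
have [hD|hD] := leP (M * Delta delta) 1; last first.
  have h1 : `|err| <= 2 * Rad + c0 * (BB * Delta delta).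
    rewrite E1; apply: (le_trans (ler_normD _ _)); apply: lerD.
      apply: (le_trans (ler_normB _ _)); rewrite mulr_natl mulr2n; apply: lerD; exact: hRad.
    apply: (le_trans (Hinv_norm _)); rewrite ler_wpM2l//.
    by apply: gphi_norm => l; exact: BBl.
  apply: (le_trans h1).
  have h2 : 1 <= (M * Delta delta) ^+ 2 by rewrite exprn_ege1// ltW.
  have h3 : 2 * Rad <= 2 * Rad * (M * Delta delta) ^+ 2 by rewrite ler_peMr// mulr_ge0.
  have h4 : c0 * (BB * Delta delta) <= c0 * (BB * Delta delta) * (M * Delta delta).
    by apply: ler_peMr; [rewrite !mulr_ge0|exact: ltW].
  rewrite [leRHS]mulrDl; apply: (@le_trans _ _ (Cb * Delta delta ^+ 2)); last first.
    by rewrite lerDr mulr_ge0// exprn_ge0.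
  apply: (le_trans (lerD h3 h4)); rewrite le_eqVlt; apply/orP; left; apply/eqP.
  by rewrite /Cb; ring.
have t10 : 0 <= 4 * (c0 * LL) by rewrite !mulr_ge0.
have t20 : 0 <= 2 * (c0 * BB) / rho by rewrite divr_ge0 ?mulr_ge0 ?mulr_ge0// ltW.
have t30 : 0 <= BB / ep by rewrite divr_ge0// ltW.
have t40 : 0 <= 2 * n%:R * (c0 * BB) / ep by rewrite divr_ge0 ?mulr_ge0 ?mulr_ge0// ltW.
have tM t : t <= M -> t * Delta delta <= 1 by move=> h; apply: le_trans hD; rewrite ler_wpM2r.
have h1 : 4 * (c0 * LL) * Delta delta <= 1 by apply: tM; rewrite /M; lra.
have h2 : 2 * (c0 * BB) / rho * Delta delta <= 1 by apply: tM; rewrite /M; lra.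
have h3 : BB / ep * Delta delta <= 1 by apply: tM; rewrite /M; lra.
have h4 : 2 * n%:R * (c0 * BB) / ep * Delta delta <= 1 by apply: tM; rewrite /M; lra.
have {}h1 : c0 * (LL * Delta delta) <= 4^-1 by lra.
have {}h2 : c0 * (BB * Delta delta) <= rho / 2.
  by move: h2; rewrite mulrAC ler_pdivrMr// mul1r; lra.
have {}h3 : BB * Delta delta <= ep by move: h3; rewrite mulrAC ler_pdivrMr// mul1r.
have {}h4 : n%:R * (2 * (c0 * (BB * Delta delta))) <= ep.
  by move: h4; rewrite mulrAC ler_pdivrMr// mul1r; lra.
have [x hx [Dx gx]] := @perturbed_root rho LL BB delta c rho0 hDr hlin hLL (fun l => BBl l a Da) h1 h2.
have [[_ gy] hy] : (D y /\ gradient (perturb delta c) y = 0) /\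
    forall x, D x /\ gradient (perturb delta c) x = 0 -> dist_to D' y <= dist_to D' x.
  by apply: hsol; exists x.
have gV0 : gradient V0 y = - gphi delta y.
  by move: gy; rewrite gradient_perturb; [move=> /eqP; rewrite addr_eq0 => /eqP|exact: DU].
have gn : `|gphi delta y| <= BB * Delta delta by apply: gphi_norm => l; exact: BBl.
(* The selected solution is no farther from [D'] than the Newton root [x], and [x] is close to [a],
   a point of [D']. With the small [gradient V0 y] this meets the conditions of [hep]. *)
have ya : `|y - a| <= rho.
  apply: hep => //; first by rewrite gV0 normrN; exact: le_trans h3.
  apply: (le_trans (hy x (conj Dx gx))); apply: (le_trans (dist_to_le x D'a)).
  apply: (le_trans (enorm_le_norm _)); apply: le_trans h4; exact: ler_wpM2l.
pose w := gradient V0 y - gradient V0 a - H *m (y - a).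
have yaE : y - a = - (invmx H *m w) + invmx H *m gradient V0 y.
  by rewrite /w Va subr0 mulmxBr mulKmx// opprB subrK.
have aa : `|a - a| <= rho by rewrite subrr normr0 ltW.
have wl : `|w| <= e * `|y - a| by exact: hlin.
(* The selected solution may differ from the Newton root, so its distance to [a] is estimated anew;
   the linearization error, a quarter of this distance, is absorbed on the left. *)
have ya2 : `|y - a| <= 2 * (c0 * (BB * Delta delta)).
  have k1 : `|y - a| <= c0 * `|w| + c0 * `|gphi delta y|.
    rewrite {1}yaE; apply: (le_trans (ler_normD _ _)); rewrite normrN; apply: lerD; first exact: Hinv_norm.
    by rewrite gV0; apply: (le_trans (Hinv_norm _)); rewrite normrN.
  have k2 := ler_wpM2l c00 wl; have k3 := ler_wpM2l c00 gn.
  have k4 : c0 * (e * `|y - a|) <= 4^-1 * `|y - a|.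
    rewrite mulrA ler_wpM2r// /e invfM mulrCA ler_piMr//.
    by rewrite ler_pdivrMr ?ltr_wpDl// mul1r lerDl.
  have := normr_ge0 (y - a); lra.
(* Both terms are quadratic in [delta]: [w] by Taylor, the other as [delta] times a Lipschitz
   difference over [|y - a|]. *)
have -> : err = - (invmx H *m w) + invmx H *m (gphi delta a - gphi delta y).
  by rewrite E1 {1}yaE gV0 mulmxBr mulmxN -addrA; congr (_ + _); rewrite mulmxBr addrC.
apply: (le_trans (ler_normD _ _)); rewrite normrN.
apply: (@le_trans _ _ (Cg * Delta delta ^+ 2)); last first.
  by rewrite [leRHS]mulrDl lerDl mulr_ge0// exprn_ge0.
rewrite /Cg [leRHS]mulrDl; apply: lerD.
  apply: (le_trans (Hinv_norm _)); rewrite -mulrA ler_wpM2l//.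
  apply: (le_trans (hT y ya)); rewrite -mulrA ler_wpM2l// -exprMn lerXn2r// ?nnegrE// ?mulr_ge0// ?mulr_ge0//.
  by rewrite -!mulrA.
apply: (le_trans (Hinv_norm _)); rewrite -mulrA ler_wpM2l//.
apply: (@le_trans _ _ (LL * `|a - y| * Delta delta)).
  by apply: gphiB_norm => l; exact: hLL.
rewrite distrC [leRHS](_ : _ = LL * (2 * (c0 * (BB * Delta delta))) * Delta delta); last by ring.
by rewrite ler_wpM2r// ler_wpM2l.
Unshelve. all: by end_near. Qed.

End Det.

(** * The cost as a quadratic form *)

Section Quadratic.
Context {R : realType} {M : nat}.

Definition complex_part (b : bool) (z : R[i]) : R := if b then complex.Re z else complex.Im z.

(** The shift by a quarter turn writes the imaginary part, a sine, as a cosine. *)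
Definition phase (b : bool) : R := if b then 0 else - (pi / 2).

(** The weight matrix is real and acts on real and imaginary parts separately, hence the index pairs
    a component with a part. *)
Definition quad_form (S : 'M[R]_M) (v : 'I_M * bool -> R) : R :=
  \sum_(k : 'I_M * bool) (\sum_j S k.1 j * v (j, k.2)) ^+ 2.

Lemma complex_part_sum b I (s : seq I) (Q : pred I) (F : I -> R[i]) :
  complex_part b (\sum_(i <- s | Q i) F i) = \sum_(i <- s | Q i) complex_part b (F i).
Proof. by case: b; rewrite /complex_part raddf_sum. Qed.

Lemma complex_partB b z z' : complex_part b (z - z') = complex_part b z - complex_part b z'.
Proof. by case: b; rewrite /complex_part raddfB. Qed.

Lemma complex_partZ b (x : R) (z : R[i]) : complex_part b (x%:C%C * z) = x * complex_part b z.
Proof. by case: z => a c; case: b; rewrite /= mul0r ?subr0 ?addr0. Qed.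

Lemma complex_part_cis b (x : R) : complex_part b (cis x) = cos (phase b + x).
Proof.
case: b; rewrite /complex_part /= /phase ?add0r//.
by rewrite addrC cosB cos_pihalf sin_pihalf mulr0 add0r mulr1.
Qed.

Lemma weighted_sqnormE (K : 'M[R]_M) (v : 'cV[R[i]]_M) :
  weighted_sqnorm K v = quad_form (inv_sqrtmx K) (fun l => complex_part l.2 (v l.1 0)).
Proof.
rewrite /weighted_sqnorm /csqnorm /quad_form.
rewrite -(pair_bigA _ (fun k b => (\sum_j inv_sqrtmx K k j * complex_part b (v j 0)) ^+ 2)) /=.
apply: eq_bigr => k _; rewrite big_bool.
have E b : complex_part b ((cmx (inv_sqrtmx K) *m v) k 0) = \sum_j inv_sqrtmx K k j * complex_part b (v j 0).
  by rewrite mxE complex_part_sum; apply: eq_bigr => j _; rewrite mxE complex_partZ.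
rewrite -!E /complex_part /=; case: ((_ *m _) k 0) => x y /=.
by rewrite sqr_sqrtr// addr_ge0 ?sqr_ge0.
Qed.

(** The gradient 2 S^T S v of [quad_form S] at [v], on each of the two parts. *)
Definition quad_slope (S : 'M[R]_M) (v : 'I_M * bool -> R) (l : 'I_M * bool) : R :=
  \sum_k 2 * S k l.1 * \sum_j S k j * v (j, l.2).

Lemma quad_formD (S : 'M[R]_M) (v delta : 'I_M * bool -> R) :
  quad_form S (fun l => v l + delta l) =
  quad_form S v + quad_form S delta + \sum_l delta l * quad_slope S v l.
Proof.
have -> : \sum_l delta l * quad_slope S v l =
    \sum_(k : 'I_M * bool) 2 * (\sum_j S k.1 j * delta (j, k.2)) * (\sum_j S k.1 j * v (j, k.2)).
  rewrite (eq_bigr (fun l => delta (l.1, l.2) * quad_slope S v (l.1, l.2))); last by case.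
  rewrite -(pair_bigA _ (fun j b => delta (j, b) * quad_slope S v (j, b))) /=.
  rewrite -(pair_bigA _ (fun k b => 2 * (\sum_j S k j * delta (j, b)) * (\sum_j S k j * v (j, b)))) /=.
  rewrite exchange_big [RHS]exchange_big /=; apply: eq_bigr => b _.
  rewrite /quad_slope /=; under eq_bigr do rewrite mulr_sumr.
  rewrite exchange_big /=; apply: eq_bigr => k _.
  by rewrite [RHS]mulrAC [RHS]mulr_sumr; apply: eq_bigr => j _; ring.
rewrite /quad_form -!big_split /=; apply: eq_bigr => k _.
under eq_bigr do rewrite mulrDr.
by rewrite big_split /=; ring.
Qed.

Context {n : nat}.

Lemma ck_quad_form k (U : set 'cV[R]_n) (S : 'M[R]_M) (v : 'I_M * bool -> 'cV[R]_n -> R) :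
  open U -> (forall l, ck k U (v l)) -> ck k U (fun x => quad_form S (fun l => v l x)).
Proof.
move=> oU hv; apply: ck_sum => // q.
have hs : ck k U (fun x => \sum_j S q.1 j * v (j, q.2) x).
  by apply: ck_sum => // j; apply: ckM => //; exact: ck_cst.
by under eq_fun do rewrite expr2; exact: ckM.
Qed.

Lemma ck_quad_slope k (U : set 'cV[R]_n) (S : 'M[R]_M) (v : 'I_M * bool -> 'cV[R]_n -> R) l :
  open U -> (forall l, ck k U (v l)) -> ck k U (fun x => quad_slope S (fun l => v l x) l).
Proof.
move=> oU hv; apply: ck_sum => // q; apply: ckM => //; first exact: ck_cst.
by apply: ck_sum => // j; apply: ckM => //; exact: ck_cst.
Qed.

End Quadratic.

Section Cost.
Context {R : realType} {p r m M : nat}.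
Variables (H : 'cV[R]_p -> 'M[R]_m) (K0 : 'cV[R]_p -> 'cV[R]_m) (L : 'cV[R]_p -> 'rV[R]_m).
Variables (u : 'I_M -> R) (phi : R -> 'cV[R]_r -> R[i]) (K : 'M[R]_M).

Lemma complex_part_score e eta (l : 'I_M * bool) :
  complex_part l.2 (score u phi e eta l.1 0) = cos (phase l.2 + u l.1 * e) - complex_part l.2 (phi (u l.1) eta).
Proof. by rewrite mxE complex_partB complex_part_cis. Qed.

Lemma costE dy N theta eta : (0 < N)%N ->
  cost H K0 L u phi K dy N theta eta =
  quad_form (inv_sqrtmx K) (fun l =>
    N%:R^-1 * (\sum_(i < N) cos (phase l.2 + u l.1 * innovation H K0 L theta dy i.+1))
    - complex_part l.2 (phi (u l.1) eta)).
Proof.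
move=> N0; rewrite /cost weighted_sqnormE; congr quad_form; apply/funext => l.
rewrite /score_mean mxE summxE.
have -> : (N%:R^-1 : R[i]) = (N%:R^-1 : R)%:C%C.
  by rewrite (fmorphV (@real_complex R)) rmorph_nat.
rewrite complex_partZ complex_part_sum.
under eq_bigr do rewrite complex_part_score.
rewrite big_add1 /= big_mkord sumrB mulrBr; congr (_ - _).
rewrite sumr_const card_ord -(mulr_natl (complex_part _ _) N) mulKf//.
by rewrite pnatr_eq0 -lt0n.
Qed.

Lemma weighted_scoreE e eta : weighted_sqnorm K (score u phi e eta) =
  quad_form (inv_sqrtmx K) (fun l => cos (phase l.2 + u l.1 * e) - complex_part l.2 (phi (u l.1) eta)).
Proof.
by rewrite weighted_sqnormE; congr quad_form; apply/funext => l; exact: complex_part_score.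
Qed.

End Cost.

(** * Integral comparison without measurability, and the [O_M] bound *)

Section OM.
Context {R : realType} {d : measure_display} {Omega : measurableType d}.
Variable P : probability Omega R.

(* The lower-integral definition makes the integral of nonnegative functions monotone without measurability. *)
Lemma ge0_le_integral_nonmeasurable (f g : Omega -> \bar R) :
  (forall w, 0 <= f w)%E -> (forall w, f w <= g w)%E -> (\int[P]_w f w <= \int[P]_w g w)%E.
Proof.
move=> f0 fg; have g0 w : (0 <= g w)%E by exact: le_trans (f0 w) (fg w).
rewrite !ge0_integralTE//; apply: le_ereal_sup => _ [h /= hf <-].
by exists h => //= w; exact: le_trans (hf w) (fg w).
Qed.

(** Raising [g] to infinity on the exceptional null set makes the inequality hold everywhere without
    changing its integral; [f] can be left nonmeasurable. *)
Lemma ae_le_integral_nonmeasurable (f g : Omega -> R) :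
  (forall w, 0 <= f w) -> (forall w, 0 <= g w) -> measurable_fun setT g ->
  {ae P, forall w, f w <= g w} -> (\int[P]_w (f w)%:E <= \int[P]_w (g w)%:E)%E.
Proof.
move=> f0 g0 mg [N [mN PN hN]].
pose g' w := ((g w)%:E + +oo * (\1_N w)%:E)%E.
have mg' : measurable_fun setT g'.
  apply: emeasurable_funD; first exact/measurable_EFinP.
  by apply: measurable_funeM; apply/measurable_EFinP; exact: measurable_indic.
have g'0 w : (0 <= g' w)%E.
  by rewrite adde_ge0 ?lee_fin// mule_ge0 ?lee_fin ?leey// indicE.
apply: (@le_trans _ _ (\int[P]_w g' w)%E).
  apply: ge0_le_integral_nonmeasurable => w; first by rewrite lee_fin.
  have [Nw|Nw] := pselect (N w).
    by rewrite /g' indicE mem_set//= mule1 addey// leey.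
  rewrite /g' indicE memNset//= mule0 adde0 lee_fin.
  by apply: contrapT => h; apply: Nw; exact: hN.
rewrite (@ge0_ae_eq_integral _ _ _ P setT g' (fun w => (g w)%:E))//.
- exact/measurable_EFinP.
- by move=> w _; rewrite lee_fin.
- exists N; split=> // w /= h; apply: contrapT => Nw; apply: h => _.
  by rewrite /g' indicE memNset//= mule0 adde0.
Qed.

(** The converse inequality uses the opposite modification: [g] is set to zero on the null set, so
    that it lies below [f] everywhere. *)
Lemma ae_eq_integral_nonmeasurable (f g : Omega -> R) :
  (forall w, 0 <= f w) -> (forall w, 0 <= g w) -> measurable_fun setT g ->
  {ae P, forall w, f w = g w} -> (\int[P]_w (f w)%:E = \int[P]_w (g w)%:E)%E.
Proof.
move=> f0 g0 mg ae; apply/eqP; rewrite eq_le; apply/andP; split.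
  by apply: ae_le_integral_nonmeasurable => //; apply: filterS ae => w ->.
have [N [mN PN hN]] := ae.
pose g' w := \1_(~` N) w * g w.
have mg' : measurable_fun setT g'.
  by apply: measurable_funM => //; apply: measurable_indic; exact: measurableC.
have g'0 w : 0 <= g' w by rewrite mulr_ge0// indicE.
rewrite -(@ge0_ae_eq_integral _ _ _ P setT (fun w => (g' w)%:E) (fun w => (g w)%:E))//.
- apply: ge0_le_integral_nonmeasurable => w; rewrite lee_fin//.
  rewrite /g'; have [Nw|Nw] := pselect (N w).
    by rewrite indicE memNset ?mul0r//=; apply.
  rewrite indicE mem_set//= mul1r le_eqVlt; apply/orP; left; apply/eqP; apply: contrapT => h.
  by apply: Nw; apply: hN => /= k; apply: h.
- exact/measurable_EFinP.
- exact/measurable_EFinP.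
- by move=> w _; rewrite lee_fin.
- by move=> w _; rewrite lee_fin.
- exists N; split=> // w /= h; apply: contrapT => Nw; apply: h => _.
  by rewrite /g' indicE mem_set//= mul1r.
Qed.

Lemma powR_le_1D (a q : R) (k : nat) : 0 <= a -> 0 <= q -> q <= k%:R -> a `^ q <= 1 + a ^+ k.
Proof.
move=> a0 q0 qk; have [a1|a1] := leP a 1.
  apply: (@le_trans _ _ 1); last by rewrite lerDl exprn_ge0.
  by have := @ge0_ler_powR R q q0 a 1; rewrite powR1; apply; rewrite ?nnegrE.
apply: (@le_trans _ _ (a `^ k%:R)); first by apply: ler_powR => //; exact: ltW.
by rewrite powR_mulrn// lerDr.
Qed.

Lemma sum_pow_le (I : finType) (x : I -> R) k : (forall l, 0 <= x l) ->
  (\sum_l x l) ^+ k.+1 <= #|I|%:R ^+ k.+1 * \sum_l x l ^+ k.+1.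
Proof.
move=> x0; have [l0 _|I0] := pickP I; last first.
  rewrite big_pred0// expr0n/= mulr_ge0 ?exprn_ge0//.
  by apply: sumr_ge0 => l _; rewrite exprn_ge0.
pose l := [arg max_(l > l0) x l]%O.
have hl j : x j <= x l by rewrite /l; case: arg_maxP => // i _ h; exact: h.
apply: (@le_trans _ _ ((#|I|%:R * x l) ^+ k.+1)).
  rewrite lerXn2r ?nnegrE ?mulr_ge0//; first by apply: sumr_ge0.
  by rewrite mulr_natl -sumr_const; apply: ler_sum.
rewrite exprMn ler_wpM2l ?exprn_ge0// (bigD1 l)//= lerDl.
by apply: sumr_ge0 => j _; rewrite exprn_ge0.
Qed.

(** A real exponent [q] is reduced to an integer one by [a^q <= 1 + a^k] with [k >= q], applied to
    [N * Q N]; the factor 1/N is then homogeneous and comes out of the norm. *)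
Lemma OM_of_moments {n : nat} (S : set nat) (X : nat -> Omega -> 'cV[R]_n) (Q : nat -> Omega -> R) (C : R) :
  (forall N, S N -> (0 < N)%N) -> 0 <= C ->
  (forall N, S N -> {ae P, forall w, enorm (X N w) <= C * Q N w}) ->
  (forall N, bounded_measurable (Q N)) -> (forall N w, 0 <= Q N w) ->
  (forall k, exists E : R, forall N, S N -> Ex P (fun w => (N%:R * Q N w) ^+ k) <= E) ->
  is_OM P S X (fun N => N%:R^-1).
Proof.
move=> SN C0 hX bQ Q0 hE q q1.
have q0 : 0 < q by exact: lt_le_trans q1.
pose k := (Num.trunc q).+1.
have qk : q <= k%:R by rewrite ltW// truncnS_gt.
have [E hEk] := hE k.
pose T := (C `^ q * (1 + `|E|)) `^ q^-1.
apply: (@le_lt_trans _ _ T%:E); last exact: ltry.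
apply: ge_ereal_sup => _ [N SNN <-].
have N0 : 0 < N%:R :> R by rewrite ltr0n SN.
have bQN := bQ N.
have i0 : (\int[P]_w ((enorm (X N w)) `^ q)%:E <= ((C / N%:R) `^ q * (1 + `|E|))%:E)%E.
  pose g w := (C / N%:R) `^ q * (1 + (N%:R * Q N w) ^+ k).
  have g0 w : 0 <= g w by rewrite mulr_ge0 ?powR_ge0// addr_ge0// exprn_ge0// mulr_ge0// ltW.
  have bg : bounded_measurable g by rewrite /g; bounded_measurable_tac.
  apply: (@le_trans _ _ (\int[P]_w (g w)%:E)%E).
    apply: ae_le_integral_nonmeasurable => //; first by move=> w; exact: powR_ge0.
      by case: bg.
    apply: filterS (hX N SNN) => w hw.
    have CN0 : 0 <= C / N%:R by rewrite divr_ge0// ltW.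
    have NQ : 0 <= N%:R * Q N w by rewrite mulr_ge0// ltW.
    apply: (@le_trans _ _ ((C / N%:R * (N%:R * Q N w)) `^ q)).
      rewrite ge0_ler_powR ?nnegrE ?mulr_ge0//; [exact: ltW|exact: sqrtr_ge0|].
      by rewrite mulrA divfK ?gt_eqF.
    rewrite powRM// ler_wpM2l ?powR_ge0//.
    by apply: powR_le_1D => //; exact: ltW.
  have -> : (\int[P]_w (g w)%:E = (Ex P g)%:E)%E.
    by rewrite /Ex /Rintegral fineK// integrable_fin_num//; exact: bm_integrable.
  rewrite lee_fin /g ExZ; last by bounded_measurable_tac.
  rewrite ler_wpM2l ?powR_ge0// ExD; [|by bounded_measurable_tac..].
  by rewrite Ex_cst lerD2l; apply: le_trans (hEk N SNN) _; exact: ler_norm.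
have enX w : 0 <= enorm (X N w) by exact: sqrtr_ge0.
rewrite invrK unlock.
under eq_integral do rewrite gee0_abs ?lee_fin// poweR_EFin.
rewrite -lee_pdivlMr// -EFinM.
apply: (@le_trans _ _ (((C / N%:R) `^ q * (1 + `|E|))%:E `^ q^-1)%E).
  apply: gt0_ler_poweR => //; first by rewrite invr_ge0 ltW.
  - by rewrite in_itv /= leey andbT integral_ge0// => w _; rewrite lee_fin powR_ge0.
  - by rewrite in_itv /= leey andbT lee_fin mulr_ge0 ?powR_ge0// addr_ge0.
have E0 : 0 <= 1 + `|E| by rewrite addr_ge0.
have Ni : 0 <= N%:R^-1 :> R by rewrite invr_ge0 ltW.
rewrite poweR_EFin lee_fin (powRM q C0 Ni) mulrAC powRM ?mulr_ge0 ?powR_ge0//.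
by rewrite -(powRrM N%:R^-1) mulfV ?gt_eqF// powRr1.
Qed.

End OM.

Section Parts.
Context {R : realType} {r : nat}.

Lemma ck_common_domain {I : finType} k (D : set 'cV[R]_r) (f : I -> 'cV[R]_r -> R) :
  (forall i, ck_on k D (f i)) ->
  exists U : set 'cV[R]_r, [/\ open U, D `<=` U & forall i, ck k U (f i)].
Proof.
move=> /choice[V hV]; exists [set x | forall i, V i x]; split.
- rewrite openE => x /= Vx; apply: (@filter_forall _ I V (nbhs x) (nbhs_filter x)) => i.
  by have [oV _ _] := hV i; exact: open_nbhs_nbhs.
- by move=> x Dx i; have [_ DV _] := hV i; exact: DV.
- by move=> i; have [_ _] := hV i; apply: ck_subset => x; apply.
Qed.

End Parts.

(** * Asymptotic and empirical cost as quadratic forms *)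

Section Decomposition.
Context {R : realType} {d : measure_display} {Omega : measurableType d}.
Variable P : probability Omega R.
Context {M : nat}.

Lemma quad_form_ge0 (S : 'M[R]_M) v : 0 <= quad_form S v.
Proof. by apply: sumr_ge0 => k _; exact: sqr_ge0. Qed.

Lemma bm_quad_form (S : 'M[R]_M) (v : 'I_M * bool -> Omega -> R) :
  (forall l, bounded_measurable (v l)) -> bounded_measurable (fun w => quad_form S (fun l => v l w)).
Proof.
move=> bv; apply: bm_sum => k; apply: bmX; apply: bm_sum => j.
by apply: bmM => //; exact: bm_cst.
Qed.

(** Bias-variance decomposition: the cross term is linear in centered variables and vanishes, and
    the variance term is free of [al], the only place where [eta] enters. *)
Lemma Ex_quad_form (S : 'M[R]_M) (F : 'I_M * bool -> Omega -> R) (al : 'I_M * bool -> R) :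
  (forall l, bounded_measurable (F l)) ->
  Ex P (fun w => quad_form S (fun l => F l w - al l)) =
  quad_form S (fun l => Ex P (F l) - al l) + Ex P (fun w => quad_form S (fun l => F l w - Ex P (F l))).
Proof.
move=> bF; set z := fun l => Ex P (F l).
have bFz l : bounded_measurable (fun w => F l w - z l) by apply: bmB => //; exact: bm_cst.
transitivity (Ex P (fun w => quad_form S (fun l => z l - al l) + quad_form S (fun l => F l w - z l)
   + \sum_l quad_slope S (fun l => z l - al l) l * (F l w - z l))).
  congr (Ex P _); apply/funext => w.
  under [in RHS]eq_bigr do rewrite mulrC.
  rewrite -quad_formD; congr quad_form; apply/funext => l; ring.
have bq : bounded_measurable (fun w => quad_form S (fun l => F l w - z l)) by exact: bm_quad_form.
have bc : @bounded_measurable _ _ Omega (fun=> quad_form S (fun l => z l - al l)) by exact: bm_cst.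
have bs l : bounded_measurable (fun w => quad_slope S (fun l => z l - al l) l * (F l w - z l)).
  by apply: bmM => //; exact: bm_cst.
rewrite ExD; [|by apply: bm_integrable; exact: bmD|by apply: bm_integrable; exact: bm_sum].
rewrite ExD; [|exact: bm_integrable bc|exact: bm_integrable bq].
rewrite Ex_cst (Ex_sum _ _ (fun l => bm_integrable P (bs l))).
rewrite big1 ?addr0// => l _; rewrite ExZ; last exact: bm_integrable (bFz l).
rewrite ExB; [|exact: bm_integrable (bF l)|by apply: bm_integrable; exact: bm_cst].
by rewrite Ex_cst subrr mulr0.
Qed.

End Decomposition.

Section Moments.
Context {R : realType} {d : measure_display} {Omega : measurableType d}.
Variable P : probability Omega R.

Lemma mean_square_moments {I : finType} (F : I -> nat -> Omega -> R) (z : I -> R) :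
  (forall l i, bounded_measurable (F l i)) ->
  (forall l k, exists2 B : R, 0 <= B & forall N, (0 < N)%N ->
    Ex P (fun w => (\sum_(i < N) (F l i w - z l)) ^+ k.*2.+2) <= B * N%:R ^+ k.+1) ->
  forall k, exists E : R, forall N, (0 < N)%N ->
    Ex P (fun w => (N%:R * \sum_l (N%:R^-1 * (\sum_(i < N) F l i w) - z l) ^+ 2) ^+ k) <= E.
Proof.
(* [hB] starts with the second moment, so the zeroth is treated apart. *)
move=> bF hB [|k]; first by exists 1 => N _; rewrite Ex_cst.
have /choice[B hB'] : forall l, exists B : R, 0 <= B /\ forall N, (0 < N)%N ->
    Ex P (fun w => (\sum_(i < N) (F l i w - z l)) ^+ k.*2.+2) <= B * N%:R ^+ k.+1.
  by move=> l; have [B B0 h] := hB l k; exists B.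
exists (#|I|%:R ^+ k.+1 * \sum_l B l) => N N0.
have NR : 0 < N%:R :> R by rewrite ltr0n.
pose T l w := \sum_(i < N) (F l i w - z l).
have bT l : bounded_measurable (T l) by apply: bm_sum => i; apply: bmB => //; exact: bm_cst.
have ET l w : N%:R * (N%:R^-1 * (\sum_(i < N) F l i w) - z l) ^+ 2 = N%:R^-1 * T l w ^+ 2.
  rewrite /T sumrB sumr_const card_ord -mulr_natl.
  by field; rewrite gt_eqF.
pose g w := #|I|%:R ^+ k.+1 * \sum_l N%:R ^- k.+1 * T l w ^+ k.*2.+2.
have bg l : bounded_measurable (fun w => N%:R ^- k.+1 * T l w ^+ k.*2.+2).
  by apply: bmM; [exact: bm_cst|exact: bmX].
apply: (@le_trans _ _ (Ex P g)).
  apply: Ex_le.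
  - apply: bm_integrable; apply: bmX; apply: bmM; first exact: bm_cst.
    apply: bm_sum => l; apply: bmX; apply: bmB; last exact: bm_cst.
    by apply: bmM; [exact: bm_cst|exact: bm_sum].
  - by apply: bm_integrable; apply: bmM; [exact: bm_cst|exact: bm_sum].
  - move=> w; rewrite mulr_sumr.
    under eq_bigr do rewrite ET.
    apply: le_trans (sum_pow_le _ _) _.
      by move=> l; rewrite mulr_ge0 ?sqr_ge0// invr_ge0 ltW.
    rewrite /g ler_wpM2l ?exprn_ge0//; apply: ler_sum => l _.
    by rewrite exprMn exprVn -exprM mul2n doubleS.
rewrite /g ExZ; last by apply: bm_integrable; exact: bm_sum.
rewrite ler_wpM2l ?exprn_ge0// Ex_sum; last by move=> l; exact: bm_integrable (bg l).
apply: ler_sum => l _; rewrite ExZ; last by apply: bm_integrable; exact: bmX.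
have [_ /(_ N N0) h] := hB' l.
by rewrite mulrC ler_pdivrMr ?exprn_gt0.
Qed.

End Moments.

Section Cost.
Context {R : realType} {d : measure_display} {Omega : measurableType d}.
Variable P : probability Omega R.
Context {p r m M : nat}.
Variables (H : 'cV[R]_p -> 'M[R]_m) (K0 : 'cV[R]_p -> 'cV[R]_m) (L : 'cV[R]_p -> 'rV[R]_m).
Variables (u : 'I_M -> R) (phi : R -> 'cV[R]_r -> R[i]) (K : 'M[R]_M).

Let al (l : 'I_M * bool) eta := complex_part l.2 (phi (u l.1) eta).
Let cs (l : 'I_M * bool) (x : R) := cos (phase l.2 + u l.1 * x).
Let S := inv_sqrtmx K.

Lemma bm_score (s : Omega -> R) l : measurable_fun setT s -> bounded_measurable (fun w => cs l (s w)).
Proof. exact: bm_cosT. Qed.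

Lemma asymptotic_costE (dy : Omega -> int -> R) theta (s : Omega -> R) :
  measurable_fun setT s ->
  {ae P, forall w, s w = innovation_stationary H K0 L theta (dy w) 0} ->
  asymptotic_cost H K0 L u phi K P dy theta =
  (fun eta => quad_form S (fun l => Ex P (fun w => cs l (s w)) - al l eta)
    + Ex P (fun w => quad_form S (fun l => cs l (s w) - Ex P (fun w => cs l (s w))))).
Proof.
move=> ms hs; apply/funext => eta.
rewrite -Ex_quad_form; last by move=> l; exact: bm_score.
rewrite /asymptotic_cost unlock /Ex /Rintegral; congr fine.
apply: ae_eq_integral_nonmeasurable.
- by move=> w; rewrite weighted_scoreE quad_form_ge0.
- by move=> w; exact: quad_form_ge0.
- have [] // : bounded_measurable (fun w => quad_form S (fun l => cs l (s w) - al l eta)).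
  by apply: bm_quad_form => l; apply: bmB; [exact: bm_score|exact: bm_cst].
- by apply: filterS hs => w sw; rewrite weighted_scoreE -sw.
Qed.

(** An exact identity, by expanding the square around [z]. With [v] the variance constant of the
    asymptotic cost, the base function is that cost, and [- v] removes the constant again. *)
Lemma cost_perturb (dy : int -> R) theta N (z : 'I_M * bool -> R) v : (0 < N)%N ->
  let delta l := N%:R^-1 * (\sum_(i < N) cs l (innovation H K0 L theta dy i.+1)) - z l in
  cost H K0 L u phi K dy N theta =
  perturb (fun eta => quad_form S (fun l => z l - al l eta) + v)
    (fun l eta => quad_slope S (fun l => z l - al l eta) l) delta (quad_form S delta - v).
Proof.
move=> N0 delta; apply/funext => eta.
rewrite costE// /perturb.
have -> : (fun l => N%:R^-1 * (\sum_(i < N) cos (phase l.2 + u l.1 * innovation H K0 L theta dy i.+1))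
    - complex_part l.2 (phi (u l.1) eta)) = (fun l => (z l - al l eta) + delta l).
  by apply/funext => l; rewrite /delta /al /cs; ring.
by rewrite quad_formD; ring.
Qed.

End Cost.

Theorem theorem6p1
  (R : realType) (d : measure_display) (Omega : measurableType d)
  (P : probability Omega R)
  (p r m M : nat)
  (* parameter domains *)
  (Gtheta Dtheta Dtheta' : set 'cV[R]_p) (thetas : 'cV[R]_p)
  (Geta Deta Deta' : set 'cV[R]_r) (etas : 'cV[R]_r)
  (hDtheta : compact_domain Dtheta) (hDtheta' : compact_domain Dtheta')
  (hthetas : Dtheta' thetas) (hDDtheta : Dtheta' `<=` Dtheta°)
  (hDGtheta : Dtheta `<=` Gtheta)
  (hDeta : compact_domain Deta) (hDeta' : compact_domain Deta')
  (hetas : Deta' etas) (hDDeta : Deta' `<=` Deta°)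
  (hDGeta : Deta `<=` Geta)
  (* driving noise *)
  (b : 'cV[R]_r -> R) (nu : 'cV[R]_r -> {measure set R -> \bar R})
  (hnu : forall eta, Geta eta -> levy_measure (nu eta))
  (Z : R -> {RV P >-> R}) (hZ : levy_process (b etas) (nu etas) Z)
  (h : R) (hh : 0 < h)
  (* system *)
  (H : 'cV[R]_p -> 'M[R]_m) (K0 : 'cV[R]_p -> 'cV[R]_m)
  (L : 'cV[R]_p -> 'rV[R]_m)
  (hA : forall w : R[i], normc w <= 1 ->
    cck_on 3 Dtheta (fun theta => transfer (H theta) (K0 theta) (L theta) w))
  (* scores *)
  (u : 'I_M -> R) (K : 'M[R]_M) (hK : sym_posdef K)
  (hphi : forall k, cck_on 3 Deta (noise_cf h b nu (u k))) :
  let dZ := increment Z h in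
  let dy := fun w => observed H K0 L thetas (dZ^~ w) in
  let phi := noise_cf h b nu in
  let V := fun N theta w => cost H K0 L u phi K (dy w) N theta in
  let W := asymptotic_cost H K0 L u phi K P dy in
  let etastar := eta_star H K0 L u phi K P dy Deta' in
  let sizes := [set N : nat | (0 < N)%N /\ (r <= N * M)%N] in
  (* (1) *)
  (forall theta, Gtheta theta ->
     stable_mx (H theta) /\ stable_mx (H theta - K0 theta *m L theta)) ->
  (* (2) *)
  (forall q : R, 1 <= q ->
     (\int[nu etas]_(x in [set x : R | (1 <= `|x|)%R]) (`|x| `^ q)%:E
        < +oo)%E) ->
  (forall n, ('E_P[dZ n] = 0)%E) ->
  (* (3) *)
  (forall theta, Dtheta theta ->
     exists! eta, Deta' eta /\ gradient (W theta) eta = 0) ->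
  forall (theta : 'cV[R]_p) (etahat : nat -> Omega -> 'cV[R]_r),
  Dtheta theta ->
  hessian (W theta) (etastar theta) \in unitmx ->
  (forall N, sizes N ->
     ecf_estimator H K0 L u phi K P dy Deta Deta' N theta (etahat N)) ->
  is_OM P sizes
    (fun N w => (etahat N w - etastar theta)
       - (- (invmx (hessian (W theta) (etastar theta))
              *m gradient (V N theta w) (etastar theta))))
    (fun N => N%:R^-1).
Proof.
move=> dZ dy phi V W etastar sizes hstable _ hmean huniq theta etahat Dth hHess hest.
have [sH _] : stable_mx (H thetas) /\ stable_mx (H thetas - K0 thetas *m L thetas).
  by apply: hstable; apply: hDGtheta; apply: interior_subset; exact: hDDtheta.
have [_ sHKL] := hstable theta (hDGtheta _ Dth).
have mX n : measurable_fun setT (dZ n) by exact: measurable_increment.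
have iX n : P.-integrable setT (EFin \o dZ n).
  by apply: expectation_fin_integrable => //; rewrite hmean.
have law n k B : measurable B -> P [set w | B (dZ n w)] = P [set w | B (dZ k w)].
  by move=> mB; exact: (increment_law hZ hh).
have muX n : Ex P (fun w => `|dZ n w|) <= Ex P (fun w => `|dZ 0 w|).
  by rewrite (Ex_abs_eq_law (mX n) (mX 0)) // => B; exact: law.
have lawX n k f : bounded_measurable f -> Ex P (fun w => f (dZ n w)) = Ex P (fun w => f (dZ k w)).
  by apply: Ex_eq_law => // B; exact: law.
have indX := increment_independent hZ hh.
(* The noise passes through the system at [thetas] and then through the inverse at [theta]. *)
have [D [rho [c [e [s [[D0 rho01 hc cc] [me ms ec sc inno]]]]]]] :=
  filter_process mX iX muX (K0 thetas) (L thetas) (K0 theta) (- L theta) sH sHKL.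
pose I := ('I_M * bool)%type.
pose al (l : I) eta := complex_part l.2 (phi (u l.1) eta).
pose cs (l : I) (x : R) := cos (phase l.2 + u l.1 * x).
pose z (l : I) := Ex P (fun w => cs l (s w)).
pose S := inv_sqrtmx K.
pose v := Ex P (fun w => quad_form S (fun l => cs l (s w) - z l)).
pose W0 eta := quad_form S (fun l => z l - al l eta) + v.
have WE : W theta = W0.
  by apply: asymptotic_costE => //; apply: filterS inno => w [].
have [U [oU DU hU]] : exists U : set 'cV[R]_r, [/\ open U, Deta `<=` U & forall l, ck 3 U (al l)].
  apply: (@ck_common_domain _ _ _ 3 Deta al) => -[k b']; have [hr hi] := hphi k.
  by case: b'; rewrite /al /complex_part; [exact: hr|exact: hi].
have hdiff l : ck 3 U (fun eta => z l - al l eta).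
  have -> : (fun eta => z l - al l eta) = (fun eta => z l + (-1) * al l eta).
    by apply/funext => eta; ring.
  by apply: (ckD oU); [exact: ck_cst|apply: (ckM oU); [exact: ck_cst|exact: hU]].
have hW : ck 3 U (W theta).
  by rewrite WE; apply: (ckD oU); [exact: (ck_quad_form _ oU)|exact: ck_cst].
have cDeta' : closed Deta'.
  by have [_ [G [_ _ _ ->]]] := hDeta'; exact: closed_closure.
have [eta0 [[eta0D eta0W] eta0u]] := huniq theta Dth.
(* Existence in (3) rules out the default value of [xget]. *)
have [D'a Wa] : Deta' (etastar theta) /\ gradient (W theta) (etastar theta) = 0.
  by rewrite /etastar /eta_star; case: xgetP => [x _ []|/(_ eta0)[]].
have uniq x : Deta' x -> gradient (W theta) x = 0 -> x = etastar theta.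
  by move=> D'x Wx; rewrite -(eta0u x)// -(eta0u (etastar theta)).
have [C C0 hC] := perturbed_root_expansion oU DU hDeta.1 cDeta' hDDeta hW
  (fun l => ck_quad_slope S l oU hdiff) D'a Wa uniq hHess.
(* Formed with the measurable versions [e], so that this majorant of the remainder is bounded and
   measurable; it is tied to the innovations almost surely. *)
pose Q N w := \sum_l (N%:R^-1 * (\sum_(i < N) cs l (e i.+1 w)) - z l) ^+ 2.
have bF l i : bounded_measurable (fun w => cs l (e i.+1 w)) by exact: bm_score.
apply: (OM_of_moments (Q := Q) (C := C)) => //.
- by move=> N [].
- move=> N hN; have [_ De aeN] := hest N hN.
  have N0 : (0 < N)%N by case: hN.
  apply: filterS2 inno aeN => w [ew sw] hw.
  pose delta l := N%:R^-1 * (\sum_(i < N) cs l (e i.+1 w)) - z l.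
  have dE : delta = fun l => N%:R^-1 * (\sum_(i < N) cs l (innovation H K0 L theta (dy w) i.+1)) - z l.
    by apply/funext => l; rewrite /delta; congr (_ * _ - _); apply: eq_bigr => i _; rewrite ew.
  have VE : V N theta w = perturb (W theta) (fun l eta => quad_slope S (fun l => z l - al l eta) l)
      delta (quad_form S delta - v).
    by rewrite WE dE; exact: cost_perturb.
  rewrite VE; apply: hC; first exact: De.
  by rewrite -VE; exact: hw.
- move=> N; apply: bm_sum => l; apply: bmX; apply: bmB; last exact: bm_cst.
  by apply: bmM; [exact: bm_cst|exact: bm_sum].
- by move=> N w; apply: sumr_ge0 => l _; exact: sqr_ge0.
- move=> k.
  have [E hE] := mean_square_moments bF
    (fun l k => process_moment mX iX indX lawX muX D0 rho01 hc cc me ms ec sc (u l.1) (phase l.2) k) k.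
  by exists E => N [N0 _]; exact: hE.
Qed.
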